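(* Let $D$ be a Drinfeld $A$-module over $\operatorname{Spec}\mathcal{O}_K$ with residual characteristic $\mathfrak{p}_0$, let $\lambda\in D(K)$, and consider the homomorphism $[\lambda,\ )_{\mathrm{ad}}\colon J_K\to\hat T D$. Then: (a) this homomorphism vanishes on the ramification subgroup $J_K^{\|\lambda\|+1}$; in particular it vanishes altogether when $\|\lambda\|=0$. (b) If the height $\|\lambda\|$ is prime to $p$, then $[\lambda,\ )_{\mathrm{ad}}$ maps $J_K^{\|\lambda\|}$ surjectively onto $\hat T D$.
   Context: $\mathbb{F}_q$ finite field of characteristic $p$; $K\supset\mathbb{F}_q$ a local field of characteristic $p$, $\mathcal{O}_K$, $\mathfrak{p}_K$, normalized valuation $v$; $K^s$ separable closure, $K^{ur}$ maximal unramified extension, $G_K$, inertia $I_K$, upper ramification filtration $I_K^u$ ($u\in\mathbb{Q}_{\geqslant0}$). $J_K=I_K^{ab}/(I_K^{ab})^{p}$ (maximal quotient of $I_K$ abelian of exponent $p$) and $J_K^u$ is the image of $I_K^u$ in $J_K$. $F$ global function field over $\mathbb{F}_q$, $\infty$ a place, $A$ the ring of elements regular outside $\infty$. $D$: a homomorphism $\varphi\colon A\to\mathcal{O}_K[\tau]$ which is a Drinfeld module over $K$ and whose reduction mod $\mathfrak{p}_K$ has the same rank; characteristic homomorphism $\iota(a)$ = constant coefficient of $\varphi(a)$; $\mathfrak{p}_0=\iota^{-1}(\mathfrak{p}_K)$. For a field $L\supset K$, $D(L)$ is $L$ with $A$-action $a\cdot x=\varphi(a)(x)$. For a proper ideal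 $\mathfrak{n}\subset A$ not contained in $\mathfrak{p}_0$ let $D_\mathfrak{n}=\operatorname{Hom}_A(\mathfrak{n}^{-1}/A,D(K^s))$; an inclusion $\mathfrak{n}'\subset\mathfrak{n}$ induces $D_{\mathfrak{n}'}\to D_\mathfrak{n}$, and $\hat TD=\varprojlim_\mathfrak{n}D_\mathfrak{n}$ (with the inverse limit topology). Kummer pairing: for $\lambda\in D(K^{ur})$ choose an $A$-linear $f\colon\mathfrak{n}^{-1}\to D(K^s)$ with $f(1)=\lambda$; for $g\in I_K$, $g\circ f-f$ vanishes on $A$ and defines $[\lambda,g)_\mathfrak{n}\in D_\mathfrak{n}$, independent of $f$; these are compatible and define $[\lambda,g)_{\mathrm{ad}}\in\hat TD$; the map $g\mapsto[\lambda,g)_{\mathrm{ad}}$ is a homomorphism factoring through $J_K$. Height: $\|\lambda\|=\max\{0,-v(\lambda)\}$ for $\lambda\in D(K)=K$. *)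

(* Defs.v *)
From HB Require Import structures.
From mathcomp Require Import all_boot all_order all_algebra all_field.
From mathcomp Require Import boolp classical_sets.

Set Implicit Arguments.
Unset Strict Implicit.
Unset Printing Implicit Defensive.

Import Order.TTheory GRing.Theory Num.Theory.
Local Open Scope ring_scope.
Local Open Scope quotient_scope.

(* Normalized discrete valuations. The value at 0, which should be +oo, is set to
   0 by convention: every inequality below treats 0 separately. *)
Record dvaluation (K : fieldType) := DValuation {
  dval :> K -> int;
  dval0 : dval 0 = 0;
  dvalM : forall x y : K, x != 0 -> y != 0 -> dval (x * y) = dval x + dval y;
  dvalD : forall x y : K, x != 0 -> y != 0 -> x + y != 0 ->
            Num.min (dval x) (dval y) <= dval (x + y);
  dval_surj : exists2 x, x != 0 & dval x = 1
}.

Definition val_ge (K : fieldType) (v : dvaluation K) (t : rat) : {pred K} :=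
  fun x => (x == 0) || (t <= (v x)%:~R).

Section ValuationRing.
Variables (K : fieldType) (v : dvaluation K).

Lemma dval1 : v 1 = 0.
Proof.
have := @dvalM K v 1 1 (oner_neq0 K) (oner_neq0 K).
by rewrite mulr1 => /eqP; rewrite -subr_eq subrr eq_sym => /eqP.
Qed.

Lemma dvalX x n : x != 0 -> v (x ^+ n) = v x *+ n.
Proof.
move=> x0; elim: n => [|n IHn]; first by rewrite expr0 mulr0n dval1.
by rewrite exprS dvalM ?expf_neq0 // IHn mulrS.
Qed.

Lemma dval_expr_id x n : (1 < n)%N -> x ^+ n = x -> v x = 0.
Proof.
have [->|x0] := eqVneq x 0; first by rewrite dval0.
case: n => [|[|n]] // _ /(congr1 v).
by rewrite dvalX // mulrS -[RHS]addr0 => /addrI/eqP; rewrite mulrn_eq0 => /eqP.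
Qed.

Lemma dvalN x : v (- x) = v x.
Proof.
have [->|x0] := eqVneq x 0; first by rewrite oppr0.
have N0 : (- 1 : K) != 0 by rewrite oppr_eq0 oner_neq0.
suff vN1 : v (- 1) = 0 by rewrite -mulN1r dvalM // vN1 add0r.
by apply: (@dval_expr_id _ 3) => //; rewrite -signr_odd.
Qed.

Definition valint : {pred K} := fun x => (x == 0) || (0 <= v x).

Lemma valint_subring : subring_closed valint.
Proof.
rewrite /valint; split=> [|x y|x y]; rewrite !unfold_in /=.
- by rewrite dval1 lexx orbT.
- have [->|x0] /= := eqVneq x 0.
    by move=> _; rewrite sub0r oppr_eq0 dvalN.
  have [->|y0] /= := eqVneq y 0; first by move=> ? _; rewrite subr0 (negPf x0).
  move=> vx vy; have [//|xy0] /= := eqVneq (x - y) 0.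
  have Ny0 : - y != 0 by rewrite oppr_eq0.
  by apply: le_trans (dvalD v x0 Ny0 xy0); rewrite le_min vx dvalN.
have [->|x0] /= := eqVneq x 0; first by rewrite mul0r eqxx.
have [->|y0] /= := eqVneq y 0; first by rewrite mulr0 eqxx.
by move=> vx vy; rewrite dvalM // addr_ge0 ?orbT.
Qed.

HB.instance Definition _ := GRing.isSubringClosed.Build K valint valint_subring.

Definition valring : Type := {x : K | x \in valint}.
HB.instance Definition _ := SubChoice.on valring.
HB.instance Definition _ := [SubChoice_isSubComNzRing of valring by <:].

Definition maxideal : {pred valring} := fun x => (val x == 0) || (0 < v (val x)).

Lemma maxideal_closed : idealr_closed maxideal.
Proof.
rewrite /maxideal; split=> [||a x y]; rewrite !unfold_in /=.
- by rewrite eqxx.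
- by rewrite oner_eq0 dval1.
have := valP a; rewrite !unfold_in /=.
have [->|a0] /= := eqVneq (val a) 0; first by move=> _; rewrite mul0r add0r.
move=> va.
have [->|x0] /= := eqVneq (val x) 0; first by move=> _; rewrite mulr0 add0r.
move=> vx.
have ax0 : val a * val x != 0 by rewrite mulf_neq0.
have vax : 0 < v (val a * val x) by rewrite dvalM // ltr_wpDl.
have [->|y0] /= := eqVneq (val y) 0; first by move=> _; rewrite addr0 vax orbT.
move=> vy; have [//|xy0] /= := eqVneq (val a * val x + val y) 0.
by apply: lt_le_trans (dvalD v ax0 y0 xy0); rewrite lt_min vax.
Qed.

HB.instance Definition _ :=
  isIdealr.Build valring maxideal maxideal_closed.

Definition residue_ring : comNzRingType := {ideal_quot maxideal}.

Definition cauchy_complete : Prop :=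
  forall u : nat -> K,
    (forall N : rat, exists M, forall m n, (M <= m)%N -> (M <= n)%N ->
       u m - u n \in val_ge v N) ->
    exists l, forall N : rat, exists M, forall n, (M <= n)%N ->
       u n - l \in val_ge v N.

Definition is_local_field : Prop :=
  cauchy_complete /\ exists s : seq residue_ring, forall x, x \in s.

End ValuationRing.

Arguments maxideal {K} v.

Section RegularRing.
Variables (F : fieldType) (infty : dvaluation F).

(* The places of F are the normalized discrete valuations of F. *)
Definition regular : {pred F} :=
  fun x => `[< forall w : dvaluation F, ~ (w =1 infty) -> x \in valint w >].

Lemma regular_subring : subring_closed regular.
Proof.
split=> [|x y|x y]; rewrite !unfold_in.
- by apply/asboolP => w _; rewrite rpred1.
- by move=> /asboolP xP /asboolP yP; apply/asboolP => w wP;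
    rewrite rpredB ?xP ?yP.
by move=> /asboolP xP /asboolP yP; apply/asboolP => w wP; rewrite rpredM ?xP ?yP.
Qed.

HB.instance Definition _ := GRing.isSubringClosed.Build F regular regular_subring.

Definition regular_ring : Type := {x : F | x \in regular}.
HB.instance Definition _ := SubChoice.on regular_ring.
HB.instance Definition _ := [SubChoice_isSubComNzRing of regular_ring by <:].

(* A copy of F, which may already carry a vector space structure, with its
   structure of module over the ring of regular elements *)
Definition fieldmod : Type := F.
HB.instance Definition _ := GRing.Zmodule.on fieldmod.

Definition fieldmod_scale (a : regular_ring) (x : fieldmod) : fieldmod :=
  (val a * x)%R.

Fact fieldmod_scaleA a b x :
  fieldmod_scale a (fieldmod_scale b x) = fieldmod_scale (a * b) x.
Proof. exact: mulrA. Qed.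
Fact fieldmod_scale1 : left_id 1 fieldmod_scale.
Proof. exact: mul1r. Qed.
Fact fieldmod_scaleDr : right_distributive fieldmod_scale +%R.
Proof. by move=> a x y; exact: mulrDr. Qed.
Fact fieldmod_scaleDl x : {morph fieldmod_scale^~ x : a b / a + b}.
Proof. by move=> a b; exact: mulrDl. Qed.

HB.instance Definition _ := GRing.Zmodule_isLmodule.Build regular_ring fieldmod
  fieldmod_scaleA fieldmod_scale1 fieldmod_scaleDr fieldmod_scaleDl.

Definition ideal_inv (n : {pred regular_ring}) : {pred fieldmod} :=
  fun x => `[< forall a, a \in n -> (val a * x : F) \in regular >].

Lemma ideal_inv_submod n : submod_closed (ideal_inv n).
Proof.
split=> [|a x y]; rewrite !unfold_in.
  by apply/asboolP => b _; rewrite mulr0 rpred0.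
move=> /asboolP xP /asboolP yP; apply/asboolP => b bn.
rewrite mulrDr rpredD ?yP // [_ *: _]/(val a * x)%R mulrCA rpredM ?xP //.
exact: valP a.
Qed.

HB.instance Definition _ n :=
  GRing.isSubmodClosed.Build regular_ring fieldmod (ideal_inv n)
    (ideal_inv_submod n).

Definition inv_module (n : {pred regular_ring}) : Type :=
  {x : fieldmod | x \in ideal_inv n}.
HB.instance Definition _ n := SubChoice.on (inv_module n).
HB.instance Definition _ n := [SubChoice_isSubLmodule of inv_module n by <:].

Fact ideal_inv1 n : (1 : F) \in ideal_inv n.
Proof. by apply/asboolP => a _; rewrite mulr1; exact: valP a. Qed.

Definition inv_one n : inv_module n := Sub (1 : F) (ideal_inv1 n).

End RegularRing.

Section GlobalFunctionField.
Variables (Fq : finFieldType) (F : fieldExtType {fraction {poly Fq}}).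
Variable infty : dvaluation F.

Definition const_fun (c : Fq) : F := (tofrac c%:P)%:A.

Fact const_regular c : const_fun c \in regular infty.
Proof.
apply/asboolP => w _; rewrite unfold_in; apply/orP; right.
suff -> : w (const_fun c) = 0 by [].
apply: (@dval_expr_id _ w _ #|Fq|); first exact: finNzRing_gt1.
by rewrite /const_fun exprZn expr1n -tofracXn -polyC_exp expf_card.
Qed.

Definition const_reg (c : Fq) : regular_ring infty :=
  Sub (const_fun c) (const_regular c).

(* deg a = d, i.e. A/(a) has dimension d over F_q *)
Definition has_degree (a : regular_ring infty) (d : nat) : Prop :=
  exists e : 'I_d -> regular_ring infty, forall x,
    exists! c : {ffun 'I_d -> Fq},
      exists y, x = \sum_(i < d) const_reg (c i) * e i + a * y.

End GlobalFunctionField.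

(* The polynomial \sum_i P`_i 'X^i stands for the twisted polynomial
   \sum_i P`_i tau^i of R[tau], where tau * c = c ^+ q * tau. *)
Definition twisted_mul (R : comNzRingType) (q : nat) (P Q : {poly R}) :
    {poly R} :=
  \sum_(i < size P) \sum_(j < size Q) (P`_i * Q`_j ^+ (q ^ i)) *: 'X^(i + j).

Definition twisted_eval (R : comNzRingType) (q : nat) (P : {poly R}) (x : R) :
    R :=
  \sum_(i < size P) P`_i * x ^+ (q ^ i).

Section TwistedTheory.
Variables (Fq : finFieldType) (L : fieldType) (iota : {rmorphism Fq -> L}).
Local Notation q := #|Fq|.

Lemma frobD i (x y : L) : (x + y) ^+ (q ^ i) = x ^+ (q ^ i) + y ^+ (q ^ i).
Proof.
have [p p_pr pF] := finPcharP Fq; apply: exprDn_pchar.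
have := card_pprimeChar pF; rewrite -[#|pPrimeCharType _|]/q => ->.
have pL : p \in [pchar L] by apply: (rmorph_pchar iota).
by rewrite -expnM pnatX (eq_pnat _ (pcharf_eq pL)) pnat_id.
Qed.

Lemma frob0 i : (0 : L) ^+ (q ^ i) = 0.
Proof.
by apply: (addrI (0 ^+ (q ^ i))); rewrite addr0 -frobD addr0.
Qed.

Lemma twisted_eval_wide n (P : {poly L}) x : (size P <= n)%N ->
  twisted_eval q P x = \sum_(i < n) P`_i * x ^+ (q ^ i).
Proof.
move=> Pn; rewrite /twisted_eval (big_ord_widen n (fun i => P`_i * x ^+ (q ^ i))) //.
rewrite big_mkcond; apply: eq_bigr => i _; case: ltnP => // Pi.
by rewrite nth_default ?mul0r.
Qed.

Lemma twisted_evalDr (P : {poly L}) : {morph twisted_eval q P : x y / x + y}.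
Proof.
by move=> x y; rewrite -big_split; apply: eq_bigr => i _; rewrite frobD mulrDr.
Qed.

Lemma twisted_evalDl x :
  {morph (fun P : {poly L} => twisted_eval q P x) : P Q / P + Q}.
Proof.
move=> P Q /=; pose n := maxn (size P) (size Q).
rewrite !(@twisted_eval_wide n) ?leq_maxl ?leq_maxr ?size_polyD //.
by rewrite -big_split; apply: eq_bigr => i _; rewrite coefD mulrDl.
Qed.

Lemma twisted_eval0 x : twisted_eval q (0 : {poly L}) x = 0.
Proof. by rewrite /twisted_eval size_poly0 big_ord0. Qed.

Lemma twisted_evalZX (c : L) n x :
  twisted_eval q (c *: 'X^n) x = c * x ^+ (q ^ n).
Proof.
rewrite (@twisted_eval_wide n.+1); last first.
  by rewrite (leq_trans (size_scale_leq _ _)) ?size_polyXn.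
rewrite big_ord_recr big1 /= => [|i _].
  by rewrite add0r coefZ coefXn eqxx mulr1.
by rewrite coefZ coefXn ltn_eqF ?ltn_ord ?mulr0 ?mul0r.
Qed.

Lemma twisted_evalM (P Q : {poly L}) x :
  twisted_eval q (twisted_mul q P Q) x = twisted_eval q P (twisted_eval q Q x).
Proof.
rewrite (big_morph _ (twisted_evalDl x) (twisted_eval0 x)); apply: eq_bigr => i _.
rewrite (big_morph _ (twisted_evalDl x) (twisted_eval0 x)).
rewrite (big_morph _ (frobD i) (frob0 i)) mulr_sumr; apply: eq_bigr => j _.
by rewrite twisted_evalZX exprMn -exprM -expnD mulrA addnC.
Qed.

Lemma map_twisted_mul (R : comNzRingType) (f : {rmorphism R -> L})
    (P Q : {poly R}) : injective f ->
  map_poly f (twisted_mul q P Q) = twisted_mul q (map_poly f P) (map_poly f Q).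
Proof.
move=> f_inj; rewrite /twisted_mul rmorph_sum !size_map_inj_poly ?rmorph0 //=.
apply: eq_bigr => i _; rewrite rmorph_sum; apply: eq_bigr => j _ /=.
by rewrite map_polyZ map_polyXn !coef_map rmorphM rmorphXn.
Qed.

End TwistedTheory.

Section Drinfeld.
Variables (Fq : finFieldType) (F : fieldExtType {fraction {poly Fq}}).
Variable infty : dvaluation F.
Local Notation A := (regular_ring infty).
Local Notation q := #|Fq|.

(* deg_tau (phi a) = r * deg a *)
Definition has_rank (R : nzRingType) (phi : A -> {poly R}) (r : nat) : Prop :=
  forall a d, a != 0 -> has_degree a d -> size (phi a) = (r * d).+1.

Variables (K : fieldType) (v : dvaluation K) (iotaK : {rmorphism Fq -> K}).

Record drinfeld_module := DrinfeldModule {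
  dmod :> A -> {poly valring v};
  dmodD : forall a b, dmod (a + b) = dmod a + dmod b;
  dmod1 : dmod 1 = 1;
  dmodM : forall a b, dmod (a * b) = twisted_mul q (dmod a) (dmod b);
  dmodC : forall c, map_poly val (dmod (const_reg infty c)) = (iotaK c)%:P;
  dmod_rank : exists2 r, (0 < r)%N &
    has_rank (fun a => map_poly val (dmod a) : {poly K}) r /\
    has_rank (fun a => map_poly (\pi_(residue_ring v)) (dmod a)) r
}.

Variable D : drinfeld_module.

Definition characteristic (a : A) : valring v := (D a)`_0.

Definition residual_char : {pred A} :=
  fun a => characteristic a \in maxideal v.

End Drinfeld.

Section Points.
Variables (Fq : finFieldType) (F : fieldExtType {fraction {poly Fq}}).
Variables (infty : dvaluation F) (K : fieldType) (v : dvaluation K).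
Variables (iotaK : {rmorphism Fq -> K}).
Variable D : drinfeld_module infty v iotaK.
Variables (L : fieldType) (j : {rmorphism K -> L}).
Local Notation A := (regular_ring infty).
Local Notation q := #|Fq|.

(* D(L): a copy of L, carrying the A-module structure given by D; the unused
   parameters D and j determine that structure. *)
Definition points : Type := let _ := D in let _ := j in L.
HB.instance Definition _ := GRing.Zmodule.copy points L.

Definition points_scale (a : A) (x : points) : points :=
  twisted_eval q (map_poly (j \o val) (D a)) (x : L).

Fact points_scaleA a b x :
  points_scale a (points_scale b x) = points_scale (a * b) x.
Proof.
rewrite /points_scale dmodM map_twisted_mul ?(twisted_evalM (j \o iotaK)) //.
by move=> y z /= /fmorph_inj/val_inj.
Qed.

Fact points_scale1 : left_id 1 points_scale.
Proof.
move=> x; rewrite /points_scale dmod1 rmorph1 /twisted_eval size_poly1 big_ord1.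
by rewrite coefC mul1r expn0 expr1.
Qed.

Fact points_scaleDr : right_distributive points_scale +%R.
Proof. by move=> a x y; exact: (twisted_evalDr (j \o iotaK)). Qed.

Fact points_scaleDl x : {morph points_scale^~ x : a b / a + b}.
Proof.
by move=> a b; rewrite /points_scale dmodD rmorphD; exact: twisted_evalDl.
Qed.

HB.instance Definition _ := GRing.Zmodule_isLmodule.Build A points
  points_scaleA points_scale1 points_scaleDr points_scaleDl.

(* [idealr] is the library's notion of a proper ideal. *)
Record level := Level {
  lvl :> idealr A;
  lvl_residual : exists2 a, a \in (lvl : {pred A}) & a \notin residual_char D
}.

(* Hom_A(n^-1/A, D(L)), which is D_n when L is the separable closure *)
Record tors (n : {pred A}) := Tors {
  tors_fun :> inv_module n -> points;
  tors_linear : linear tors_fun;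
  tors_regular : forall x, (val x : F) \in regular infty -> tors_fun x = 0
}.

Record tate := Tate {
  tate_fun :> forall n : level, tors n;
  tate_compat : forall n n' : level,
    {subset (n' : {pred A}) <= (n : {pred A})} ->
    forall (x : inv_module n) (x' : inv_module n'),
      val x = val x' -> tate_fun n x = tate_fun n' x'
}.

Definition tors0 n : tors n.
Proof. by exists (fun _ => 0) => // a x y; rewrite scaler0 addr0. Defined.

Definition tate0 : tate.
Proof. by exists (fun n : level => tors0 n). Defined.

(* t = [lambda, g)_n *)
Definition kummer_at (lambda : points) (g : L -> L) (n : {pred A})
    (t : tors n) : Prop :=
  exists f : inv_module n -> points,
    [/\ linear f, f (inv_one n) = lambda &
        forall x, t x = (g (f x) : points) - f x].

(* [lambda, g)_ad, the unique element of the Tate module with components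
   [lambda, g)_n; the default value is only used if there is none. *)
Definition kummer_ad (lambda : points) (g : L -> L) : tate :=
  match pselect (exists t : tate, forall n, kummer_at lambda g (t n)) with
  | left ex_t => sval (cid ex_t)
  | right _ => tate0
  end.

End Points.

Definition separable_closure (K L : fieldType) (j : {rmorphism K -> L}) : Prop :=
  (forall x, exists2 P : {poly K}, separable_poly P & root (map_poly j P) x) /\
  (forall P : {poly L}, separable_poly P -> (1 < size P)%N -> exists x, root P x).

Section Unramified.
Variables (K : fieldType) (v : dvaluation K).
Variables (Ks : fieldType) (j : {rmorphism K -> Ks}).

(* A finite extension of K is unramified iff its ramification index is 1, as the
   residue field of K is finite, hence perfect. *)
Definition max_unramified : set Ks := fun y =>
  exists (L : fieldExtType K) (w : dvaluation L) (i : {rmorphism L -> Ks}),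
    [/\ forall a : K, i a%:A = j a, forall a : K, w a%:A = v a &
        exists x, i x = y].

End Unramified.

Section FieldAut.
Variables (L : fieldType) (S : set L).

Record field_aut := FieldAut {
  aut_fun :> L -> L;
  aut_inv : L -> L;
  autK : cancel aut_fun aut_inv;
  aut_invK : cancel aut_inv aut_fun;
  autB : zmod_morphism aut_fun;
  autM : monoid_morphism aut_fun;
  aut_fix : forall x, S x -> aut_fun x = x
}.

HB.instance Definition _ := gen_eqMixin field_aut.
HB.instance Definition _ := gen_choiceMixin field_aut.

Lemma field_autP (g h : field_aut) : g =1 h -> g = h.
Proof.
case: g h => [g g' gK g'K gB gM gS] [h h' hK h'K hB hM hS] /= /funext gh.
subst h; have /funext gh' : g' =1 h' by move=> x; rewrite -{1}[x]h'K gK.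
by subst h'; congr FieldAut; exact: Prop_irrelevance.
Qed.

Definition aut_one : field_aut.
Proof. by exists id id. Defined.

Definition aut_mul (g h : field_aut) : field_aut.
Proof.
exists (g \o h) (aut_inv h \o aut_inv g).
- exact: can_comp (autK g) (autK h).
- exact: can_comp (aut_invK h) (aut_invK g).
- by move=> x y; rewrite /= !autB.
- by split=> [|x y]; rewrite /= ?(autM h).1 ?(autM g).1 // (autM h).2 (autM g).2.
- by move=> x Sx; rewrite /= !aut_fix.
Defined.

Definition aut_invg (g : field_aut) : field_aut.
Proof.
exists (aut_inv g) g; first exact: aut_invK; first exact: autK.
- by move=> x y; apply: (can_inj (autK g)); rewrite autB !aut_invK.
- split=> [|x y]; apply: (can_inj (autK g)).
    by rewrite aut_invK (autM g).1.
  by rewrite (autM g).2 !aut_invK.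
- by move=> x Sx; apply: (can_inj (autK g)); rewrite aut_invK aut_fix.
Defined.

Fact aut_mulA : associative aut_mul.
Proof. by move=> f g h; apply: field_autP. Qed.
Fact aut_mul1 : left_id aut_one aut_mul.
Proof. by move=> f; apply: field_autP. Qed.
Fact aut_mul1r : right_id aut_one aut_mul.
Proof. by move=> f; apply: field_autP. Qed.
Fact aut_mulV : left_inverse aut_one aut_invg aut_mul.
Proof. by move=> f; apply: field_autP => x /=; rewrite autK. Qed.
Fact aut_mulVr : right_inverse aut_one aut_invg aut_mul.
Proof. by move=> f; apply: field_autP => x /=; rewrite aut_invK. Qed.

HB.instance Definition _ := isGroup.Build field_aut
  aut_mulA aut_mul1 aut_mul1r aut_mulV aut_mulVr.

Local Open Scope group_scope.

(* Closed for the Krull topology, i.e. for pointwise convergence with respect to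
   the discrete topology of L *)
Definition krull_closed (H : set field_aut) : Prop :=
  forall g : field_aut, (forall s : seq L, exists2 h, H h & {in s, h =1 g}) -> H g.

Definition is_subgroup (H : set field_aut) : Prop :=
  H 1 /\ forall g h : field_aut, H g -> H h -> H (g / h).

(* The smallest closed subgroup containing all commutators and p-th powers *)
Definition elem_ab_ker (p : nat) : set field_aut := fun g =>
  forall H : set field_aut, is_subgroup H -> krull_closed H ->
    (forall x y : field_aut, H [~ x, y]) -> (forall x : field_aut, H (x ^+ p)) -> H g.

Definition elem_ab_rel p : rel field_aut :=
  fun g h => `[< elem_ab_ker p (g / h) >].

Fact elem_ab_equiv p : equiv_class_of (elem_ab_rel p).
Proof.
split=> [g|g h|g h k].
- by apply/asboolP => H [H1 _] _ _ _; rewrite mulgV.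
- suff sym x y : elem_ab_ker p (x / y) -> elem_ab_ker p (y / x).
    by apply/asboolP/asboolP; exact: sym.
  move=> xy H Hgrp Hcl HR HX; have [H1 HB] := Hgrp.
  by have := HB _ _ H1 (xy H Hgrp Hcl HR HX); rewrite mul1g invgF.
move=> /asboolP hg /asboolP gk; apply/asboolP => H Hgrp Hcl HR HX.
have [H1 HB] := Hgrp; have Hgk := gk H Hgrp Hcl HR HX.
have := HB _ _ (hg H Hgrp Hcl HR HX) (HB _ _ H1 Hgk).
by rewrite mul1g invgK mulgA divgK.
Qed.

Definition elem_ab_eqv p : equiv_rel field_aut :=
  EquivRelPack (elem_ab_equiv p).

(* For G = field_aut, the maximal quotient G^ab/(G^ab)^p of G (as a profinite
   group) which is abelian of exponent p *)
Definition elem_ab_quot (p : nat) : Type := {eq_quot elem_ab_eqv p}.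

HB.instance Definition _ p := EqQuotient.on (elem_ab_quot p).

End FieldAut.

Section Ramification.
Variables (K : fieldType) (v : dvaluation K).

Section Finite.
Variables (L : splittingFieldType K) (w : dvaluation L).

(* The ramification group G_t of Gal(L/K); w is normalized on L. *)
Definition lower_ram (t : rat) : {set gal_of {:L}} :=
  [set s in 'Gal({:L} / 1%AS) |
     `[< forall x, x \in valint w -> s x - x \in val_ge w (t + 1) >]]%g.

(* Herbrand's function, i.e. the integral of #|G_x| / #|G_0| over [0, t] *)
Definition herbrand (t : rat) : rat :=
  let m := Num.truncn t in
  (\sum_(1 <= i < m.+1) #|lower_ram i%:R|%:R +
     (t - m%:R) * #|lower_ram m.+1%:R|%:R) / #|lower_ram 0|%:R.

(* G^u = G_t for u = herbrand t *)
Definition upper_ram (u : rat) : set (gal_of {:L}) := fun s =>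
  exists t : rat, [/\ 0 <= t, herbrand t = u & s \in lower_ram t].

End Finite.

Variables (Ks : fieldType) (j : {rmorphism K -> Ks}) (p : nat).

Definition inertia := field_aut (max_unramified v j).

(* I_K^u is the inverse limit of Gal(L/K)^u over all finite Galois extensions
   L/K inside the separable closure. *)
Definition upper_inertia (u : rat) : set inertia := fun g =>
  forall (L : splittingFieldType K) (w : dvaluation L) (e : nat)
         (i : {rmorphism L -> Ks}),
    galois 1%AS {:L} -> (0 < e)%N -> (forall a : K, w a%:A = v a *+ e) ->
    (forall a : K, i a%:A = j a) ->
    exists2 s, upper_ram w u s & forall x, g (i x) = i (s x).

Definition J : Type := elem_ab_quot (max_unramified v j) p.

Definition upper_J (u : rat) : set J := fun c =>
  exists2 g : inertia, upper_inertia u g & c = \pi_J g.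

End Ramification.

Arguments J {K} v {Ks} j p.
Arguments upper_J {K} v {Ks} j p u _.

Section KummerJ.
Variables (Fq : finFieldType) (F : fieldExtType {fraction {poly Fq}}).
Variables (infty : dvaluation F) (K : fieldType) (v : dvaluation K).
Variables (iotaK : {rmorphism Fq -> K}).
Variable D : drinfeld_module infty v iotaK.
Variables (Ks : fieldType) (j : {rmorphism K -> Ks}) (p : nat).

(* The map induced by [lambda, )_ad on the quotient J of the inertia group. As
   [lambda, )_ad factors through J, the choice of representative is immaterial. *)
Definition kummer_J (lambda : K) (c : J v j p) : tate D j :=
  kummer_ad (j lambda : points D j) (repr c).

(* max {0, - v(lambda)}, where v(0) = +oo *)
Definition height (lambda : K) : nat :=
  if lambda == 0 then 0%N else absz (Num.max 0 (- v lambda)).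

End KummerJ.

Arguments height {K} v lambda.

(* Main.v *)
(** For [a] prime to the residual characteristic, the roots [mu] of [phi_a (X) = lambda] form
    a coset of the [a]-torsion, on which inertia acts trivially: a torsion point has valuation 0,
    and [phi_a] preserves positive valuations. The Kummer pairing of [g] is thus read off from the
    differences [g mu - mu]. Let [L = K (mu)] be the field of all roots, with ramification index [e],
    let [h = ||lambda|| > 0] and let [Q] be the degree of [phi_a]. Comparing valuations gives
    [Q H = e h] for [H = - w mu], and [e <= Q] because inertia acts freely on the roots, so
    [H <= h].

    (a) If [s] is a nontrivial element of the inertia group, [pi] a uniformizer of [L] and
    [C = w (s pi - pi)], then the unit [mu pi ^ H] moves by exactly [H] unless [C <= H + 1]. So [s] is
    not in [G_t] for [t > H], and as Herbrand's function is at most the identity, the group of upper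
    index [h + 1] is trivial.

    (b) If [h] is prime to [p] then [Q] divides [e], so [e = Q], [H = h], and the inertia group
    permutes the roots simply transitively. A product of powers of [mu] and of a uniformizer of [K]
    is a uniformizer of [L], and it shows that [G_0 = G_h], which is therefore also the group of upper
    index [h]. A family of prescribed differences at finitely many levels comes from the level
    generated by a product [b]; the resulting automorphism is lifted to larger fields by Herbrand's
    theorem, and compactness yields an element of the inertia group. *)
Require Import Defs.
From HB Require Import structures.
From mathcomp Require Import all_boot all_order all_fingroup all_algebra all_solvable all_field.
From mathcomp Require Import boolp classical_sets filter.
From mathcomp Require Import zify ring.

Set Implicit Arguments.
Unset Strict Implicit.
Unset Printing Implicit Defensive.

Import Order.TTheory GRing.Theory Num.Theory VectorInternalTheory.
Local Open Scope ring_scope.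
Local Open Scope quotient_scope.

(** * Valuations *)

(** The facts about local fields are drawn from one compactness statement, [bolzano_weierstrass],
    applied to coordinate vectors and the norm [nrm]. It yields the extension of [v] to a finite
    extension, its uniqueness, hence its Galois invariance, and the congruences between
    [x ^+ (p ^ k)] and [x] that stand for the finite residue field. Coordinate estimates lose
    constants; these disappear on passing to high powers, and p-power powers are additive. The ring
    of integers of L is never described by a generator. By [uniformizer_bound] an inertia element
    moves every integer at least as little as it moves [pi], so [w (s pi - pi)] decides everything,
    and Herbrand's function becomes a mean of truncated displacements. Two gaps between the
    definitions and their use have to be bridged. The rank of D controls the size of [D a] only
    through the dimension of A/(a), whose finiteness is [has_degree_exists]. The inertia group is
    defined as fixing the unramified extensions, whereas at a finite layer it is cut out by
    congruences; [fixed_inertia_unramified] and [unramified_fixed] reconcile the two. *)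

Definition vge (K : fieldType) (v : dvaluation K) (n : int) (x : K) : bool :=
  (x == 0) || (n <= v x).

Section Vge.
Variables (K : fieldType) (v : dvaluation K).
Implicit Types (x y : K) (m n : int).

Lemma vge0 n : vge v n 0. Proof. by rewrite /vge eqxx. Qed.

Lemma vgeE n x : x != 0 -> vge v n x = (n <= v x).
Proof. by rewrite /vge => /negPf->. Qed.

Lemma vge_val x : vge v (v x) x. Proof. by rewrite /vge lexx orbT. Qed.

Lemma vgeW m n x : m <= n -> vge v n x -> vge v m x.
Proof. by move=> mn /orP[/eqP->|nx]; rewrite ?vge0 // /vge (le_trans mn nx) orbT. Qed.

Lemma vgeN n x : vge v n (- x) = vge v n x.
Proof. by rewrite /vge oppr_eq0 dvalN. Qed.

Lemma vgeD n x y : vge v n x -> vge v n y -> vge v n (x + y).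
Proof.
have [->|x0] := eqVneq x 0; first by rewrite add0r.
have [->|y0] := eqVneq y 0; first by rewrite addr0.
have [->|xy0] := eqVneq (x + y) 0; first by rewrite vge0.
by rewrite !vgeE // => nx ny; apply: le_trans (dvalD v x0 y0 xy0); rewrite le_min nx.
Qed.

Lemma vgeB n x y : vge v n x -> vge v n y -> vge v n (x - y).
Proof. by move=> nx ny; rewrite vgeD ?vgeN. Qed.

Lemma vgeM m n x y : vge v m x -> vge v n y -> vge v (m + n) (x * y).
Proof.
have [->|x0] := eqVneq x 0; first by rewrite mul0r !vge0.
have [->|y0] := eqVneq y 0; first by rewrite mulr0 !vge0.
by rewrite !vgeE ?mulf_neq0 // dvalM // => mx ny; exact: lerD.
Qed.

Lemma vge1 : vge v 0 1. Proof. by rewrite /vge dval1 lexx orbT. Qed.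

Lemma vgeM0 n x y : vge v 0 x -> vge v n y -> vge v n (x * y).
Proof. by move=> vx /(vgeM vx); rewrite add0r. Qed.

Lemma vge_nat k : vge v 0 k%:R.
Proof. by elim: k => [|k IHk]; rewrite ?vge0 // -natr1 vgeD ?vge1. Qed.

Lemma vgeX n x k : vge v n x -> vge v (n *+ k) (x ^+ k).
Proof.
move=> nx; elim: k => [|k IHk]; first by rewrite mulr0n expr0 vge1.
by rewrite exprS mulrS vgeM.
Qed.

Lemma vgeX0 x k : vge v 0 x -> vge v 0 (x ^+ k).
Proof. by move=> /(@vgeX _ _ k); rewrite mul0rn. Qed.

Lemma vge_sum n (I : Type) (r : seq I) (P : pred I) (F : I -> K) :
  (forall i, P i -> vge v n (F i)) -> vge v n (\sum_(i <- r | P i) F i).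
Proof. by move=> nF; elim/big_ind: _ => //; [exact: vge0 | exact: vgeD]. Qed.

Lemma vge_prod (I : Type) (r : seq I) (P : pred I) (F : I -> K) :
  (forall i, P i -> vge v 0 (F i)) -> vge v 0 (\prod_(i <- r | P i) F i).
Proof. by move=> nF; elim/big_ind: _ => //; [exact: vge1 | exact: vgeM0]. Qed.

Lemma vge_all_eq0 x : (forall N : nat, vge v N%:Z x) -> x = 0.
Proof.
move=> vx; have [//|x0] := eqVneq x 0.
by have := vx (`|v x|%N.+1); rewrite vgeE //; lia.
Qed.

Lemma dvalV x : x != 0 -> v x^-1 = - v x.
Proof.
move=> x0; have := @dvalM K v x x^-1 x0; rewrite invr_eq0 divff // dval1.
by move=> /(_ x0); lia.
Qed.

Lemma dvalZ x n : x != 0 -> v (x ^ n) = v x * n.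
Proof.
move=> x0; case: n => n; first by rewrite -exprnP dvalX // pmulrn mulrzz.
by rewrite NegzE -exprnN dvalV ?expf_neq0 // dvalX // pmulrn mulrzz; lia.
Qed.

Lemma dval_prod (I : Type) (r : seq I) (P : pred I) (F : I -> K) :
  (forall i, P i -> F i != 0) ->
  v (\prod_(i <- r | P i) F i) = \sum_(i <- r | P i) v (F i).
Proof.
move=> F0; suff [] : (\prod_(i <- r | P i) F i != 0) /\
  v (\prod_(i <- r | P i) F i) = \sum_(i <- r | P i) v (F i) by [].
elim/big_rec2: _ => [|i y1 y2 Pi [y20 <-]]; first by rewrite oner_neq0 dval1.
by rewrite mulf_neq0 ?F0 // dvalM ?F0.
Qed.

Lemma vge_addl x z : x != 0 -> vge v (v x + 1) z -> x + z != 0 /\ v (x + z) = v x.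
Proof.
move=> x0; have [->|z0] := eqVneq z 0; first by rewrite addr0.
rewrite vgeE // => vz; have [xz|xz] := eqVneq (x + z) 0.
  by move/eqP: xz vz; rewrite addr_eq0 => /eqP->; rewrite dvalN => h; exfalso; lia.
split=> //; have := dvalD v x0 z0 xz.
have Nz0 : - z != 0 by rewrite oppr_eq0.
have := @dvalD _ v _ _ xz Nz0; rewrite addrK x0 => /(_ isT); rewrite dvalN; lia.
Qed.

Lemma vgeM_inv n x y : x != 0 -> vge v (v x + n) (x * y) = vge v n y.
Proof.
move=> x0; have [->|y0] := eqVneq y 0; first by rewrite mulr0 !vge0.
by rewrite !vgeE ?mulf_neq0 // dvalM // lerD2l.
Qed.

Lemma valintE x : (x \in valint v) = vge v 0 x. Proof. by []. Qed.

Lemma val_geE n x : (x \in val_ge v n%:~R) = vge v n x.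
Proof. by rewrite unfold_in /val_ge ler_int. Qed.

Lemma uniformizer : {x : K | x != 0 & v x = 1}.
Proof.
have h : exists x, (x != 0) && (v x == 1).
  by have [x x0 vx] := dval_surj v; exists x; rewrite x0 vx eqxx.
by have /andP[x0 /eqP vx] := xchooseP h; exists (xchoose h).
Qed.

Lemma vge1_expX k x : vge v 1 (x ^+ k.+1) -> vge v 1 x.
Proof.
have [->|x0] := eqVneq x 0; first by rewrite vge0.
by rewrite !vgeE ?expf_neq0 // dvalX // pmulrn mulrzz; nia.
Qed.

End Vge.

Lemma exprDp (R : fieldType) (p k : nat) (x y : R) : p \in [pchar R] ->
  (x + y) ^+ (p ^ k) = x ^+ (p ^ k) + y ^+ (p ^ k).
Proof.
move=> pR; apply: exprDn_pchar.
by rewrite pnatX (eq_pnat _ (pcharf_eq pR)) pnat_id ?(pcharf_prime pR).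
Qed.

Lemma exprBp (R : fieldType) (p k : nat) (x y : R) : p \in [pchar R] ->
  (x - y) ^+ (p ^ k) = x ^+ (p ^ k) - y ^+ (p ^ k).
Proof. by move=> /(exprDp k (x - y) y); rewrite subrK => ->; rewrite addrK. Qed.

Lemma vge_unit (K : fieldType) (v : dvaluation K) (x : K) :
  vge v 0 x -> ~~ vge v 1 x -> x != 0 /\ v x = 0.
Proof.
have [->|x0] := eqVneq x 0; first by rewrite !vge0.
by rewrite !vgeE //; lia.
Qed.

Lemma min_succ_le (C m : int) (N : nat) : 0 < m -> Num.min C N.+1 <= m + Num.min C N.
Proof. lia. Qed.

Lemma mul_absz_ge0 (e : nat) (z : int) : (0 < e)%N -> 0 <= e%:Z * `|z|%N + z.
Proof. nia. Qed.

Lemma leq_mul_absz (e N : nat) : (0 < e)%N -> N%:Z <= e%:Z * N%:Z.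
Proof. nia. Qed.

Lemma mulrn_eq_dvdn (z : int) (e n : nat) : z *+ e = n%:Z -> (e %| n)%N.
Proof.
by rewrite pmulrn mulrzz => /(congr1 absz); rewrite abszM /= => <-; exact: dvdn_mull.
Qed.

(** * Compactness of the unit ball of a local field *)

Lemma infinite_pigeonhole (C : finType) (f : nat -> C) (S : nat -> Prop) :
  (forall M, exists m, (M <= m)%N /\ S m) ->
  exists c, forall M, exists m, [/\ (M <= m)%N, S m & f m = c].
Proof.
move=> infS; apply: contrapT => /forallNP noc.
have /choice[B BP] c : exists M, forall m, (M <= m)%N -> S m -> f m <> c.
  have /existsNP[M /forallNP MP] := noc c; exists M => m Mm Sm fm.
  by apply: (MP m).
have [m [Bm Sm]] := infS (\max_c B c).
by apply: (BP (f m) m) => //; apply: leq_trans Bm; apply: leq_bigmax.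
Qed.

Section LocalField.
Variables (K : fieldType) (v : dvaluation K).
Hypothesis localK : is_local_field v.

(** Finiteness of the residue field, put as a colouring of K by a finite type, which is what the
    pigeonhole argument consumes; non-integral elements get the arbitrary colour [ord0]. *)
Lemma finite_residue : exists (C : finType) (r : K -> C), forall x y,
  vge v 0 x -> vge v 0 y -> r x = r y -> vge v 1 (x - y).
Proof.
have [_ [s sP]] := localK.
have idx (a : valring v) : (index (\pi_(residue_ring v) a) s < (size s).+1)%N.
  by rewrite ltnS index_size.
pose r x : 'I_(size s).+1 := if insub x is Some a then Ordinal (idx a) else ord0.
exists _, r => x y vx vy; rewrite /r !insubT /= => -[] /(congr1 (nth 0 s)).
rewrite !nth_index // => /eqP; rewrite -Quotient.idealrBE unfold_in /maxideal /=.
by rewrite gtz0_ge1.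
Qed.

(** Successive refinement: among infinitely many terms agreeing modulo [pi ^+ k], infinitely many
    share the residues of their next digits, hence agree modulo [pi ^+ k.+1]. The chosen
    representatives form a Cauchy sequence in each coordinate. *)
Lemma bolzano_weierstrass n (u : nat -> 'rV[K]_n) :
  (forall m i, vge v 0 (u m 0 i)) ->
  exists x : 'rV[K]_n, forall N M : nat, exists m, (M <= m)%N /\
    forall i, vge v N%:Z (u m 0 i - x 0 i).
Proof.
move=> u0; have [C [r rP]] := finite_residue; have [pi pi0 vpi] := uniformizer v.
pose near k m0 m := forall i, vge v k%:Z (u m 0 i - u m0 0 i).
pose inf k m0 := forall M, exists m, (M <= m)%N /\ near k m0 m.
have step k m0 : exists m1, inf k m0 -> near k m0 m1 /\ inf k.+1 m1.
  have [infm|ninf] := pselect (inf k m0); last by exists 0%N.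
  pose f m := [ffun i => r ((u m 0 i - u m0 0 i) / pi ^+ k)].
  have [c cP] := infinite_pigeonhole f infm.
  have [m1 [_ nm1 fm1]] := cP 0%N; exists m1 => _; split=> // M.
  have [m [Mm nm fm]] := cP M; exists m; split=> // i.
  have pik0 : pi ^+ k != 0 by rewrite expf_neq0.
  have vpik : v (pi ^+ k) = k%:Z by rewrite dvalX // vpi natz.
  have int_q m' : near k m0 m' -> vge v 0 ((u m' 0 i - u m0 0 i) / pi ^+ k).
    by move=> /(_ i); rewrite -(vgeM_inv v 0 _ pik0) vpik addr0 mulrCA divff // mulr1.
  have := rP _ _ (int_q _ nm) (int_q _ nm1).
  move: fm; rewrite -fm1 => /ffunP/(_ i); rewrite !ffunE => -> /(_ erefl).
  rewrite -(vgeM_inv v _ _ pik0) vpik -mulrBl mulrCA divff // mulr1.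
  by rewrite opprB addrA subrK -[k.+1]addn1 PoszD.
have /choice[g gP] : forall km : nat * nat, exists m1,
  inf km.1 km.2 -> near km.1 km.2 m1 /\ inf km.1.+1 m1 by move=> [k m]; exact: step.
pose s := fix s k := if k is k'.+1 then g (k', s k') else 0%N.
have infs k : inf k (s k).
  elim: k => [|k IHk]; last exact: (gP (k, s k) IHk).2.
  by move=> M; exists M; split=> // i; rewrite vgeB.
have nears k : near k (s k) (s k.+1) := (gP (k, s k) (infs k)).1.
have near_ge i k l : (k <= l)%N -> vge v k%:Z (u (s l) 0 i - u (s k) 0 i).
  elim: l => [|l IHl]; first by rewrite leqn0 => /eqP->; rewrite subrr vge0.
  rewrite leq_eqVlt => /predU1P[->|]; first by rewrite subrr vge0.
  rewrite ltnS => kl; rewrite -[u (s l.+1) 0 i](subrK (u (s l) 0 i)) -addrA.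
  by rewrite vgeD ?IHl // (vgeW _ (nears l i)).
have [cmpl _] := localK.
have /choice[x xP] i : exists x, forall N : nat, exists M, forall k, (M <= k)%N ->
    vge v N%:Z (u (s k) 0 i - x).
  have [|x xP] := cmpl (fun k => u (s k) 0 i).
    (* Completeness is stated with rational bounds, the construction gives integral ones. *)
    move=> N; pose N' := `|Num.floor N|%N.+1; exists N' => k l Nk Nl.
    have : vge v N'%:Z (u (s k) 0 i - u (s l) 0 i).
      rewrite -[_ - _](subrKA (u (s N') 0 i)) vgeD ?near_ge //.
      by rewrite -vgeN opprB near_ge.
    rewrite /vge unfold_in /val_ge; case: eqVneq => //= _ h.
    have : N <= N'%:~R.
      rewrite /N'; apply: ltW; apply: lt_le_trans (floorD1_gt N) _.
      by rewrite ler_int -addn1 PoszD lerD2r abszE ler_norm.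
    by move=> /le_trans; apply; rewrite ler_int.
  exists x => N; have [M MP] := xP (N%:Z)%:~R; exists M => k /MP.
  by rewrite val_geE.
exists (\row_i x i) => N M.
have /choice[B BP] i := xP i N.
pose k := maxn N (\max_i B i).
have [m [Mm nm]] := infs k M; exists m; split=> // i.
rewrite mxE -[u m 0 i](subrK (u (s k) 0 i)) -addrA vgeD //.
  by apply: vgeW (nm i); rewrite lez_nat leq_maxl.
by apply: BP; rewrite (leq_trans _ (leq_maxr _ _)) // leq_bigmax.
Qed.

End LocalField.

(** * The norm of a finite extension *)

Lemma vge_det n (K : fieldType) (v : dvaluation K) (A : 'M[K]_n) :
  (forall i j, vge v 0 (A i j)) -> vge v 0 (\det A).
Proof.
move=> A0; apply: vge_sum => s _; apply: vgeM0; last exact: vge_prod.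
by rewrite vgeX0 // vgeN vge1.
Qed.

Lemma vge_detB n (K : fieldType) (v : dvaluation K) (A B : 'M[K]_n) (k : int) :
  (forall i j, vge v 0 (A i j)) -> (forall i j, vge v 0 (B i j)) ->
  (forall i j, vge v k (A i j - B i j)) -> vge v k (\det A - \det B).
Proof.
move=> A0 B0 AB; rewrite /determinant -sumrB; apply: vge_sum => s _.
rewrite -mulrBr; apply: vgeM0; first by rewrite vgeX0 // vgeN vge1.
(* Integrality of both partial products is carried along, because the telescoping of a difference of
   products multiplies by them. *)
suff [] : [/\ vge v 0 (\prod_i A i (s i)), vge v 0 (\prod_i B i (s i)) &
   vge v k (\prod_i A i (s i) - \prod_i B i (s i))] by [].
elim/big_rec2: _ => [|i a b _ [b0 a0 ab]]; first by rewrite subrr vge1 vge0.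
split; try exact: vgeM0.
rewrite -[_ - _](subrKA (A i (s i) * a)) -mulrBr -mulrBl.
by apply: vgeD; [|rewrite mulrC]; exact: vgeM0.
Qed.

Lemma vge_finite (K : fieldType) (v : dvaluation K) (I : finType) (F : I -> K) :
  exists B : nat, forall i, vge v (- B%:Z) (F i).
Proof.
exists (\sum_i `|v (F i)|)%N => i; apply: vgeW (vge_val v _).
by rewrite (bigD1 i) //=; lia.
Qed.

Section Norm.
Variables (K : fieldType) (v : dvaluation K) (L : fieldExtType K).
Local Notation n := (vector.dim L).

Definition mult_mx (x : L) : 'M[K]_n := f2mx (amulr x).
(** The norm of L over K. As a determinant in coordinates it is multiplicative and continuous for
    the coordinate topology, before any valuation on L is available. *)
Definition nrm (x : L) : K := \det (mult_mx x).
Definition coord_ge (C : int) (x : L) := forall i, vge v C (v2r x 0 i).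

Lemma mult_mxE x y : v2r (y * x) = v2r y *m mult_mx x.
Proof.
have -> : y * x = amulr x y by rewrite lfunE.
by rewrite unlock /= r2vK.
Qed.

Lemma mult_mxM x y : mult_mx (x * y) = mult_mx x *m mult_mx y.
Proof.
apply/row_matrixP => i; rewrite !rowE mulmxA -[delta_mx 0 i]r2vK.
by rewrite -!mult_mxE mulrA.
Qed.

Lemma mult_mxZ a : mult_mx a%:A = a%:M.
Proof.
apply/row_matrixP => i; rewrite !rowE -[delta_mx 0 i]r2vK -mult_mxE mulr_algr.
by rewrite linearZ /= mul_mx_scalar.
Qed.

Lemma nrmM x y : nrm (x * y) = nrm x * nrm y.
Proof. by rewrite /nrm mult_mxM det_mulmx. Qed.

Lemma nrmZ a : nrm a%:A = a ^+ n.
Proof. by rewrite /nrm mult_mxZ det_scalar. Qed.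

Lemma nrm1 : nrm 1 = 1.
Proof. by rewrite -[1]scale1r nrmZ expr1n. Qed.

Lemma nrmX x k : nrm (x ^+ k) = nrm x ^+ k.
Proof. by elim: k => [|k IHk]; rewrite ?nrm1 // !exprS nrmM IHk. Qed.

Lemma dim_gt0 : (0 < n)%N.
Proof.
rewrite lt0n; apply/eqP => n0; have := oner_neq0 L; rewrite -(v2rK (1 : L)).
suff -> : v2r (1 : L) = 0 by rewrite linear0 eqxx.
by apply/rowP => i; have := ltn_ord i; rewrite [X in (_ < X)%N]n0.
Qed.

Lemma nrm_eq0 x : (nrm x == 0) = (x == 0).
Proof.
have [->|x0] := eqVneq x 0.
  by rewrite -(scale0r (1 : L)) nrmZ expr0n eqn0Ngt dim_gt0 eqxx.
apply: contraTF (oner_neq0 K) => /eqP Nx; rewrite negbK.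
by rewrite -nrm1 -(divff x0) nrmM Nx mul0r.
Qed.

Lemma mult_mx_coord x i j :
  mult_mx x i j = \sum_k v2r x 0 k * mult_mx (r2v (delta_mx 0 k)) i j.
Proof.
suff -> : mult_mx x = \sum_k v2r x 0 k *: mult_mx (r2v (delta_mx 0 k)).
  by rewrite summxE; apply: eq_bigr => k _; rewrite mxE.
apply/row_matrixP => l; rewrite !rowE -[delta_mx 0 l]r2vK.
have xE : x = \sum_k v2r x 0 k *: r2v (delta_mx 0 k).
  rewrite -{1}[x]v2rK {1}[v2r x]row_sum_delta linear_sum.
  by apply: eq_bigr => k _; rewrite linearZ.
rewrite -mult_mxE {1}xE mulr_sumr linear_sum mulmx_sumr; apply: eq_bigr => k _.
by rewrite -scalerAr linearZ /= mult_mxE scalemxAr.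
Qed.

Lemma mult_mx_bound : exists B : nat, forall C x, coord_ge C x ->
  forall i j, vge v (C - B%:Z) (mult_mx x i j).
Proof.
have [B BP] := vge_finite v (fun kij : 'I_n * 'I_n * 'I_n =>
  mult_mx (r2v (delta_mx 0 kij.1.1)) kij.1.2 kij.2).
exists B => C x xC i j; rewrite mult_mx_coord; apply: vge_sum => k _.
by apply: vgeM => //; apply: (BP (k, i, j)).
Qed.

Lemma min_coord x : x != 0 -> exists i, v2r x 0 i != 0 /\ coord_ge (v (v2r x 0 i)) x.
Proof.
move=> x0; have [i0 xi0] : exists i, v2r x 0 i != 0.
  apply/existsP; apply: contraNT x0; rewrite negb_exists => /forallP h.
  apply/eqP/v2r_inj; rewrite linear0; apply/rowP => i; rewrite mxE.
  by have := h i; rewrite negbK => /eqP.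
have [i xi imin] := @arg_minP _ _ _ i0 (fun i => v2r x 0 i != 0) (fun i => v (v2r x 0 i)) xi0.
exists i; split=> // k; have [->|xk] := eqVneq (v2r x 0 k) 0; first exact: vge0.
by rewrite vgeE ?imin.
Qed.

Lemma coord_geD C x y : coord_ge C x -> coord_ge C y -> coord_ge C (x + y).
Proof. by move=> xC yC i; rewrite linearD mxE vgeD. Qed.

Hypothesis localK : is_local_field v.

(** By contradiction and compactness: counterexamples, rescaled to be primitive, accumulate at a
    vector that is nonzero because some coordinate stays a unit, yet has norm 0 by continuity of the
    determinant. *)
Lemma nrm_bounded : exists C : nat, forall x, vge v 0 (nrm x) -> coord_ge (- C%:Z) x.
Proof.
apply: contrapT => /forallNP unb; have [pi pi0 vpi] := uniformizer v.
have /choice[y yP] C : exists y : L, [/\ coord_ge 0 y,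
    (exists i, ~~ vge v 1 (v2r y 0 i)) & vge v C%:Z (nrm y)].
  have /existsNP[x /not_implyP[Nx /existsNP[i /negP xi]]] := unb C.
  have x0 : x != 0 by apply: contraNneq xi => ->; rewrite linear0 mxE vge0.
  have [k [xk kmin]] := min_coord x0; set m := v (v2r x 0 k) in kmin.
  have mC : m <= - C%:Z.
    have [//|/ltW Cm] := leP m (- C%:Z).
    by rewrite (vgeW Cm (kmin i)) in xi.
  (* The scalar [pi ^ (- m)] turns the least coordinate into a unit; as [m <= - C], it raises the
     value of the norm to at least C. *)
  have vpim : v (pi ^ (- m)) = - m by rewrite dvalZ // vpi mul1r.
  have pim0 : pi ^ (- m) != 0 by rewrite expfz_neq0.
  exists (pi ^ (- m) *: x); split.
  - move=> l; rewrite linearZ mxE.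
    by rewrite -[0](addNr m) -{1}vpim vgeM_inv.
  - exists k; rewrite linearZ mxE vgeE ?mulf_neq0 // dvalM // vpim -/m.
    by rewrite addNr.
  rewrite -mulr_algl nrmM nrmZ; have N0 : nrm x != 0 by rewrite nrm_eq0.
  rewrite -[C%:Z]addr0 vgeM //; apply: vgeW (vge_val _ _).
  rewrite dvalX // vpim pmulrn mulrzz; have := dim_gt0; nia.
have [z zP] := bolzano_weierstrass localK (fun m i => (let: And3 h _ _ := yP m in h) i).
have [B BP] := mult_mx_bound.
have [m [_ ymz]] := zP 1%N 0%N.
have [_ [i ymi] _] := yP m.
have z0 : r2v z != 0.
  apply: contraNneq ymi => /(congr1 v2r); rewrite r2vK linear0 => z0.
  by have := ymz i; rewrite z0 mxE subr0.
suff Nz : nrm (r2v z) = 0 by rewrite -nrm_eq0 Nz eqxx in z0.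
(* Making the multiplication matrices integral costs a factor [pi ^+ B], so their determinants lose
   [B * n]. *)
apply: (@vge_all_eq0 _ v) => N; pose N' := (N + B * n)%N.
have {m ymz ymi i}[m [N'm ymz]] := zP N' N'.
have [ym0 _ Nym] := yP m.
have zge : coord_ge 0 (r2v z).
  move=> i; rewrite r2vK -[z 0 i](subKr (v2r (y m) 0 i)) vgeB //.
  by apply: vgeW (ymz i).
have vpiB : v (pi ^+ B) = B%:Z by rewrite dvalX // vpi natz.
have piB0 : pi ^+ B != 0 by rewrite expf_neq0.
have int_sc x : coord_ge 0 x -> forall i j, vge v 0 ((pi ^+ B *: mult_mx x) i j).
  move=> x0 i j; rewrite mxE -[0](subrr B%:Z) -{1}vpiB vgeM_inv //.
  by rewrite -[- _]add0r BP.
have diff i j : vge v N'%:Z ((pi ^+ B *: mult_mx (y m)) i j - (pi ^+ B *: mult_mx (r2v z)) i j).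
  rewrite !mxE -mulrBr -[N'%:Z](subrK B%:Z) addrC -{1}vpiB vgeM_inv //.
  have -> : mult_mx (y m) i j - mult_mx (r2v z) i j = mult_mx (y m - r2v z) i j.
    rewrite !mult_mx_coord -sumrB; apply: eq_bigr => k _.
    by rewrite linearB !mxE mulrBl.
  by apply: BP => k; rewrite linearB /= r2vK !mxE.
have := vge_detB (int_sc _ ym0) (int_sc _ zge) diff; rewrite !detZ -mulrBr.
have vpin : v ((pi ^+ B) ^+ n) = (B * n)%N%:Z by rewrite dvalX // vpiB -mulr_natr natz.
have pin0 : (pi ^+ B) ^+ n != 0 by rewrite expf_neq0.
rewrite /N' PoszD addrC -{1}vpin vgeM_inv // => h.
rewrite -[nrm (r2v z)](subKr (nrm (y m))) vgeB //.
by apply: vgeW Nym; rewrite lez_nat (leq_trans _ N'm) // leq_addr.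
Qed.

End Norm.

(** * Extension of valuations *)

Lemma vge_det_shift n (K : fieldType) (v : dvaluation K) (A : 'M[K]_n) (c : nat) :
  (forall i j, vge v (- c%:Z) (A i j)) -> vge v (- (c * n)%N%:Z) (\det A).
Proof.
move=> Ac; have [pi pi0 vpi] := uniformizer v.
have vpic : v (pi ^+ c) = c%:Z by rewrite dvalX // vpi natz.
have pic0 : pi ^+ c != 0 by rewrite expf_neq0.
have : vge v 0 (\det (pi ^+ c *: A)).
  apply: vge_det => i j; rewrite mxE -[0](subrr c%:Z) -{1}vpic vgeM_inv //.
have vpin : v ((pi ^+ c) ^+ n) = (c * n)%N%:Z by rewrite dvalX // vpic -mulr_natr natz.
have pin0 : (pi ^+ c) ^+ n != 0 by rewrite expf_neq0.
by rewrite detZ -[0](subrr (c * n)%N%:Z) -{1}vpin vgeM_inv.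
Qed.

(** An element of negative value has powers of arbitrarily negative value. This is how the constants
    lost in coordinate estimates are eliminated. *)
Lemma vge0_powers (K : fieldType) (v : dvaluation K) (D : nat) (x : K) :
  (forall N : nat, exists2 k : nat, (N <= k)%N & vge v (- D%:Z) (x ^+ k)) -> vge v 0 x.
Proof.
move=> h; have [->|x0] := eqVneq x 0; first exact: vge0.
have [k Dk] := h D.+1; rewrite !vgeE ?expf_neq0 // dvalX // pmulrn mulrzz; nia.
Qed.

(** The index is [w (iota pi)]; an element of value 0 keeps value 0 because it and its inverse both
    stay integral. *)
Lemma dval_scale (K M : fieldType) (w1 : dvaluation K) (w : dvaluation M)
    (iota : {rmorphism K -> M}) : (forall x, vge w1 0 x = vge w 0 (iota x)) ->
  exists2 e : nat, (0 < e)%N & forall x, w (iota x) = w1 x *+ e.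
Proof.
move=> h; have [pi pi0 vpi] := uniformizer w1.
have ipi0 : iota pi != 0 by rewrite fmorph_eq0.
have ge0 : 0 < w (iota pi).
  have : ~~ vge w1 0 pi^-1 by rewrite vgeE ?invr_eq0 // dvalV // vpi.
  by rewrite h fmorphV vgeE ?invr_eq0 // dvalV // -ltNge oppr_lt0.
exists `|w (iota pi)|%N; first (by lia); move=> x.
have [->|x0] := eqVneq x 0; first by rewrite rmorph0 !dval0 mul0rn.
pose u := x / pi ^ (w1 x).
have u0 : u != 0 by rewrite mulf_neq0 // invr_eq0 expfz_neq0.
have w1u : w1 u = 0.
  by rewrite dvalM ?invr_eq0 ?expfz_neq0 // dvalV ?expfz_neq0 // dvalZ // vpi mul1r subrr.
have wu : w (iota u) = 0.
  have := h u; rewrite !vgeE ?fmorph_eq0 // w1u lexx => /esym wu.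
  have := h u^-1; rewrite fmorphV !vgeE ?invr_eq0 ?fmorph_eq0 // !dvalV ?fmorph_eq0 //.
  by rewrite w1u oppr0 lexx oppr_ge0 => /esym wu2; apply/eqP; rewrite eq_le wu wu2.
have -> : x = u * pi ^ (w1 x) by rewrite mulfVK // expfz_neq0.
rewrite rmorphM /= fmorphXz dvalM ?expfz_neq0 ?fmorph_eq0 // wu dvalZ //.
by rewrite dvalM ?expfz_neq0 // w1u dvalZ // vpi pmulrn mulrzz !add0r mul1r mulrC gez0_abs ?ltW.
Qed.

Lemma dval_scale1 (K M : fieldType) (w1 : dvaluation K) (w : dvaluation M)
    (iota : {rmorphism K -> M}) : (forall y, exists x, y = iota x) ->
  (forall x, vge w1 0 x = vge w 0 (iota x)) -> forall x, w (iota x) = w1 x.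
Proof.
move=> sj /dval_scale[e e0 eP] x; have [y _ wy] := uniformizer w.
have [z yz] := sj y; move: wy; rewrite yz !eP !pmulrn !mulrzz => wz.
move/(congr1 absz)/eqP: wz; rewrite abszM muln_eq1 => /andP[_ /eqP/= ->].
by rewrite mulr1.
Qed.

Section Extension.
Variables (K : fieldType) (v : dvaluation K) (p : nat).
Hypotheses (localK : is_local_field v) (pK : p \in [pchar K]).

(** Frobenius does the work: [(1 + x) ^+ (p ^ N) = 1 + x ^+ (p ^ N)] has coordinates bounded below
    independently of N, by [nrm_bounded]. So the p ^ N-th powers of the norm of [1 + x] stay
    bounded, and [vge0_powers] applies. *)
Lemma nrm_add1 (L : fieldExtType K) (x : L) :
  vge v 0 (nrm x) -> vge v 0 (nrm (1 + x)).
Proof.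
move=> Nx; have pL : p \in [pchar L] := rmorph_pchar (in_alg L) pK.
have [C CP] := nrm_bounded L localK.
have [C0 C0P] := vge_finite v (fun i => v2r (1 : L) 0 i).
have [B BP] := mult_mx_bound v L; pose D := ((C + C0 + B) * vector.dim L)%N.
apply: (@vge0_powers _ _ D) => N; exists (p ^ N)%N.
  by rewrite ltnW // ltn_expl // prime_gt1 ?(pcharf_prime pK).
rewrite -nrmX exprDp // expr1n; apply: vge_det_shift => i j.
have h : coord_ge v (- (C + C0)%N%:Z) (1 + x ^+ (p ^ N)).
  apply: coord_geD => l; first by apply: vgeW (C0P l); lia.
  by apply: (@vgeW _ _ _ (- C%:Z)); [lia | apply: CP; rewrite nrmX vgeX0].
by apply: vgeW (BP _ _ h i j); lia.
Qed.

(** The extension is the value of the norm divided by its least positive value [f]. The ultrametric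
    inequality is [nrm_add1] at the quotient [y / x], once [x] is the term whose norm has the
    smaller value. *)
Lemma extension_exists (L : fieldExtType K) : exists (w : dvaluation L) (e : nat),
  (0 < e)%N /\ forall a : K, w a%:A = v a *+ e.
Proof.
pose w0 (x : L) := v (nrm x); pose n := vector.dim L.
have w0M x y : x != 0 -> y != 0 -> w0 (x * y) = w0 x + w0 y.
  by move=> x0 y0; rewrite /w0 nrmM dvalM ?nrm_eq0.
have w0Z a : a != 0 -> w0 a%:A = v a * n%:Z.
  by move=> a0; rewrite /w0 nrmZ dvalX // pmulrn mulrzz.
have [pi pi0 vpi] := uniformizer v.
have exf : exists f : nat, (0 < f)%N && `[< exists2 x : L, x != 0 & w0 x = f%:Z >].
  exists n; rewrite dim_gt0; apply/asboolP; exists pi%:A.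
    by rewrite scaler_eq0 oner_eq0 orbF.
  by rewrite w0Z // vpi mul1r.
case: (ex_minnP exf) => f /andP[f0 /asboolP[pL pL0 wpL]] fmin.
have w0V x : x != 0 -> w0 x^-1 = - w0 x.
  move=> x0; have := w0M x x^-1 x0; rewrite invr_eq0 divff // => /(_ x0).
  by rewrite {1}/w0 nrm1 dval1; lia.
have w0X x k : x != 0 -> w0 (x ^+ k) = w0 x * k%:Z.
  by move=> x0; rewrite /w0 nrmX dvalX ?nrm_eq0 // pmulrn mulrzz.
have w0Xz x z : x != 0 -> w0 (x ^ z) = w0 x * z.
  move=> x0; case: z => k; first by rewrite -exprnP w0X.
  by rewrite NegzE -exprnN w0V ?expf_neq0 // w0X //; lia.
have fdvd x : (f%:Z %| w0 x)%Z.
  have [->|x0] := eqVneq x 0.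
    suff -> : w0 0 = 0 by rewrite dvdz0.
    by rewrite /w0 (_ : nrm 0 = 0) ?dval0 //; apply/eqP; rewrite nrm_eq0.
  apply/dvdz_mod0P; set r := (w0 x %% f)%Z.
  have r0 : 0 <= r by rewrite modz_ge0 // -lt0n.
  have rf : r < f%:Z by rewrite ltz_pmod.
  have [//|rn0] := eqVneq r 0.
  have := fmin `|r|%N; have -> /= : (0 < `|r|)%N by rewrite absz_gt0.
  have -> : `[< exists2 x : L, x != 0 & w0 x = `|r|%N >].
    apply/asboolP; exists (x / pL ^ (w0 x %/ f)%Z).
      by rewrite mulf_neq0 // invr_eq0 expfz_neq0.
    rewrite w0M ?invr_eq0 ?expfz_neq0 // w0V ?expfz_neq0 // w0Xz // wpL.
    rewrite gez0_abs // {1}(divz_eq (w0 x) f) -/r; lia.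
  by move=> /(_ isT); lia.
pose w x := (w0 x %/ f)%Z.
have wE x : w0 x = w x * f%:Z by rewrite divzK.
have w_0 : w 0 = 0.
  rewrite /w /w0 (_ : nrm 0 = 0) ?dval0 ?div0z //; apply/eqP; by rewrite nrm_eq0.
have fz : f%:Z != 0 by rewrite eqz_nat -lt0n.
have wM x y : x != 0 -> y != 0 -> w (x * y) = w x + w y.
  by move=> x0 y0; apply: (mulIf fz); rewrite mulrDl -!wE w0M.
have wD x y : x != 0 -> y != 0 -> x + y != 0 -> Num.min (w x) (w y) <= w (x + y).
  wlog xy : x y / w0 x <= w0 y.
    move=> h x0 y0 xy0; have [xy|/ltW xy] := leP (w0 x) (w0 y); first exact: h.
    by rewrite minC addrC h // addrC.
  move=> x0 y0 xy0; rewrite ge_min; apply/orP; left.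
  have f0z : 0 < f%:Z by rewrite ltz_nat.
  rewrite -(ler_pM2r f0z) -!wE.
  have yx : vge v 0 (nrm (y / x)).
    rewrite vgeE ?nrm_eq0 ?mulf_neq0 ?invr_eq0 // -/(w0 _) w0M ?invr_eq0 // w0V //; lia.
  have := nrm_add1 yx.
  have -> : 1 + y / x = (x + y) / x by rewrite mulrDl divff.
  by rewrite vgeE ?nrm_eq0 ?mulf_neq0 ?invr_eq0 // -/(w0 _) w0M ?invr_eq0 // w0V //; lia.
have wsurj : exists2 x, x != 0 & w x = 1.
  by exists pL => //; apply: (mulIf fz); rewrite -wE wpL mul1r.
exists (DValuation w_0 wM wD wsurj) => /=.
have nE : n%:Z = w pi%:A * f%:Z by rewrite -wE w0Z // vpi mul1r.
have n0 := dim_gt0 L; rewrite -/n in n0.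
exists `|w pi%:A|%N; split=> [|a]; first by nia.
have [->|a0] := eqVneq a 0; first by rewrite scale0r w_0 dval0 mul0rn.
apply: (mulIf fz); rewrite -wE w0Z // nE pmulrn mulrzz mulrA; congr (_ * _ * _).
by nia.
Qed.

(** * Uniqueness of the extended valuation and comparison with coordinates *)

Section Unique.
Variables (L : fieldExtType K) (M : fieldType) (w : dvaluation M).
Variables (iota : {rmorphism L -> M}) (e : nat).
Hypotheses (e_gt0 : (0 < e)%N) (wK : forall a : K, w (iota a%:A) = v a *+ e).

Lemma vge_scalar C a : vge v C a -> vge w (C * e%:Z) (iota a%:A).
Proof.
have [->|a0] := eqVneq a 0; first by rewrite scale0r rmorph0 !vge0.
rewrite !vgeE ?fmorph_eq0 ?scaler_eq0 ?oner_eq0 ?orbF // wK pmulrn mulrzz.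
by rewrite ler_pM2r // ltz_nat.
Qed.

Lemma coord_ge_vge : exists B : nat, forall C x,
  coord_ge v C x -> vge w (C * e%:Z - B%:Z) (iota x).
Proof.
have [B BP] := vge_finite w (fun k => iota (r2v (delta_mx 0 k))).
exists B => C x xC.
have -> : x = \sum_k (v2r x 0 k)%:A * r2v (delta_mx 0 k).
  rewrite -{1}[x]v2rK {1}[v2r x]row_sum_delta linear_sum.
  by apply: eq_bigr => k _; rewrite linearZ /= mulr_algl.
rewrite rmorph_sum; apply: vge_sum => k _; rewrite rmorphM; apply: vgeM => //.
exact: vge_scalar.
Qed.

(** The right-hand side involves neither [w] nor [iota], whence uniqueness of the extension. An
    integral norm bounds the coordinates of all powers of [x], hence their values, so [vge0_powers]
    gives one implication. *)
Lemma vge_nrm x : vge w 0 (iota x) = vge v 0 (nrm x).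
Proof.
apply/idP/idP => [|Nx].
  have [->|x0] := eqVneq x 0.
    by move=> _; rewrite /vge nrm_eq0 eqxx.
  apply: contraTT => Nx; have ix0 : iota x != 0 by rewrite fmorph_eq0.
  have vN : v (nrm x) < 0 by move: Nx; rewrite vgeE ?nrm_eq0 //; lia.
  suff : w (iota x) < 0 by rewrite vgeE //; lia.
  have n0 := dim_gt0 L; set n := vector.dim L in n0 *.
  have [pi pi0 vpi] := uniformizer v.
  have [C CP] := nrm_bounded L localK; have [B BP] := coord_ge_vge.
  (* The factor [pi] produces the strict inequality: the norm of [x ^+ n * pi%:A] still has value at
     most 0, so the inverse of this element is integral and [n * w (iota x) + e <= 0]. *)
  pose y k := (x ^+ n * pi%:A) ^- k.
  have xp0 : x ^+ n * pi%:A != 0.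
    by rewrite mulf_neq0 ?expf_neq0 // scaler_eq0 oner_eq0 orbF.
  have yk k : coord_ge v (- C%:Z) (y k).
    apply: CP; rewrite vgeE ?nrm_eq0 ?invr_eq0 ?expf_neq0 // /y -exprVn nrmX.
    have Nxp : v (nrm (x ^+ n * pi%:A)) <= 0.
      rewrite nrmM nrmX nrmZ -/n dvalM ?expf_neq0 ?nrm_eq0 // !dvalX ?nrm_eq0 // vpi.
      rewrite !pmulrn !mulrzz; nia.
    have : nrm (x ^+ n * pi%:A)^-1 = (nrm (x ^+ n * pi%:A))^-1.
      apply: (@mulfI _ (nrm (x ^+ n * pi%:A))); first by rewrite nrm_eq0.
      by rewrite -nrmM !divff ?nrm1 ?nrm_eq0.
    move=> ->; rewrite dvalX ?invr_eq0 ?nrm_eq0 // dvalV ?nrm_eq0 //.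
    by rewrite pmulrn mulrzz; nia.
  have : vge w 0 (iota (x ^+ n * pi%:A)^-1).
    apply: (@vge0_powers _ _ (C * e + B)%N) => N; exists N => //.
    rewrite -rmorphXn exprVn; apply: vgeW (BP _ _ (yk N)); lia.
  rewrite fmorphV vgeE ?invr_eq0 ?fmorph_eq0 // dvalV ?fmorph_eq0 //.
  rewrite rmorphM rmorphXn dvalM ?expf_neq0 ?fmorph_eq0 ?scaler_eq0 ?oner_eq0 ?orbF //.
  rewrite dvalX // wK vpi !pmulrn !mulrzz; move: (w (iota x)) e_gt0 n0 => i; nia.
have [C CP] := nrm_bounded L localK; have [B BP] := coord_ge_vge.
apply: (@vge0_powers _ _ (C * e + B)%N) => N; exists N => //.
rewrite -rmorphXn; have h := CP (x ^+ N); rewrite nrmX vgeX0 // in h.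
by apply: vgeW (BP _ _ (h isT)); lia.
Qed.

(** Division by [pi ^ N] reduces to integral elements, whose norm is integral. Together with
    [coord_ge_vge] this identifies the topologies given by the coordinates and by [w]. *)
Lemma vge_coord : exists C : nat, forall (N : int) x,
  vge w (N * e%:Z) (iota x) -> coord_ge v (N - C%:Z) x.
Proof.
have [C CP] := nrm_bounded L localK; have [pi pi0 vpi] := uniformizer v.
exists C => N x xN; have piN0 : pi ^ N != 0 by rewrite expfz_neq0.
have vpiN : v (pi ^ N) = N by rewrite dvalZ // vpi mul1r.
have : coord_ge v (- C%:Z) ((pi ^ N)^-1 *: x).
  apply: CP; rewrite -vge_nrm -mulr_algl rmorphM.
  have i0 : iota (pi ^ N)%:A != 0 by rewrite fmorph_eq0 scaler_eq0 oner_eq0 orbF.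
  rewrite -(vgeM_inv w 0 _ i0) mulrA -rmorphM -scalerAl mul1r scalerA divff //.
  by rewrite scale1r rmorph1 mul1r wK vpiN addr0 pmulrn mulrzz.
move=> h i; have := h i; rewrite linearZ mxE.
by rewrite -(vgeM_inv v _ _ piN0) mulrA divff // mul1r vpiN.
Qed.

End Unique.

Lemma memv_mx (L : vectType K) (V : {vspace L}) x : (x \in V) = (v2r x <= vs2mx V)%MS.
Proof. by rewrite -genmxE. Qed.

(** Membership in V is the vanishing of finitely many linear forms, the columns of [cokermx], and
    these are continuous. This turns density of a subspace of L into equality. *)
Lemma vspace_closed (L : fieldExtType K) (w : dvaluation L) (e : nat)
    (V : {vspace L}) (x : L) : (0 < e)%N -> (forall a : K, w a%:A = v a *+ e) ->
  (forall N : nat, exists2 y, y \in V & vge w N%:Z (x - y)) -> x \in V.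
Proof.
move=> e0 wK h; have [C CP] := @vge_coord L L w idfun e e0 wK.
suff : v2r x *m cokermx (vs2mx V) == 0 by rewrite -submxE memv_mx.
have [B BP] := vge_finite v (fun ij => cokermx (vs2mx V) ij.1 ij.2).
apply/eqP/rowP => j; rewrite [RHS]mxE; apply: (@vge_all_eq0 _ v) => N.
have [y Vy xy] := h ((N + C + B) * e)%N.
have -> : v2r x *m cokermx (vs2mx V) = v2r (x - y) *m cokermx (vs2mx V).
  rewrite linearB mulmxBl; move: Vy; rewrite memv_mx submxE => /eqP->.
  by rewrite subr0.
rewrite mxE; apply: vge_sum => k _.
have xyk := CP (N + C + B)%N%:Z (x - y) _ k.
apply: vgeW (vgeM (xyk _) (BP (k, j))); first by lia.
by rewrite -PoszM.
Qed.

(** By compactness two terms of the sequence [x ^+ (p ^ m)] are close, and their difference is a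
    p-power power of [x ^+ (p ^ k) - x], with k the difference of the two indices. *)
Lemma residue_power (L : fieldExtType K) (w : dvaluation L) (e : nat) (x : L) :
  (0 < e)%N -> (forall a : K, w a%:A = v a *+ e) -> vge w 0 x ->
  exists2 k : nat, (0 < k)%N & vge w 1 (x ^+ (p ^ k) - x).
Proof.
move=> e0 wK x0; have pL : p \in [pchar L] := rmorph_pchar (in_alg L) pK.
have [C CP] := @vge_coord L L w idfun e e0 wK.
have [B BP] := @coord_ge_vge L L w idfun e e0 wK.
have [pi pi0 vpi] := uniformizer v.
have vpiC : v (pi ^+ C) = C%:Z by rewrite dvalX // vpi natz.
have piC0 : pi ^+ C != 0 by rewrite expf_neq0.
pose u m : 'rV[K]_(vector.dim L) := pi ^+ C *: v2r (x ^+ (p ^ m)).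
have u0 m i : vge v 0 (u m 0 i).
  rewrite mxE -[0](subrr C%:Z) -{1}vpiC vgeM_inv // -[- _]add0r.
  by apply: CP; rewrite mul0r vgeX0.
have [z zP] := bolzano_weierstrass localK u0.
pose N := (C + C + B.+1)%N.
have [m1 [_ m1P]] := zP N 0%N; have [m2 [m12 m2P]] := zP N m1.+1.
exists (m2 - m1)%N; first by rewrite subn_gt0.
have : vge w 1 (x ^+ (p ^ m2) - x ^+ (p ^ m1)).
  apply: (@vgeW _ _ _ ((N%:Z - C%:Z) * e%:Z - B%:Z)); first by rewrite /N; nia.
  apply: BP => i; rewrite -(vgeM_inv v _ _ piC0) vpiC addrC subrK.
  have -> : pi ^+ C * v2r (x ^+ (p ^ m2) - x ^+ (p ^ m1)) 0 i = u m2 0 i - u m1 0 i.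
    by rewrite linearB !mxE mulrBr.
  by rewrite -[_ - _](subrKA (z 0 i)) vgeD // -vgeN opprB.
have -> : x ^+ (p ^ m2) - x ^+ (p ^ m1) = (x ^+ (p ^ (m2 - m1)) - x) ^+ (p ^ m1).
  by rewrite exprBp // -exprM -expnD subnK // ltnW.
have : (0 < p ^ m1)%N by rewrite expn_gt0 prime_gt0 ?(pcharf_prime pK).
by case: (p ^ m1)%N => // k _ /vge1_expX.
Qed.

End Extension.

(** * Ramification groups *)

Lemma subfield_uniformizer (K : fieldType) (L : fieldExtType K) (w : dvaluation L)
    (E : {subfield L}) (x : L) : x \in E -> 0 < w x ->
  exists (y : L) (e : nat), [/\ (0 < e)%N, y \in E, y != 0, w y = e%:Z &
    forall z, z \in E -> (e%:Z %| w z)%Z].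
Proof.
move=> Ex wx.
have exe : exists e : nat, (0 < e)%N && `[< exists2 y : L, y \in E & w y = e%:Z >].
  exists `|w x|%N; apply/andP; split; first by lia.
  by apply/asboolP; exists x => //; lia.
case: (ex_minnP exe) => e /andP[e0 /asboolP[y Ey wy]] emin.
have y0 : y != 0 by apply: contraTneq e0 => y0; rewrite -ltz_nat -wy y0 dval0.
exists y, e; split=> // z Ez.
have [->|z0] := eqVneq z 0; first by rewrite dval0 dvdz0.
apply/dvdz_mod0P; set r := (w z %% e)%Z.
have r0 : 0 <= r by rewrite modz_ge0 // -lt0n.
have re : r < e%:Z by rewrite ltz_pmod.
have [//|rn0] := eqVneq r 0.
have := emin `|r|%N; have -> /= : (0 < `|r|)%N by rewrite absz_gt0.
have Eyz k : y ^ k \in E by case: k => k; rewrite ?NegzE -?exprnN ?rpredV ?rpredX.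
have -> : `[< exists2 y : L, y \in E & w y = `|r|%N >].
  apply/asboolP; exists (z / y ^ (w z %/ e)%Z); first by rewrite rpredM ?rpredV.
  rewrite dvalM ?invr_eq0 ?expfz_neq0 // dvalV ?expfz_neq0 // dvalZ // wy.
  rewrite gez0_abs // {1}(divz_eq (w z) e) -/r mulrC; lia.
by move=> /(_ isT); lia.
Qed.

Lemma sum_rcosets (gT : finGroupType) (V : nmodType) (P I : {group gT}) (F : {set gT} -> V) g :
  g \in I -> \sum_(C in rcosets P I) F (C :* g)%g = \sum_(C in rcosets P I) F C.
Proof.
move=> Ig; rewrite [RHS](reindex_inj (@rcoset_inj _ g)) /=; apply: eq_bigl => C.
apply/rcosetsP/rcosetsP => -[h Ih].
  by move=> ->; exists (h * g)%g; rewrite ?groupM // rcosetM.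
move=> CE; exists (h * g^-1)%g; first by rewrite groupM ?groupV.
by rewrite rcosetM -CE -rcosetM mulgV rcoset1.
Qed.

(** The integral over [0, t] of a step function that drops from 1 to 0 at n - 1, plus 1: what an
    automorphism with displacement n contributes to Herbrand's function. *)
Lemma sum_steps (m n : nat) (t : rat) : m%:R <= t < m.+1%:R -> (0 < n)%N ->
  \sum_(1 <= i < m.+1) (i < n)%N%:R + (t - m%:R) * (m.+1 < n)%N%:R + 1 = Num.min n%:R (t + 1).
Proof.
move=> /andP[mt tm] n0.
have -> : \sum_(1 <= i < m.+1) (i < n)%N%:R = (minn m n.-1)%:R :> rat.
  elim: m {mt tm} => [|k IHk]; first by rewrite big_geq // min0n.
  by rewrite big_nat_recr //= IHk -natrD; congr _%:R; lia.
have [nm|mn] := leqP n m.+1.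
  rewrite mulr0 addr0 (minn_idPr _); last by lia.
  rewrite natr1 prednK // min_l // (le_trans _ (_ : m.+1%:R <= _)) ?ler_nat //.
  by rewrite -natr1 lerD2r.
rewrite mulr1 (minn_idPl _); last by lia.
rewrite min_r; first by rewrite subrKC.
by apply: (@le_trans _ _ m.+2%:R); rewrite ?ler_nat // -[m.+2%:R]natr1 lerD2r ltW.
Qed.

Section Ramification.
Variables (K : fieldType) (p : nat) (L : splittingFieldType K) (w : dvaluation L).
Hypothesis galL : galois 1%AS {:L}.
Hypothesis pL : p \in [pchar L].
Hypothesis winv : forall (s : gal_of {:L}) x, w (s x) = w x.
Hypothesis residP : forall x, vge w 0 x ->
  exists2 k : nat, (0 < k)%N & vge w 1 (x ^+ (p ^ k) - x).
Hypothesis closedP : forall (V : {vspace L}) x,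
  (forall N : nat, exists2 y, y \in V & vge w N%:Z (x - y)) -> x \in V.

Implicit Types (s t g h : gal_of {:L}) (H : {group gal_of {:L}}).

Lemma gal_in s : s \in 'Gal({:L} / 1%AS)%g.
Proof. by rewrite gal_kHom ?sub1v // k1AHom. Qed.

Lemma galMx s t x : (s * t)%g x = t (s x).
Proof. by rewrite galM ?memvf. Qed.

Lemma gal_eqx s t : (forall x, s x = t x) -> s = t.
Proof. by move=> st; apply/eqP/gal_eqP => x _. Qed.

Lemma vge_gal C s x : vge w C (s x) = vge w C x.
Proof. by rewrite /vge fmorph_eq0 winv. Qed.

Definition inertia_set : {set gal_of {:L}} :=
  [set s : gal_of {:L} | `[< forall x, vge w 0 x -> vge w 1 (s x - x) >]].

Lemma inertiaP s : reflect (forall x, vge w 0 x -> vge w 1 (s x - x)) (s \in inertia_set).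
Proof. by rewrite inE; apply: asboolP. Qed.

Lemma inertia_group_set : group_set inertia_set.
Proof.
apply/group_setP; split=> [|s t /inertiaP sI /inertiaP tI].
  by apply/inertiaP => x _; rewrite gal_id subrr vge0.
apply/inertiaP => x x0; rewrite galMx -[_ - _](subrKA (t x)) vgeD ?tI //.
by rewrite -rmorphB vge_gal sI.
Qed.
Canonical inertia_group := Group inertia_group_set.
Local Notation G0 := inertia_group.

Lemma resid_large x N : vge w 0 x ->
  exists2 k : nat, (N <= k)%N & vge w 1 (x ^+ (p ^ k) - x).
Proof.
move=> x0; have [k k0 xk] := residP x0; exists (k * N)%N; first exact: leq_pmull.
elim: N => [|N IHN]; first by rewrite muln0 expn0 expr1 subrr vge0.
rewrite -[_ - _](subrKA (x ^+ (p ^ k))) vgeD // mulnS addnC expnD exprM -exprBp //.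
have : (0 < p ^ k)%N by rewrite expn_gt0 prime_gt0 ?(pcharf_prime pL).
case: (p ^ k)%N => // m _; rewrite exprS -[1]addr0 vgeM // vgeX0 //.
exact: vgeW IHN.
Qed.

(** Induction on the precision. Write [z = z ^+ (p ^ k) + y * z'], where [z'] is integral because
    [y] has least positive value on E. The first term moves by [(s z - z) ^+ (p ^ k)], negligible
    for large k as [s] lies in the inertia group. The second moves by [(s y - y) * z'] and by
    [s y * (s z' - z')], where the factor [s y] improves the precision known for [z']. *)
Lemma uniformizer_bound (E : {subfield L}) y s C x :
  y \in E -> 0 < w y -> (forall z, z \in E -> vge w 1 z -> vge w (w y) z) ->
  s \in G0 -> vge w C (s y - y) -> x \in E -> vge w 0 x -> vge w C (s x - x).
Proof.
move=> Ey wy ymin /inertiaP sI syC.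
suff P N : forall z, z \in E -> vge w 0 z -> vge w (Num.min C N%:Z) (s z - z).
  by move=> Ex x0; have := P `|C|%N x Ex x0; apply: vgeW; rewrite le_min; lia.
elim: N => [|N IHN] z Ez z0.
  by apply: vgeW (vgeB _ z0); rewrite ?ge_min ?lexx ?orbT // vge_gal.
have y0 : y != 0 by apply: contraTneq wy => ->; rewrite dval0.
have [k Nk zk] := resid_large N.+1 z0.
pose z' := (z - z ^+ (p ^ k)) / y.
have Ez' : z' \in E by rewrite rpredM ?rpredV // rpredB ?rpredX.
have z'0 : vge w 0 z'.
  rewrite -(vgeM_inv _ _ _ y0) addr0 mulrC divfK // ymin //.
    by rewrite rpredB ?rpredX.
  by rewrite -vgeN opprB.
have zE : z = z ^+ (p ^ k) + y * z' by rewrite /z' mulrC divfK // addrC subrK.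
rewrite {1 2}zE rmorphD rmorphXn rmorphM /=.
have -> : s z ^+ (p ^ k) + s y * s z' - (z ^+ (p ^ k) + y * z') =
   (s z - z) ^+ (p ^ k) + ((s y - y) * z' + s y * (s z' - z')).
  by rewrite exprBp //; ring.
apply: vgeD; last apply: vgeD.
- apply: vgeW (vgeX (p ^ k) (sI z z0)).
  have : (k < p ^ k)%N by rewrite ltn_expl // prime_gt1 ?(pcharf_prime pL).
  by move=> kp; rewrite natz ge_min lez_nat (leq_trans Nk) ?orbT // ltnW.
- by rewrite mulrC vgeM0 //; apply: vgeW syC; rewrite ge_min lexx.
have vsy : vge w (w y) (s y) by rewrite vge_gal vge_val.
by apply: vgeW (vgeM vsy (IHN z' Ez' z'0)); apply: min_succ_le.
Qed.

(** I acts trivially on residues, so the norm over a Sylow p-subgroup of order p ^ b raises residues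
    to the power p ^ b, and the trace over its cosets multiplies them by an index prime to p. The
    first effect is undone by the choice of [z], the second by [m]. *)
Lemma residue_fixed (I : {group gal_of {:L}}) x : I \subset G0 -> vge w 0 x ->
  exists2 y, y \in fixedField I & vge w 1 (y - x).
Proof.
move=> /fintype.subsetP IG0 x0; have [P sylP] := Sylow_exists p I.
have [PI pP copP] := and3P sylP.
have [b Pb] := p_natP pP.
have [k bk xk] := resid_large b x0.
have p_pr := pcharf_prime pL.
(* Then [z ^+ (p ^ b)] is [x ^+ (p ^ k)], which is congruent to [x]. *)
pose z := x ^+ (p ^ (k - b)); have z0 : vge w 0 z by rewrite vgeX0.
pose y : L := \sum_(C in rcosets P I) \prod_(g in C) g z.
have fix_y g : g \in I -> g y = y.
  move=> Ig; rewrite rmorph_sum -[RHS](sum_rcosets _ _ Ig); apply: eq_bigr => C _.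
  rewrite rmorph_prod [RHS](reindex_inj (mulIg g)) /=.
  by apply: eq_big => [h|h _]; rewrite ?mem_rcoset ?mulgK ?galMx.
have yz C : C \in rcosets P I -> vge w 1 (\prod_(g in C) g z - z ^+ (p ^ b)).
  move=> /rcosetsP[h Ih ->]; rewrite -Pb -(card_rcoset P h) -prodr_const.
  suff [] : vge w 0 (\prod_(g in (P :* h)%g) g z) /\
    vge w 1 (\prod_(g in (P :* h)%g) g z - \prod_(g in (P :* h)%g) z) by [].
  elim/big_rec2: _ => [|g z1 z2 Phg [z20 z12]]; first by rewrite subrr vge1 vge0.
  have gz0 : vge w 0 (g z) by rewrite vge_gal.
  split; first exact: vgeM0.
  rewrite -[_ - _](subrKA (g z * z1)) -mulrBr -mulrBl; apply: vgeD; first exact: vgeM0.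
  have z10 : vge w 0 z1.
    by rewrite -[z1](subKr z2) vgeB //; apply: vgeW z12.
  rewrite mulrC vgeM0 //; apply/inertiaP => //; apply: IG0.
  have [h' Ph' ->] := rcosetP Phg.
  by rewrite groupM //; apply: (fintype.subsetP PI).
have [m mP] : exists m : nat, (m * #|I : P|%g)%N%:R = 1 :> L.
  case: (egcdnP p (indexg_gt0 I P)) => m l ml _; exists m.
  rewrite ml natrD natrM (pcharf0 pL) mulr0 add0r.
  by rewrite (eqP (_ : coprime #|I : P|%g p)) // coprime_sym prime_coprime // -p'natE.
exists (m%:R * y).
  apply/fixedFieldP => [|g Ig]; first exact: memvf.
  by rewrite rmorphM rmorph_nat; congr (_ * _); apply: fix_y.
have -> : m%:R * y - x = m%:R * (\sum_(C in rcosets P I) (\prod_(g in C) g z - z ^+ (p ^ b)))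
   + (z ^+ (p ^ b) - x).
  rewrite sumrB sumr_const -[#|rcosets P I|]/(#|I : P|%g) -/y mulrBr -[z ^+ _ *+ _]mulr_natl.
  by rewrite mulrA -natrM mP mul1r addrA subrK.
apply: vgeD.
  by rewrite vgeM0 ?vge_nat //; apply: vge_sum.
by rewrite -exprM -expnD subnK.
Qed.
Variables (pi : L) (pi0 : pi != 0) (wpi : w pi = 1).

Lemma inertia_gal_bound s C x : s \in G0 -> vge w C (s pi - pi) -> vge w 0 x ->
  vge w C (s x - x).
Proof.
move=> Gs sC x0; apply: (@uniformizer_bound {:L}%AS pi) => //; rewrite ?memvf ?wpi //.
Qed.

Lemma inertia_gal_eq1 s : s \in G0 -> s pi = pi -> s = 1%g.
Proof.
move=> Gs spi; apply: gal_eqx => x; rewrite gal_id.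
have fix_int y : vge w 0 y -> s y = y.
  move=> y0; apply/eqP; rewrite -subr_eq0; apply/eqP; apply: (@vge_all_eq0 _ w) => N.
  by apply: inertia_gal_bound => //; rewrite spi subrr vge0.
have [->|x0] := eqVneq x 0; first by rewrite rmorph0.
have [xge|xlt] := lerP 0 (w x); first by rewrite fix_int // vgeE.
have := fix_int x^-1; rewrite fmorphV vgeE ?invr_eq0 // dvalV // oppr_ge0 ltW //.
by move=> /(_ isT)/invr_inj.
Qed.

Lemma prod_fixed (I : {group gal_of {:L}}) x : \prod_(g in I) g x \in fixedField I.
Proof.
apply/fixedFieldP => [|h Ih]; first exact: memvf.
rewrite rmorph_prod [RHS](reindex_inj (mulIg h)) /=.
by apply: eq_big => [g|g _]; rewrite ?groupMr ?galMx.
Qed.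

Lemma dval_prod_gal (A : {set gal_of {:L}}) x : x != 0 ->
  w (\prod_(g in A) g x) = w x *+ #|A|.
Proof.
move=> x0; rewrite dval_prod => [|g _]; last by rewrite fmorph_eq0.
by rewrite -sumr_const; apply: eq_bigr.
Qed.

(** The norm of [pi] has value #|I|, so the least positive value e on the fixed field E divides
    #|I|. Conversely the powers of [pi] below e span over E a subspace that is dense, since digits
    can be taken in E by [residue_fixed], hence equal to L. So #|I|, the degree of L over E, is at
    most e. *)
Lemma fixed_inertia (I : {group gal_of {:L}}) : I \subset G0 ->
  exists2 y, [/\ y \in fixedField I, y != 0 & w y = #|I|%:Z] &
    forall z, z \in fixedField I -> (#|I|%:Z %| w z)%Z.
Proof.
move=> IG0; have NE := prod_fixed I pi.
have wN : w (\prod_(g in I) g pi) = #|I|%:Z by rewrite dval_prod_gal // wpi natz.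
have [|y [e [e0 Ey y0 wy ediv]]] := @subfield_uniformizer _ _ w [aspace of fixedField I] _ NE.
  by rewrite wN ltz_nat cardG_gt0.
suff eI : e = #|I| by exists y; rewrite -?eI.
have eI : (e %| #|I|)%N by have := ediv _ NE; rewrite wN.
apply/eqP; rewrite eqn_leq dvdn_leq ?cardG_gt0 //=.
set E := fixedField I in Ey ediv *.
pose V : {vspace L} := (\sum_(i < e) (E * <[pi ^+ i]>))%VS.
have VE c x : c \in E -> x \in V -> c * x \in V.
  move=> Ec /memv_sumP[u uP ->]; rewrite mulr_sumr; apply: memv_sumr => i _.
  have /memv_cosetP[d Ed ->] := uP i isT.
  by apply/memv_cosetP; exists (c * d); rewrite ?rpredM ?mulrA.
have step x i : (i <= e)%N -> vge w 0 x -> exists2 z, z \in V &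
    exists2 x', vge w 0 x' & x = z + pi ^+ i * x'.
  move=> ie x0; elim: i ie => [|i IHi] ie.
    by exists 0; rewrite ?mem0v //; exists x; rewrite // expr0 mul1r add0r.
  have [z Vz [x' x'0 xE]] := IHi (ltnW ie).
  have [c Ec cx'] := residue_fixed IG0 x'0.
  exists (z + c * pi ^+ i).
    rewrite rpredD //; apply: (subvP (sumv_sup (Ordinal ie) isT (subvv _))).
    by apply/memv_cosetP; exists c.
  exists ((x' - c) / pi).
    by rewrite -(vgeM_inv _ _ _ pi0) wpi mulrC divfK // -vgeN opprB.
  rewrite xE exprSr -mulrA [pi * _]mulrC divfK // mulrBr [c * _]mulrC; ring.
(* Beyond precision e, [pi ^+ e] is traded for [y], which has the same value and lies in E; the
   approximants thus stay in V. *)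
have dens x N : vge w 0 x -> exists2 z, z \in V &
    exists2 x', vge w 0 x' & x = z + y ^+ N * x'.
  move=> x0; elim: N => [|N [z Vz [x' x'0 xE]]].
    by exists 0; rewrite ?mem0v //; exists x; rewrite // expr0 mul1r add0r.
  have [z' Vz' [x'' x''0 x'E]] := step x' e (leqnn e) x'0.
  exists (z + y ^+ N * z'); first by rewrite rpredD // VE // rpredX.
  exists (pi ^+ e / y * x''); last first.
    by rewrite xE x'E exprSr -[y ^+ N * y * _]mulrA [y * (_ * _)]mulrA [y * (_ / _)]mulrC divfK //; ring.
  rewrite vgeM0 // vgeE ?mulf_neq0 ?invr_eq0 ?expf_neq0 //.
  by rewrite dvalM ?invr_eq0 ?expf_neq0 // dvalV // dvalX // wpi wy natz subrr.
have VL : V = {:L}%VS.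
  apply/eqP; rewrite eqEsubv subvf; apply/subvP => x _; apply: closedP => N.
  pose M := `|w x|%N; have yM0 : y ^+ M != 0 by rewrite expf_neq0.
  have [|z Vz [x' x'0 xE]] := dens (y ^+ M * x) (M + N)%N.
    have [->|x0] := eqVneq x 0; first by rewrite mulr0 vge0.
    by rewrite vgeE ?mulf_neq0 // dvalM // dvalX // wy pmulrn mulrzz mul_absz_ge0.
  exists ((y ^+ M)^-1 * z); first by rewrite VE // rpredV rpredX.
  have -> : x - (y ^+ M)^-1 * z = y ^+ N * x'.
    apply: (mulfI yM0); rewrite mulrBr mulVKf // xE addrC addKr exprD mulrA //.
  apply: (@vgeW _ _ _ (w y *+ N + 0)); last by rewrite vgeM // vgeX // vge_val.
  by rewrite wy pmulrn mulrzz addr0 leq_mul_absz.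
have : (\dim {:L} <= e * \dim E)%N.
  rewrite -VL; apply: leq_trans (dimv_leq_sum _ _ _) _.
  rewrite (eq_bigr (fun=> \dim E)) ?sum_nat_const ?card_ord // => i _.
  by rewrite dim_cosetv_unit // unitfE expf_neq0.
by rewrite dim_fixedField -/E; move=> /(leq_div2r (\dim E)); rewrite mulnK ?adim_gt0.
Qed.

Lemma rcoset_fixed (I : {group gal_of {:L}}) g s t x : x \in fixedField I ->
  s \in (I :* g)%g -> t \in (I :* g)%g -> s x = t x.
Proof.
move=> Ex /rcosetP[a Ia ->] /rcosetP[b Ib ->]; rewrite !galMx.
by have [_ fx] := mem_fixedFieldP Ex; rewrite (fx a Ia) (fx b Ib).
Qed.

(** Two distinct cosets differ by an element of H outside the inertia group, which moves some
    residue; by [residue_fixed] this residue is represented in the fixed field of I. *)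
Lemma rcoset_separated H (C C' : {set gal_of {:L}}) :
  let I := (H :&: G0)%G in
  C \in rcosets I H -> C' \in rcosets I H -> C != C' ->
  exists d, [/\ d \in fixedField I, vge w 0 d & ~~ vge w 1 (repr C d - repr C' d)].
Proof.
move=> I XC XC' CC'; set s := repr C; set t := repr C'.
have [/rcosetsP[g Hg CE] /rcosetsP[g' Hg' CE']] := (XC, XC').
have Cs : s \in C by rewrite /s CE mem_repr_rcoset.
have Ct : t \in C' by rewrite /t CE' mem_repr_rcoset.
have sI : (s * t^-1)%g \notin I.
  apply: contra CC' => stI; rewrite CE CE' in Cs Ct *; apply/eqP.
  rewrite -(rcoset_eqP Cs) -(rcoset_eqP Ct); apply/rcoset_eqP.
  by rewrite mem_rcoset.
have Hst : (s * t^-1)%g \in H.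
  by rewrite groupM ?groupV //; [move: Cs; rewrite CE | move: Ct; rewrite CE'];
    case/rcosetP => h /setIP[Hh _] ->; rewrite groupM.
have : ~ (forall x, vge w 0 x -> vge w 1 ((s * t^-1)%g x - x)).
  by move=> /inertiaP st; rewrite inE Hst st in sI.
move=> /existsNP[x /not_implyP[x0' /negP xst]].
have [d Ed dx] := residue_fixed (subsetIr H G0) x0'.
have d0 : vge w 0 d by rewrite -[d](subrK x) vgeD // (vgeW _ dx).
exists d; split=> //; apply: contra xst => st.
have st1 : vge w 1 ((s * t^-1)%g d - d).
  rewrite -(vge_gal _ t) rmorphB /= -[t _](galMx) mulgKV //.
rewrite -[_ - _](subrKA ((s * t^-1)%g d)) vgeD //.
  by rewrite -rmorphB vge_gal -vgeN opprB.
by rewrite -[_ - _](subrKA d) vgeD.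
Qed.

(** Artin's independence of characters, for the action on residues: a relation is multiplied by an
    element [d] separating two cosets, and a multiple of the original relation is subtracted. *)
Lemma rcoset_independent H (Y : {set {set gal_of {:L}}}) (u : {set gal_of {:L}} -> L) :
  let I := (H :&: G0)%G in
  Y \subset rcosets I H -> (forall C, C \in Y -> vge w 0 (u C)) ->
  (forall c, c \in fixedField I -> vge w 0 c -> vge w 1 (\sum_(C in Y) u C * repr C c)) ->
  forall C, C \in Y -> vge w 1 (u C).
Proof.
move=> I; have [n Yn] := ubnP #|Y|; elim: n => // n IHn in Y u Yn *.
move=> YX u0 Yu C0 YC0.
have sub : Y :\ C0 \subset rcosets I H := fintype.subset_trans (finset.subsetDl _ _) YX.
have XY C : C \in Y -> C \in rcosets I H := fintype.subsetP YX C.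
have uC C : C \in Y :\ C0 -> vge w 1 (u C).
  move=> /[dup] YC /setD1P[CC0 YC'].
  have [d [Ed d0 dP]] := rcoset_separated (XY _ YC') (XY _ YC0) CC0.
  have : vge w 1 (u C * (repr C d - repr C0 d)).
    apply: (IHn (Y :\ C0) (fun C => u C * (repr C d - repr C0 d))) => //.
    - by move: Yn; rewrite (cardsD1 C0 Y) YC0.
    - move=> C' /setD1P[_ YC'']; rewrite vgeM0 ?u0 // vgeB ?vge_gal //.
    move=> c Ec c0.
    have -> : \sum_(C' in Y :\ C0) u C' * (repr C' d - repr C0 d) * repr C' c =
       \sum_(C' in Y) u C' * repr C' (d * c) - repr C0 d * \sum_(C' in Y) u C' * repr C' c.
      rewrite mulr_sumr -sumrB (big_setD1 C0 YC0) /= rmorphM.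
      rewrite [X in X + _](_ : _ = 0) ?add0r; last by ring.
      by apply: eq_bigr => C' _; rewrite rmorphM /=; ring.
    by rewrite vgeB ?vgeM0 ?vge_gal ?Yu ?rpredM ?vgeM0.
  have [e0 we] : repr C d - repr C0 d != 0 /\ w (repr C d - repr C0 d) = 0.
    by apply: vge_unit; rewrite // vgeB ?vge_gal.
  by rewrite mulrC -[1]add0r -{1}we vgeM_inv.
have := Yu 1 (rpred1 _) (vge1 _); rewrite (big_setD1 C0 YC0) /= rmorph1 mulr1 => h.
rewrite -[u C0](addrK (\sum_(C in Y :\ C0) u C * repr C 1)) vgeB //.
by apply: vge_sum => C YC; rewrite rmorph1 mulr1 uC.
Qed.

(** The element [y] of [fixed_inertia] is fixed by I only. Its trace over the cosets of I in H is
    fixed by H; multiplying [y] first by a [c] supplied by [rcoset_independent] ensures that the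
    trace keeps the value of [y]. *)
Lemma fixed_uniformizer H :
  exists2 y, [/\ y \in fixedField H, y != 0 & w y = #|H :&: G0|%:Z] &
    forall z, z \in fixedField H -> (#|H :&: G0|%:Z %| w z)%Z.
Proof.
pose I := (H :&: G0)%G; have [y [Ey y0 wy] ydiv] := fixed_inertia (subsetIr H G0).
have sub z : z \in fixedField H -> z \in fixedField I.
  by move=> Ez; apply: (subvP (fixedFieldS (finset.subsetIl H G0))).
suff [z Ez [z0 wz]] : exists2 z, z \in fixedField H & z != 0 /\ w z = w y.
  by exists z => [|x /sub/ydiv //]; split; rewrite // wz.
pose S x := \sum_(C in rcosets I H) repr C x.
pose u (C : {set gal_of {:L}}) := repr C y / y.
have u0 C : vge w 0 (u C).
  by rewrite vgeE ?mulf_neq0 ?fmorph_eq0 ?invr_eq0 // dvalM ?fmorph_eq0 ?invr_eq0 // dvalV // winv subrr.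
have : ~ (forall c, c \in fixedField I -> vge w 0 c -> vge w 1 (\sum_(C in rcosets I H) u C * repr C c)).
  move=> /(rcoset_independent (fintype.subxx _) (fun C _ => u0 C)).
  have XI : (I :* 1)%g \in rcosets I H by apply/rcosetsP; exists 1%g.
  move=> /(_ _ XI); rewrite vgeE ?mulf_neq0 ?fmorph_eq0 ?invr_eq0 //.
  by rewrite dvalM ?fmorph_eq0 ?invr_eq0 // dvalV // winv subrr.
move=> /existsNP[c /not_implyP[Ec /not_implyP[c0 /negP Sc]]].
set T := \sum_(C in _) _ in Sc.
have Sy : S (y * c) = y * T.
  rewrite mulr_sumr; apply: eq_bigr => C _; rewrite rmorphM /u /=.
  by rewrite mulrA mulrC [y * _]mulrC divfK // mulrC.
exists (S (y * c)).
  apply/fixedFieldP => [|h Hh]; first exact: memvf.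
  rewrite /S rmorph_sum -[RHS](sum_rcosets I (fun C => repr C (y * c)) Hh).
  apply: eq_bigr => C XC; have [g Hg CE] := rcosetsP XC.
  transitivity ((repr C * h)%g (y * c)); first by rewrite galMx.
  apply: (@rcoset_fixed I (g * h)%g); first by rewrite rpredM.
    by rewrite mem_rcoset invMg mulgA mulgK -mem_rcoset CE mem_repr_rcoset.
  by rewrite CE -rcosetM mem_repr_rcoset.
have T0 : vge w 0 T by apply: vge_sum => C _; rewrite vgeM0 ?vge_gal.
have [Tn wT] := vge_unit T0 Sc.
by rewrite Sy mulf_neq0 //; split=> //; rewrite dvalM // wT addr0.
Qed.

(** The product [f] of the [X - t pi] is an Eisenstein polynomial over the fixed field of I.
    Evaluating [s f - f] at [pi] gives the product of the displacements [pi - s (t pi)]; in this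
    value the constant coefficient dominates, and it is displaced as much as [c] because both have
    least positive value. *)
Lemma coset_displacement H c s : c \in fixedField H -> c != 0 -> w c = #|H :&: G0|%:Z ->
  s \in G0 -> s c != c ->
  (forall t, t \in H :&: G0 -> (t * s)%g pi != pi) /\
  \sum_(t in H :&: G0) w ((t * s)%g pi - pi) = w (s c - c).
Proof.
move=> Hc c0 wc Gs sc; pose I := (H :&: G0)%G; rewrite -[H :&: G0]/(gval I) in wc *.
have [_ _ Idiv] := fixed_inertia (subsetIr H G0 : I \subset G0).
have Ic : c \in fixedField I by apply: (subvP (fixedFieldS (finset.subsetIl H G0))).
have I0 : (0 < #|I|)%N := cardG_gt0 I.
have Imin y : w y = #|I|%:Z -> forall z, z \in fixedField I -> vge w 1 z -> vge w (w y) z.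
  move=> wy z Ez; have [->|z0] := eqVneq z 0; first by rewrite !vge0.
  rewrite !vgeE // wy => z1; have /dvdzP[q qE] := Idiv z Ez; rewrite qE in z1 *.
  have I0z : 0 < #|I|%:Z by rewrite ltz_nat.
  have q1 : 1 <= q by rewrite -gtz0_ge1 -(pmulr_lgt0 q I0z) gtz0_ge1.
  by rewrite ler_peMl // ltW.
pose f : {poly L} := \prod_(t in I) ('X - (t pi)%:P).
have sf (g : gal_of {:L}) : map_poly g f = \prod_(t in I) ('X - ((t * g)%g pi)%:P).
  by rewrite rmorph_prod; apply: eq_bigr => t _; rewrite /= map_polyXsubC galMx.
have fE k : f`_k \in fixedField I.
  apply/fixedFieldP => [|g Ig]; first exact: memvf.
  suff gf : map_poly g f = f by rewrite -[g _](coef_map g) gf.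
  rewrite sf /f [RHS](reindex_inj (mulIg g)) /=.
  by apply: eq_bigl => t; rewrite groupMr.
have f0 k : vge w 0 f`_k.
  have : f \is a polyOver (valint w).
    by apply: rpred_prod => t _; rewrite polyOverXsubC valintE vge_gal vgeE // wpi.
  by move=> /polyOverP/(_ k).
have sc0 : s c - c != 0 by rewrite subr_eq0.
set D := w (s c - c).
have fD k : vge w D (s f`_k - f`_k).
  by apply: (uniformizer_bound Ic) => //; [rewrite wc ltz_nat | exact: Imin | exact: vge_val].
have wf0 : w f`_0 = #|I|%:Z.
  rewrite -horner_coef0 horner_prod (eq_bigr (fun t => - (t pi))) => [|t _]; last first.
    by rewrite hornerXsubC sub0r.
  rewrite dval_prod => [|t _]; last by rewrite oppr_eq0 fmorph_eq0.
  rewrite (eq_bigr (fun=> 1)) => [|t _]; last by rewrite dvalN winv.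
  by rewrite sumr_const natz.
(* If the constant term had a displacement of higher value, [uniformizer_bound] with that term as
   uniformizer would raise the value of [s c - c] too. *)
have [n0 wn] : s f`_0 - f`_0 != 0 /\ w (s f`_0 - f`_0) = D.
  have : ~~ vge w (D + 1) (s f`_0 - f`_0).
    apply/negP => h; have : vge w (D + 1) (s c - c).
      apply: (uniformizer_bound (fE 0%N)) => //.
      - by rewrite wf0 ltz_nat.
      - exact: Imin.
      by rewrite vgeE // wc.
    by rewrite vgeE // -/D gerDl ler10.
  have := fD 0%N; rewrite /vge; case: eqP => //= _; clear; move: (w _) => m; lia.
have prodE : \prod_(t in I) (pi - (t * s)%g pi) = (map_poly s f - f).[pi].
  have fpi : f.[pi] = 0.
    by rewrite horner_prod (bigD1 1%g) ?group1 //= hornerXsubC gal_id subrr mul0r.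
  rewrite hornerD hornerN fpi subr0 sf horner_prod.
  by apply: eq_bigr => t _; rewrite hornerXsubC.
have [P0 wP] : \prod_(t in I) (pi - (t * s)%g pi) != 0 /\
    w (\prod_(t in I) (pi - (t * s)%g pi)) = D.
  rewrite prodE (@horner_coef_wide _ (size f).+1) -?wn; last first.
    by rewrite (leq_trans (size_polyD _ _)) // size_polyN size_map_poly maxnn.
  rewrite big_ord_recl expr0 mulr1 coefB coef_map; apply: vge_addl => //.
  apply: vge_sum => k _; rewrite coefB coef_map wn; apply: vgeM; first exact: fD.
  by apply: vgeW (vgeX _ (vge_val w pi)); rewrite wpi lift0 natz.
have Pt t : t \in I -> (t * s)%g pi != pi.
  move=> It; rewrite eq_sym -subr_eq0.
  by move: P0; rewrite (bigD1 t) //= mulf_eq0 negb_or => /andP[].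
split=> //; rewrite -wP dval_prod => [|t It]; last by rewrite subr_eq0 eq_sym Pt.
by apply: eq_bigr => t _; rewrite -dvalN opprB.
Qed.

Lemma lower_ramP (t : rat) s : 0 <= t ->
  reflect (s \in G0 /\ (s pi != pi -> t + 1 <= (w (s pi - pi))%:~R)) (s \in lower_ram w t).
Proof.
move=> t0; rewrite [s \in lower_ram w t]inE gal_in /=; apply: (iffP (asboolP _)) => [h|[Gs h] x x0].
  split=> [|spi].
    apply/inertiaP => x x0; have := h x x0; rewrite unfold_in /val_ge /vge.
    case: eqP => //= _ tw; rewrite -(ler_int rat); apply: le_trans tw.
    by rewrite lerDr.
  have := h pi; rewrite valintE vgeE // wpi => /(_ isT).
  by rewrite unfold_in /val_ge subr_eq0 (negPf spi).
have [spi|spi] := eqVneq (s pi) pi.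
  by rewrite (inertia_gal_eq1 Gs spi) gal_id subrr unfold_in /val_ge eqxx.
have := inertia_gal_bound Gs (vge_val w _) x0; rewrite unfold_in /val_ge /vge.
case: eqP => //= _; rewrite -(ler_int rat); apply: le_trans; exact: h.
Qed.

(** The displacement [w (s pi - pi)] truncated at [u], and counted as infinite when [s] fixes [pi].
    The argument is t + 1 for a lower index t, so that inside the inertia group G_t is given by
    [depth s u = u]. *)
Definition depth s (u : rat) : rat :=
  if s pi == pi then u else Num.min (w (s pi - pi))%:~R u.

(** Herbrand's function of the subgroup I, with argument and value both shifted by one. *)
Definition phi (I : {set gal_of {:L}}) (u : rat) : rat := (\sum_(s in I) depth s u) / #|I|%:R.

Lemma lower_ram_depth (t : rat) s : 0 <= t -> s \in G0 ->
  (s \in lower_ram w t) = (depth s (t + 1) == t + 1).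
Proof.
move=> t0 Gs; rewrite /depth; apply/lower_ramP/idP => // [[_]|].
  by case: eqP => //= _ /(_ isT) h; rewrite min_r.
move=> h; split=> // spi; move: h; rewrite (negPf spi) => /eqP <-.
by rewrite ge_min lexx.
Qed.

Lemma lower_ram0 : lower_ram w 0 = G0.
Proof.
apply/setP => s; apply/lower_ramP/idP => // [[]//|Gs]; split=> // spi.
rewrite add0r (ler_int _ 1); have /inertiaP/(_ pi) := Gs.
by rewrite !vgeE ?subr_eq0 // wpi => /(_ isT).
Qed.

(** Pairs of an index i and an element [s] of G_i are counted by [s] instead of by i; each [s] then
    contributes the value found in [sum_steps]. *)
Lemma herbrandE (t : rat) : 0 <= t -> herbrand w t + 1 = phi G0 (t + 1).
Proof.
move=> t0; rewrite /herbrand /phi lower_ram0; set m := Num.truncn t.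
have G00 : #|G0|%:R != 0 :> rat by rewrite pnatr_eq0 -lt0n cardG_gt0.
have /andP[mt tm] : m%:R <= t < m.+1%:R by exact: truncn_itv.
have cardE (i : nat) : #|lower_ram w i%:R|%:R = \sum_(s in G0) (s \in lower_ram w i%:R)%:R :> rat.
  rewrite -sum1_card natr_sum big_mkcond [RHS]big_mkcond; apply: eq_bigr => s _.
  have [/lower_ramP[|->//]|] := boolP (s \in lower_ram w i%:R); first by rewrite ler0n.
  by case: ifP.
apply: (mulIf G00); rewrite mulrDl mul1r !divfK //.
rewrite (eq_bigr _ (fun i _ => cardE i)) exchange_big cardE mulr_sumr -big_split /=.
rewrite -sum1_card natr_sum -big_split; apply: eq_bigr => s Gs /=.
rewrite (eq_bigr (fun i => (s \in lower_ram w i%:R)%:R)) //.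
have inE' (i : nat) : (s \in lower_ram w i%:R) = (s pi == pi) || (i < `|w (s pi - pi)%R|)%N.
  have iE : i%:R + 1 = (i%:Z + 1)%:~R :> rat by rewrite rmorphD.
  apply/(lower_ramP s (ler0n _ i))/idP => [[_]|].
    case: eqP => //= spi /(_ isT); rewrite iE ler_int.
    by move: (w _) => n; clear; lia.
  move=> h; split=> // spi; move: h; rewrite (negPf spi) iE ler_int /=.
  have /inertiaP/(_ pi) := Gs; rewrite !vgeE ?subr_eq0 // wpi => /(_ isT).
  by move: (w _) => n; clear; lia.
rewrite inE' (eq_bigr (fun i : nat => ((s pi == pi) || (i < `|w (s pi - pi)%R|)%N)%:R));
  last by move=> i _; rewrite inE'.
rewrite /depth; have [spi|spi] /= := eqVneq (s pi) pi.
  by rewrite sumr_const_nat subn1 /= mulr1 subrKC.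
have w1 : 1 <= w (s pi - pi).
  by have /inertiaP/(_ pi) := Gs; rewrite !vgeE ?subr_eq0 // wpi => /(_ isT).
have n1 : (0 < `|w (s pi - pi)%R|)%N by move: (w _) w1 => n; clear; lia.
rewrite (sum_steps _ n1); last by rewrite mt.
by congr (Num.min _ _); move: (w _) w1 => [n|//].
Qed.

(** * Herbrand's function of a subgroup of the inertia group: monotonicity and surjectivity *)

Section Phi.
Variable I : {group gal_of {:L}}.
Hypothesis IG0 : I \subset G0.

Lemma depth_min s a b : depth s (Num.min a b) = Num.min (depth s a) (depth s b).
Proof. by rewrite /depth; case: ifP => // _; rewrite minACA minxx. Qed.

Lemma depth_le s a b : a <= b -> depth s a <= depth s b.
Proof. by move=> /min_idPl <-; rewrite depth_min ge_min lexx orbT. Qed.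

Lemma depth_id s u : depth s u <= u.
Proof. by rewrite /depth; case: ifP => // _; rewrite ge_min lexx orbT. Qed.

Lemma card_rat_gt0 : 0 < #|I|%:R :> rat.
Proof. by rewrite ltr0n cardG_gt0. Qed.

Lemma phi_lt a b : a < b -> phi I a < phi I b.
Proof.
move=> ab; rewrite /phi ltr_pM2r ?invr_gt0 ?card_rat_gt0 // !(bigD1 1%g (group1 I)) /=.
rewrite ltr_leD //; first by rewrite /depth gal_id eqxx.
by apply: ler_sum => s _; apply/depth_le/ltW.
Qed.

Lemma phi_le a b : (phi I a <= phi I b) = (a <= b).
Proof. exact: (le_mono phi_lt). Qed.

Lemma phi_min a b : phi I (Num.min a b) = Num.min (phi I a) (phi I b).
Proof.
have [ab|ba] := leP a b; first by rewrite min_l ?phi_le.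
by rewrite min_r // phi_le ltW.
Qed.

Lemma phi_id u : phi I u <= u.
Proof.
rewrite ler_pdivrMr ?card_rat_gt0 // mulr_natr -sumr_const.
by apply: ler_sum => s _; apply: depth_id.
Qed.

Lemma inertia_displacement s : s \in G0 -> s pi != pi -> 1 <= w (s pi - pi).
Proof. by move=> /inertiaP/(_ pi) h spi; move: h; rewrite !vgeE ?subr_eq0 // wpi => /(_ isT). Qed.

Lemma depth1 s : s \in I -> depth s 1 = 1.
Proof.
move=> /(fintype.subsetP IG0) Gs; rewrite /depth; case: eqVneq => // spi.
by rewrite min_r // (ler_int _ 1) inertia_displacement.
Qed.

Lemma phi1 : phi I 1 = 1.
Proof.
by rewrite /phi (eq_bigr _ depth1) sumr_const divff // gt_eqF ?card_rat_gt0.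
Qed.

(** Displacements are integers, so each truncation is affine between consecutive integers. This is
    what allows the function to be inverted over the rationals. *)
Lemma phi_segment (m : nat) (x : rat) : 0 <= x <= 1 ->
  phi I (m%:R + x) = phi I m%:R + x * (phi I m.+1%:R - phi I m%:R).
Proof.
move=> /andP[x0 x1]; rewrite /phi -mulrBl mulrA -mulrDl; congr (_ / _).
rewrite -sumrB mulr_sumr -big_split; apply: eq_bigr => s _ /=.
rewrite /depth; case: eqVneq => [_|_]; first by rewrite -natr1 addrAC subrr add0r mulr1.
move: (w _) => n; have [nm|mn] := leP n m%:Z.
  have nm' : n%:~R <= m%:R :> rat by rewrite -[m%:R]/(m%:~R) ler_int.
  rewrite !min_l ?subrr ?mulr0 ?addr0 // (le_trans nm') ?ler_nat //.
  by rewrite lerDl.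
have mn' : m.+1%:R <= n%:~R :> rat by rewrite -[m.+1%:R]/(m.+1%:~R) ler_int; lia.
rewrite !min_r // ?(le_trans _ mn') ?ler_nat // -natr1.
  by rewrite addrAC subrr add0r mulr1.
by rewrite lerD2l.
Qed.

Lemma phi_surj (y : rat) : 1 <= y -> exists2 u, 1 <= u & phi I u = y.
Proof.
move=> y1; have exM : exists m : nat, y < phi I m.+1%:R.
  (* The identity alone contributes all of [u] to the sum, so [phi I u] is at least u / #|I|. *)
  exists (Num.bound (y * #|I|%:R)); rewrite ltr_pdivlMr ?card_rat_gt0 //.
  have := archi_boundP (mulr_ge0 (le_trans ler01 y1) (ltW card_rat_gt0)).
  move/lt_le_trans; apply; rewrite (bigD1 1%g (group1 I)) /= /depth gal_id eqxx.
  rewrite -[X in X <= _]addr0 lerD ?ler_nat // sumr_ge0 // => s /andP[Is _].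
  by rewrite (le_trans _ (depth_le s (_ : 1 <= _))) ?ler1n // depth1.
case: (ex_minnP exM) => [[|m]] ym mmin; first by rewrite phi1 ltNge y1 in ym.
have my : phi I m.+1%:R <= y.
  by rewrite leNgt; apply/negP => /mmin; rewrite ltnn.
have d0 : 0 < phi I m.+2%:R - phi I m.+1%:R by rewrite subr_gt0 phi_lt // ltr_nat.
pose x := (y - phi I m.+1%:R) / (phi I m.+2%:R - phi I m.+1%:R).
have x0 : 0 <= x by rewrite divr_ge0 ?subr_ge0 // -subr_ge0 ltW.
exists (m.+1%:R + x); first by rewrite -[1]addr0 lerD // ler1n.
rewrite phi_segment; first by rewrite divfK ?gt_eqF // subrKC.
by rewrite x0 ler_pdivrMr // mul1r lerD2r ltW.
Qed.

End Phi.
End Ramification.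

(** * Herbrand's theorem *)

(** By normality a minimal polynomial splits in L1, so its roots in M all lie in the image of [g];
    hence [f] factors through [g]. *)
Lemma normal_embedding (K : fieldType) (L1 : splittingFieldType K) (M : fieldType)
    (f g : {rmorphism L1 -> M}) : (forall a : K, f a%:A = g a%:A) ->
  exists s : gal_of {:L1}, forall x, f x = g (s x).
Proof.
move=> fg; have /normalFieldP nL := normalFieldf (1%AS : {subfield L1}).
have ex x : exists y, f x = g y.
  have [r _ rP] := nL x (memvf x).
  have fgP : map_poly f (minPoly 1 x) = map_poly g (minPoly 1 x).
    apply/polyP => i; rewrite !coef_map /=.
    by have /vlineP[a ->] := polyOverP (minPolyOver 1 x) i.
  have : root (map_poly f (minPoly 1 x)) (f x) by rewrite fmorph_root root_minPoly.
  rewrite fgP rP rmorph_prod (eq_bigr (fun b => 'X - (g b)%:P)); last first.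
    by move=> b _; rewrite /= map_polyXsubC.
  rewrite -(big_map g xpredT (fun b => 'X - b%:P)) root_prod_XsubC => /mapP[y _ ->].
  by exists y.
have [h hP] := choice ex.
have hlin : linear h.
  move=> a x y; apply: (fmorph_inj g); rewrite -hP.
  by rewrite -[a *: x]mulr_algl -[a *: h x]mulr_algl !rmorphD !rmorphM /= fg !hP.
pose hl : {linear L1 -> L1} := HB.pack h (GRing.isLinear.Build K L1 L1 _ h hlin).
have hom : kHom 1 {:L1} (linfun hl).
  apply/kHom_monoid_morphism; split=> [|x y]; rewrite !lfunE /=;
    apply: (fmorph_inj g); rewrite -!hP ?rmorph1 //.
  by rewrite !rmorphM /= !hP.
have [|s _ sP] := @kAut_to_gal _ _ 1%AS {:L1}%AS (linfun hl); first by rewrite kAutfE.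
by exists s => x; rewrite hP -sP ?memvf // lfunE.
Qed.

Lemma gal_scalar (K : fieldType) (L : splittingFieldType K) (s : gal_of {:L}) (a : K) :
  s a%:A = a%:A.
Proof. by rewrite linearZ /= rmorph1. Qed.

Section Image.
Variables (K : fieldType) (L1 L : fieldExtType K) (iota : {lrmorphism L1 -> L}).

Definition image_field : {subfield L} := <<1 & map iota (vbasis {:L1})>>%AS.
Lemma image_fieldP x : reflect (exists y, x = iota y) (x \in image_field).
Proof.
have -> : (x \in image_field) = (x \in limg (linfun iota)).
  have <- : (linfun iota @: <<1 & vbasis {:L1}>> = limg (linfun iota))%VS.
    congr (_ @: _)%VS; apply/eqP; rewrite eqEsubv subvf -{1}(span_basis (vbasisP {:L1})).
    by apply/span_subvP => y; apply: seqv_sub_adjoin.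
  rewrite (aimg_adjoin_seq (linfun_ahom iota)) aimg1; congr (_ \in <<_ & _>>%VS).
  by apply: eq_map => y; rewrite lfunE.
apply: (iffP memv_imgP) => [[y _ ->]|[y ->]]; exists y; rewrite ?lfunE ?memvf //.
Qed.

End Image.

Section Local.
Variables (K : fieldType) (v : dvaluation K) (p : nat).
Hypotheses (localK : is_local_field v) (pK : p \in [pchar K]).

Section One.
Variables (L : splittingFieldType K) (w : dvaluation L) (e : nat).
Hypotheses (e_gt0 : (0 < e)%N) (wK : forall a : K, w a%:A = v a *+ e).

(** By [vge_nrm], used for the embeddings [s] and the identity, integrality of [s x] and of [x] is
    decided by the same norm; as [s] is onto, [dval_scale1] excludes a scaling factor. *)
Lemma dval_gal (s : gal_of {:L}) x : w (s x) = w x.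
Proof.
apply: (@dval_scale1 _ _ w w (s : {rmorphism L -> L})) => [y|y].
  by exists ((s^-1)%g y); have := galMx (s^-1)%g s y; rewrite mulVg gal_id.
rewrite [RHS](vge_nrm (iota := (s : {rmorphism L -> L})) localK pK e_gt0); last first.
  by move=> a; apply: etrans (congr1 w (gal_scalar s a)) (wK a).
by rewrite (vge_nrm (iota := (idfun : {rmorphism L -> L})) localK pK e_gt0).
Qed.

Lemma pchar_ext : p \in [pchar L].
Proof. exact: (rmorph_pchar (in_alg L) pK). Qed.

Definition ext_resid x := @residue_power K v p localK pK L w e x e_gt0 wK.
Definition ext_closed V x := @vspace_closed K v p localK pK L w e V x e_gt0 wK.

End One.

Section OneUpper.
Variables (L : splittingFieldType K) (w : dvaluation L) (e : nat).
Hypothesis galL : galois 1%AS {:L}.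
Hypotheses (e_gt0 : (0 < e)%N) (wK : forall a : K, w a%:A = v a *+ e).
Variables (pi : L) (pi0 : pi != 0) (wpi : w pi = 1).

Local Notation winv := (dval_gal e_gt0 wK).
Local Notation G0 := (inertia_group winv).
Local Notation resid := (ext_resid e_gt0 wK).
Local Notation closed := (ext_closed e_gt0 wK).
Local Notation pL := (pchar_ext L).

(** This is [fixed_uniformizer] for the whole Galois group: the fixed field is K, on which the least
    positive value of [w] is e. *)
Lemma card_inertia_group : #|G0| = e.
Proof.
have [y [Ey y0 wy] ydiv] := fixed_uniformizer pL winv resid closed pi0 wpi [set: gal_of {:L}]%G.
rewrite (finset.setTI (inertia_set w)) in wy ydiv.
have [varpi varpi0 wvarpi] := uniformizer v.
have E1 : fixedField [set: gal_of {:L}]%G = 1%VS :> {vspace L}.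
  have /galois_fixedField <- := galL; congr fixedField.
  by apply/setP => s; rewrite inE gal_in.
apply/eqP; rewrite eqn_dvd; apply/andP; split.
  have := ydiv varpi%:A; rewrite E1 wK wvarpi natz; apply.
  by apply/vlineP; exists varpi.
have /vlineP[a ya] : y \in 1%VS by rewrite -E1.
by move: wy; rewrite ya wK => /mulrn_eq_dvdn.
Qed.

(** The point is that [u] is the Herbrand value of some lower index, which [phi_surj] provides. *)
Lemma upper_ram1 (u : rat) : 0 <= u -> upper_ram w u 1%g.
Proof.
move=> u0; have [|y y1 yu] := @phi_surj K p L w galL pL winv pi pi0 wpi G0 (fintype.subxx _) (u + 1).
  by rewrite lerDr.
have y0 : 0 <= y - 1 by rewrite subr_ge0.
exists (y - 1); split=> //.
  by apply: (addIr 1); rewrite (herbrandE galL pL winv resid pi0 wpi) // subrK.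
by apply/(lower_ramP galL pL winv resid pi0 wpi) => //; split; rewrite ?group1 // gal_id eqxx.
Qed.

Lemma herbrand_le (t : rat) : 0 <= t -> herbrand w t <= t.
Proof.
move=> t0; rewrite -(lerD2r 1) (herbrandE galL pL winv resid pi0 wpi) //.
exact: phi_id.
Qed.

End OneUpper.

(** * Two Galois extensions, one embedded in the other *)

Section Pair.
Variables (L1 : splittingFieldType K) (w1 : dvaluation L1) (e1 : nat).
Hypothesis galL1 : galois 1%AS {:L1}.
Hypotheses (e1_gt0 : (0 < e1)%N) (w1K : forall a : K, w1 a%:A = v a *+ e1).
Variables (L : splittingFieldType K) (w : dvaluation L) (e : nat).
Hypothesis galL : galois 1%AS {:L}.
Hypotheses (e_gt0 : (0 < e)%N) (wK : forall a : K, w a%:A = v a *+ e).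
Variable iota : {lrmorphism L1 -> L}.
Variables (pi1 : L1) (pi10 : pi1 != 0) (wpi1 : w1 pi1 = 1).
Variables (pi : L) (pi0 : pi != 0) (wpi : w pi = 1).

Local Notation winv := (dval_gal e_gt0 wK).
Local Notation G0 := (inertia_group winv).
Local Notation resid := (ext_resid e_gt0 wK).
Local Notation closed := (ext_closed e_gt0 wK).
Local Notation pL := (pchar_ext L).
Local Notation winv1 := (dval_gal e1_gt0 w1K).
Local Notation G1 := (inertia_group winv1).
Local Notation resid1 := (ext_resid e1_gt0 w1K).
Local Notation pL1 := (pchar_ext L1).

Lemma iotaA a : iota a%:A = a%:A.
Proof. by rewrite linearZ /= rmorph1. Qed.

Lemma ex_restrict (s : gal_of {:L}) : exists s1 : gal_of {:L1}, forall x, s (iota x) = iota (s1 x).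
Proof.
apply: (normal_embedding (f := (s : {rmorphism L -> L}) \o iota)) => a /=.
by rewrite iotaA gal_scalar.
Qed.

Definition restrict (s : gal_of {:L}) : gal_of {:L1} := sval (cid (ex_restrict s)).
Lemma restrictE (s : gal_of {:L}) x : s (iota x) = iota (restrict s x).
Proof. exact: svalP (cid (ex_restrict s)) x. Qed.

Lemma restrictM (s t : gal_of {:L}) : restrict (s * t)%g = (restrict s * restrict t)%g.
Proof.
apply: gal_eqx => x; apply: (fmorph_inj iota).
transitivity (t (s (iota x))); first by rewrite -galMx restrictE.
by rewrite !restrictE galMx.
Qed.

Local Notation image_field := (image_field iota).
Definition image_gal : {group gal_of {:L}} := 'Gal({:L} / image_field)%G.
Local Notation H := image_gal.

Lemma fixed_image : fixedField H = image_field.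
Proof.
apply/galois_fixedField; apply: galoisS galL; by rewrite sub1v subvf.
Qed.

Lemma image_galP s : reflect (restrict s = 1%g) (s \in H).
Proof.
rewrite /= gal_kHom ?subvf //; apply: (iffP kAHomP) => [h|r1 x /image_fieldP[y ->]].
  apply: gal_eqx => x; apply: (fmorph_inj iota); rewrite gal_id.
  by apply: etrans (esym (restrictE s x)) (h _ _); apply/image_fieldP; exists x.
by rewrite restrictE r1 gal_id.
Qed.

Local Notation m := #|H :&: G0|.

Lemma image_dval x : w (iota x) = w1 x *+ m.
Proof.
have vgeE x' : vge w1 0 x' = vge w 0 (iota x').
  rewrite (vge_nrm (iota := (iota : {rmorphism L1 -> L})) localK pK e_gt0) => [|a]; last by rewrite /= iotaA.
  by rewrite (vge_nrm (iota := (idfun : {rmorphism L1 -> L1})) localK pK e1_gt0).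
have [m' m'0 m'P] := dval_scale vgeE; rewrite m'P; congr (_ *+ _).
have [y [Ey y0 wy] ydiv] := fixed_uniformizer pL winv resid closed pi0 wpi H.
rewrite fixed_image in Ey ydiv.
apply/eqP; rewrite eqn_dvd; apply/andP; split.
  have /image_fieldP[z yz] := Ey; move: wy; rewrite yz m'P.
  exact: mulrn_eq_dvdn.
have := ydiv (iota pi1); rewrite m'P wpi1 natz; apply.
by apply/image_fieldP; exists pi1.
Qed.

Lemma restrict_inertia s : s \in G0 -> restrict s \in G1.
Proof.
move=> /inertiaP Gs; apply/inertiaP => x xint.
have m0 : (0 < m)%N by rewrite cardG_gt0.
have ixint : vge w 0 (iota x).
  move: xint; rewrite /vge fmorph_eq0 image_dval; case: eqP => //= _.
  exact: mulrn_wge0.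
have [->|x0] := eqVneq x 0; first by rewrite rmorph0 subr0 vge0.
have := Gs _ ixint; rewrite restrictE -rmorphB /vge !fmorph_eq0.
rewrite image_dval pmulrn mulrzz; case: eqP => //= _.
by move: (w1 _) m0 => a; move: (#|_|) => n; clear; nia.
Qed.

Lemma restrict_fiber s0 (V : nmodType) (F : gal_of {:L} -> V) : s0 \in G0 ->
  \sum_(s in G0 | restrict s == restrict s0) F s = \sum_(t in H :&: G0) F (t * s0)%g.
Proof.
move=> Gs0; rewrite (reindex_inj (mulIg s0)) /=; apply: eq_bigl => t.
rewrite finset.in_setI (@groupMr _ G0 s0 t Gs0) andbC; congr andb; rewrite restrictM.
apply/eqP/image_galP => [|->]; last by rewrite mul1g.
by move=> /(canRL (mulgK _)); rewrite mulgV.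
Qed.

(** By counting: the fibres have [m] elements, the two inertia groups have orders e and e1, and e =
    e1 m. *)
Lemma restrict_inertia_onto : restrict @: G0 = G1.
Proof.
have sub : restrict @: G0 \subset G1.
  by apply/fintype.subsetP => _ /imsetP[s Gs ->]; apply: restrict_inertia.
apply/eqP; rewrite eqEcard sub /=.
have m0 : (0 < m)%N by rewrite cardG_gt0.
rewrite -(leq_pmul2r m0) (card_inertia_group galL1 e1_gt0 w1K pi10 wpi1).
have -> : (e1 * m)%N = e.
  have [varpi varpi0 wvarpi] := uniformizer v.
  by have := image_dval varpi%:A; rewrite iotaA wK w1K wvarpi; clear; lia.
rewrite -[X in (X <= _)%N](card_inertia_group galL e_gt0 wK pi0 wpi) -sum1_card.
rewrite (partition_big restrict (mem (restrict @: G0))) /= => [|s Gs]; last exact: imset_f.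
rewrite -sum_nat_const; apply: leq_sum => _ /imsetP[s0 Gs0 ->].
by rewrite (restrict_fiber (fun=> 1%N) Gs0) sum1_card.
Qed.

Local Notation phiH := (phi w pi (H :&: G0)).

Lemma IG0 : H :&: G0 \subset G0. Proof. exact: finset.subsetIr. Qed.

(** Among the lifts of [sigma], [s0] has the displacement of greatest value j. Since [t * s0]
    displaces [pi] by [s0 (t pi - pi) + (s0 pi - pi)], its displacement has value the minimum of j
    and that of [t]: the ultrametric inequality gives one bound, and maximality of j the other when
    that of [t] is at least j. Summing over [t] with [coset_displacement] expresses the displacement
    of [sigma] as [phiH] of j. *)
Lemma deepest_lift sigma : sigma \in G1 -> sigma pi1 != pi1 -> exists2 s0,
  [/\ s0 \in G0, restrict s0 = sigma & forall s, s \in G0 -> restrict s = sigma ->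
       s pi != pi /\ w (s pi - pi) <= w (s0 pi - pi)] &
  (w1 (sigma pi1 - pi1))%:~R = phiH (w (s0 pi - pi))%:~R /\
  forall t u, t \in H :&: G0 ->
    depth w pi (t * s0)%g u = depth w pi t (Num.min (w (s0 pi - pi))%:~R u).
Proof.
move=> Gsigma spi1; have /imsetP[s1 Gs1 s1E] : sigma \in restrict @: G0.
  by rewrite restrict_inertia_onto.
have moves s : s \in G0 -> restrict s = sigma -> s (iota pi1) != iota pi1.
  by move=> _ sE; rewrite restrictE sE (inj_eq (fmorph_inj iota)).
have cH : iota pi1 \in fixedField H.
  by rewrite fixed_image; apply/image_fieldP; exists pi1.
have c0 : iota pi1 != 0 by rewrite fmorph_eq0.
have wc : w (iota pi1) = m%:Z by rewrite image_dval wpi1 natz.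
have disp s : s \in G0 -> restrict s = sigma ->
  (forall t, t \in H :&: G0 -> (t * s)%g pi != pi) /\
  \sum_(t in H :&: G0) w ((t * s)%g pi - pi) = w1 (sigma pi1 - pi1) *+ m.
  move=> Gs sE; have -> : w1 (sigma pi1 - pi1) *+ m = w (s (iota pi1) - iota pi1).
    by rewrite restrictE sE -rmorphB image_dval.
  by apply: (coset_displacement galL pL resid closed pi0 wpi cH) => //; apply: moves.
have neq s : s \in G0 -> restrict s = sigma -> s pi != pi.
  by move=> Gs sE; have [/(_ 1%g (group1 _))] := disp s Gs sE; rewrite mul1g.
pose P s := (s \in G0) && (restrict s == sigma).
have Ps1 : P s1 by rewrite /P Gs1 s1E eqxx.
have [s0 /andP[Gs0 /eqP s0E] s0max] := @arg_maxP _ _ _ s1 P (fun s => w (s pi - pi)) Ps1.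
exists s0.
  by split=> // s Gs sE; split; [exact: neq | apply: s0max; rewrite /P Gs sE eqxx].
set j := w (s0 pi - pi) in s0max *.
have Gts t : t \in H :&: G0 -> (t * s0)%g \in G0.
  by move=> /setIP[_ Gt]; rewrite (@groupM _ G0).
have tsE t : t \in H :&: G0 -> restrict (t * s0)%g = sigma.
  by move=> /setIP[Ht _]; rewrite restrictM (image_galP t Ht) mul1g.
have tsj t : t \in H :&: G0 -> w ((t * s0)%g pi - pi) <= j.
  by move=> Ht; apply: s0max; rewrite /P Gts // tsE // eqxx.
have depthE t u : t \in H :&: G0 -> depth w pi (t * s0)%g u = depth w pi t (Num.min j%:~R u).
  move=> Ht; have tsne := neq _ (Gts t Ht) (tsE t Ht).
  rewrite /depth (negPf tsne); case: eqVneq => [tpi|tpi]; first by rewrite galMx tpi.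
  rewrite minA; congr (Num.min _ _).
  have dE : (t * s0)%g pi - pi = s0 (t pi - pi) + (s0 pi - pi).
    by rewrite galMx rmorphB /= addrA subrK.
  have s0ne := neq _ Gs0 s0E.
  have [ltj|gej] := ltP (w (t pi - pi)) j.
    rewrite min_l ?ler_int 1?ltW // dE; congr _%:~R.
    have a0 : s0 (t pi - pi) != 0 by rewrite fmorph_eq0 subr_eq0.
    have [|_ ->] := @vge_addl _ w (s0 (t pi - pi)) (s0 pi - pi) a0.
      by rewrite vgeE ?subr_eq0 // winv lezD1.
    by rewrite winv.
  rewrite min_r ?ler_int //; congr _%:~R; apply/eqP; rewrite eq_le tsj //=.
  have : vge w j ((t * s0)%g pi - pi).
    by rewrite dE vgeD // ?(vge_gal winv) // vgeE ?subr_eq0.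
  by rewrite vgeE // subr_eq0.
split=> //; have [_ sumE] := disp s0 Gs0 s0E.
have m0 : m%:R != 0 :> rat by rewrite pnatr_eq0 -lt0n cardG_gt0.
apply: (mulIf m0); rewrite /phi divfK // mulr_natr -rmorphMn -sumE rmorph_sum.
apply: eq_bigr => t Ht; rewrite -[j%:~R]minxx -depthE //.
by rewrite /depth (negPf (neq _ (Gts t Ht) (tsE t Ht))) min_l // ler_int tsj.
Qed.

Lemma restrict1 : restrict 1%g = 1%g.
Proof. by apply/image_galP; rewrite group1. Qed.

Lemma inertia1 sigma : sigma \in G1 -> sigma pi1 = pi1 -> sigma = 1%g.
Proof. exact: (inertia_gal_eq1 galL1 pL1 resid1 wpi1). Qed.

Lemma sum_depth_fiber sigma u : sigma \in G1 ->
  \sum_(s in G0 | restrict s == sigma) depth w pi s u = m%:R * depth w1 pi1 sigma (phiH u).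
Proof.
move=> Gsigma; have m0 : m%:R != 0 :> rat by rewrite pnatr_eq0 -lt0n cardG_gt0.
have [spi|spi] := eqVneq (sigma pi1) pi1.
  rewrite (inertia1 Gsigma spi) -restrict1 (restrict_fiber (fun s => depth w pi s u) (group1 G0)).
  rewrite restrict1 /depth gal_id eqxx /phi mulrC divfK //; apply: eq_bigr => t _.
  by rewrite mulg1.
have [s0 [Gs0 s0E _] [jE depthE]] := deepest_lift Gsigma spi.
rewrite -{1}s0E (restrict_fiber (fun s => depth w pi s u) Gs0).
rewrite {2}/depth (negPf spi) jE -(phi_min w pi (H :&: G0)%G) /phi mulrC divfK //.
by apply: eq_bigr => t Ht; rewrite depthE.
Qed.

Lemma card_inertia_mul : #|G0|%:R = m%:R * #|G1|%:R :> rat.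
Proof.
rewrite -natrM (card_inertia_group galL e_gt0 wK pi0 wpi).
rewrite (card_inertia_group galL1 e1_gt0 w1K pi10 wpi1); congr _%:R.
have [varpi varpi0 wvarpi] := uniformizer v.
by have := image_dval varpi%:A; rewrite iotaA wK w1K wvarpi; clear; lia.
Qed.

(** Transitivity of Herbrand's function: the sum over the inertia group of L is grouped by
    restriction to L1, and [sum_depth_fiber] evaluates each group. *)
Lemma phi_comp u : phi w pi G0 u = phi w1 pi1 G1 (phiH u).
Proof.
rewrite {1 2}/phi card_inertia_mul invfM mulrA; congr (_ / _).
have m0 : m%:R != 0 :> rat by rewrite pnatr_eq0 -lt0n cardG_gt0.
apply: (mulIf m0); rewrite divfK // mulr_suml.
rewrite (partition_big restrict (mem G1)) /= => [|s Gs]; last exact: restrict_inertia.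
by apply: eq_bigr => sigma Gsigma; rewrite sum_depth_fiber // mulrC.
Qed.

(** The lower index t on L becomes [phiH (t + 1) - 1] on L1 by [phi_comp]; [deepest_lift] and
    monotonicity of [phiH] carry the bound on displacements over. *)
Lemma upper_ram_restrict (u : rat) s : upper_ram w u s -> upper_ram w1 u (restrict s).
Proof.
move=> [t [t0 tu /(lower_ramP galL pL winv resid pi0 wpi s t0)[Gs st]]].
have phi1 : phiH 1 = 1 by apply: (phi1 pi0 wpi IG0).
have t1 : 1 <= phiH (t + 1) by rewrite -{1}phi1 (phi_le w pi (H :&: G0)%G) lerDr.
have t1' : 0 <= phiH (t + 1) - 1 by rewrite subr_ge0.
exists (phiH (t + 1) - 1); split=> //.
  apply: (addIr 1); rewrite (herbrandE galL1 pL1 winv1 resid1 pi10 wpi1) // subrK -phi_comp.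
  by rewrite -tu (herbrandE galL pL winv resid pi0 wpi).
apply/(lower_ramP galL1 pL1 winv1 resid1 pi10 wpi1) => //.
split=> [|spi]; first exact: restrict_inertia.
have [s0 [_ _ s0max] [-> _]] := deepest_lift (restrict_inertia Gs) spi.
have [sne sle] := s0max s Gs erefl.
rewrite subrK (phi_le w pi (H :&: G0)%G) (le_trans (st sne)) // ler_int //.
Qed.

(** The deepest lift works: its displacement has [phiH] value equal to the displacement of [sigma],
    and [phiH] reflects the order. *)
Lemma upper_ram_lift (u : rat) sigma : upper_ram w1 u sigma ->
  exists2 s, upper_ram w u s & restrict s = sigma.
Proof.
move=> [t1 [t10 t1u /(lower_ramP galL1 pL1 winv1 resid1 pi10 wpi1 sigma t10)[Gs st]]].
have [|y y1 yE] := phi_surj galL pL pi0 wpi IG0 (_ : 1 <= t1 + 1); first by rewrite lerDr.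
have y0 : 0 <= y - 1 by rewrite subr_ge0.
have hu : herbrand w (y - 1) = u.
  apply: (addIr 1); rewrite (herbrandE galL pL winv resid pi0 wpi) // subrK phi_comp yE.
  by rewrite -t1u (herbrandE galL1 pL1 winv1 resid1 pi10 wpi1).
have [spi|spi] := eqVneq (sigma pi1) pi1.
  exists 1%g; last by rewrite (inertia1 Gs spi) restrict1.
  exists (y - 1); split=> //; apply/(lower_ramP galL pL winv resid pi0 wpi) => //.
  by rewrite group1 gal_id eqxx.
have [s0 [Gs0 s0E s0max] [jE _]] := deepest_lift Gs spi.
exists s0 => //; exists (y - 1); split=> //.
apply/(lower_ramP galL pL winv resid pi0 wpi) => //; split=> // _.
by rewrite subrK -(phi_le w pi (H :&: G0)%G) -jE yE st.
Qed.

End Pair.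
End Local.

(** * Degrees of regular functions *)

Lemma fraction_denom (R : idomainType) (x : {fraction R}) :
  exists d n : R, d != 0 /\ tofrac d * x = tofrac n.
Proof.
elim/quotW: x => r; exists (\d_r), (\n_r); split; first exact: denom_ratioP.
unlock tofrac; rewrite -[LHS]FracField.pi_mul; apply/eqmodP => /=.
rewrite FracField.equivfE /FracField.mulf /= !numden_Ratio ?mulf_neq0 ?oner_neq0 ?denom_ratioP //.
by rewrite mulr1 mul1r.
Qed.

Lemma common_denom (R : idomainType) (I : finType) (f : I -> {fraction R}) :
  exists (d : R) (g : I -> R), d != 0 /\ forall i, tofrac d * f i = tofrac (g i).
Proof.
have /choice[dn dnP] i : exists dn : R * R, dn.1 != 0 /\ tofrac dn.1 * f i = tofrac dn.2.
  by have [d [n h]] := fraction_denom (f i); exists (d, n).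
exists (\prod_i (dn i).1), (fun i => (\prod_(j | j != i) (dn j).1) * (dn i).2).
split=> [|i]; first by apply/prodf_neq0 => i _; case: (dnP i).
by rewrite (bigD1 i) //= [(dn i).1 * _]mulrC !tofracM -mulrA (dnP i).2.
Qed.

(** Pigeonhole in place of linear algebra: values of [f] are determined by #|J| constants, fewer
    than the constants in the argument. *)
Lemma ffun_collision (Fq : finFieldType) (I J : finType) (V : zmodType)
    (f : {ffun I -> Fq} -> V) (coef : V -> J -> Fq) (B : V -> Prop) :
  (#|J| < #|I|)%N -> (forall c, B (f c)) ->
  (forall x y, B x -> B y -> coef x =1 coef y -> x = y) ->
  exists c d, c != d /\ f c = f d.
Proof.
move=> JI fB cinj.
pose h (c : {ffun I -> Fq}) : {ffun J -> Fq} := [ffun j => coef (f c) j].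
have : ~~ injectiveb h.
  apply/negP => /injectiveP/leq_card; rewrite !card_ffun leqNgt ltn_exp2l ?JI //.
  exact: finNzRing_gt1.
move/injectivePn => [c [d cd hcd]]; exists c, d; split=> //.
apply: cinj => // j; have := congr1 (fun h : {ffun J -> Fq} => h j) hcd.
by rewrite !ffunE.
Qed.

Lemma size_mul_bound (R : idomainType) (f g : {poly R}) (a b : nat) :
  (size f <= a.+1)%N -> (size g <= b.+1)%N -> (size (f * g)%R <= (a + b).+1)%N.
Proof. by move=> fa gb; have := size_polyMleq f g; lia. Qed.

Section Degree.
Variables (Fq : finFieldType) (F : fieldExtType {fraction {poly Fq}}).

Local Notation toF := (@tofrac {poly Fq}).

Lemma const_funB : zmod_morphism (@const_fun Fq F).
Proof. by move=> c d; rewrite /const_fun polyCB tofracB scalerBl. Qed.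
Lemma const_funM : monoid_morphism (@const_fun Fq F).
Proof.
by split=> [|c d]; rewrite /const_fun ?scale1r // polyCM tofracM -scalerAl mul1r scalerA.
Qed.
HB.instance Definition _ := GRing.isZmodMorphism.Build Fq F (@const_fun Fq F) const_funB.
HB.instance Definition _ := GRing.isMonoidMorphism.Build Fq F (@const_fun Fq F) const_funM.

(* The powers of alpha times the x_i span too small a space of vectors of polynomials
   of bounded degree to be linearly independent over the constants. *)
Lemma powers_dependent (alpha : F) : exists N : nat, forall x : 'I_N.+1 -> F,
  exists (M : nat) (c : 'I_N.+1 -> 'I_M -> Fq),
    (exists i k, c i k != 0) /\
    \sum_i \sum_(k < M) const_fun F (c i k) * (alpha ^+ k * x i) = 0.
Proof.
pose m := vector.dim F.
have [s [B0 [s0 sB]]] := common_denom (fun ij : 'I_m * 'I_m => mult_mx alpha ij.1 ij.2).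
pose B : 'M[{poly Fq}]_m := \matrix_(i, j) B0 (i, j).
have BE : map_mx toF B = tofrac s *: mult_mx alpha.
  by apply/matrixP => i j; rewrite !mxE; apply: esym (sB (i, j)).
pose b := (size s + \sum_ij size (B0 ij))%N.
have sb : (size s <= b.+1)%N by rewrite /b; lia.
have Bb (i j : 'I_m) : (size (B i j) <= b.+1)%N.
  by rewrite mxE /b (bigD1 (i, j)) //= leqW // addnCA leq_addr.
(* This bound depends on [alpha] only, whereas [M] below depends on [x]; the uniformity is what
   later bounds the dimension of A/(a). *)
exists (m * b)%N => x.
have [u [X0 [u0 uX]]] := common_denom (fun ij : 'I_(m * b).+1 * 'I_m => v2r (x ij.1) 0 ij.2).
pose X (i : 'I_(m * b).+1) : 'rV[{poly Fq}]_m := \row_j X0 (i, j).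
have XE i : map_mx toF (X i) = tofrac u *: v2r (x i).
  by apply/rowP => j; rewrite !mxE; apply: esym (uX (i, j)).
pose a := (\sum_ij size (X0 ij))%N.
have Xa i (j : 'I_m) : (size (X i ord0 j) <= a.+1)%N.
  by rewrite mxE /a (bigD1 (i, j)) //= leqW // leq_addr.
(* There are [(m * b + 1) * M] unknown constants against [m * (a + M * b + 1)] polynomial
   coefficients; the excess is [M - m * (a + 1)], here equal to 1. *)
pose M := (m * a.+1).+1.
pose Y i := fix Y0 (k : nat) : 'rV[{poly Fq}]_m := if k is k'.+1 then Y0 k' *m B else X i.
have YE i k : map_mx toF (Y i k) = tofrac (u * s ^+ k) *: v2r (alpha ^+ k * x i).
  elim: k => [|k IHk]; first by rewrite /= XE expr0 mulr1 mul1r.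
  rewrite /= map_mxM IHk BE -scalemxAl -scalemxAr scalerA -tofracM -mulrA -exprSr.
  by rewrite -mult_mxE [_ * alpha]mulrC mulrA -exprS.
have Ysz i k (j : 'I_m) : (size (Y i k ord0 j) <= (a + k * b).+1)%N.
  elim: k j => [|k IHk] j /=; first by rewrite mul0n addn0.
  rewrite mxE (leq_trans (size_sum _ _ _)) //; apply/bigmax_leqP => l _.
  by rewrite mulSn addnC -addnA addnC [(_ + a)%N]addnC; apply: size_mul_bound.
(* The power of [s] brings all terms to the common denominator [u * s ^+ M]. *)
pose Z i (k : 'I_M) := s ^+ (M - k) *: Y i k.
have ssz k : (size (s ^+ k) <= (k * b).+1)%N.
  elim: k => [|k IHk]; first by rewrite expr0 size_poly1.
  by rewrite exprS mulSn; apply: size_mul_bound.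
have Zsz i (k : 'I_M) (j : 'I_m) : (size (Z i k ord0 j) <= (a + M * b).+1)%N.
  rewrite mxE; have -> : (a + M * b = (M - k) * b + (a + k * b))%N.
    by rewrite addnCA -mulnDl subnK // ltnW.
  exact: size_mul_bound.
pose f (c : {ffun 'I_(m * b).+1 * 'I_M -> Fq}) : 'rV[{poly Fq}]_m :=
  \sum_i \sum_k (c (i, k))%:P *: Z i k.
have fsz c (j : 'I_m) : (size (f c ord0 j) <= (a + M * b).+1)%N.
  rewrite summxE (leq_trans (size_sum _ _ _)) //; apply/bigmax_leqP => i _.
  rewrite summxE (leq_trans (size_sum _ _ _)) //; apply/bigmax_leqP => k _.
  rewrite mxE; apply: (@size_mul_bound _ _ _ 0) => //.
  by rewrite size_polyC leq_b1.
have [|//||c [d [cd fcd]]] := @ffun_collision Fq _ ('I_m * 'I_(a + M * b).+1)%type _ f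
  (fun y jl => (y 0 jl.1)`_jl.2) (fun y => forall j, (size (y ord0 j) <= (a + M * b).+1)%N).
- by rewrite !card_prod !card_ord /M; nia.
- move=> y z ysz zsz yz; apply/rowP => j; apply/polyP => l.
  have [lt_l|ge_l] := ltnP l (a + M * b).+1; first exact: (yz (j, Ordinal lt_l)).
  by rewrite !nth_default // (leq_trans _ ge_l).
exists M, (fun i k => c (i, k) - d (i, k)); split.
  have : [exists ik, c ik != d ik].
    apply: contraNT cd; rewrite negb_exists => /forallP h; apply/eqP/ffunP => ik.
    by apply/eqP; have := h ik; rewrite negbK.
  by move=> /existsP[[i k] ik]; exists i, k; rewrite subr_eq0.
have us0 : tofrac (u * s ^+ M) != 0 by rewrite tofrac_eq0 mulf_neq0 // expf_neq0.
apply: v2r_inj; apply: (scalerI us0); rewrite linear0 scaler0.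
transitivity (map_mx toF (f c - f d)); last by rewrite fcd subrr map_mx0.
rewrite /f -sumrB linear_sum scaler_sumr raddf_sum; apply: eq_bigr => i _ /=.
rewrite -sumrB linear_sum scaler_sumr raddf_sum; apply: eq_bigr => k _ /=.
rewrite -scalerBl -polyCB map_mxZ /Z map_mxZ YE /const_fun mulr_algl linearZ /= !scalerA.
congr (_ *: _); rewrite -!tofracM; congr (toF _).
have -> : s ^+ M = s ^+ (M - k) * s ^+ k by rewrite -exprD subnK // ltnW.
by rewrite [LHS]mulrC -mulrA [u * _]mulrCA.
Qed.

End Degree.

(** After cancelling [a ^+ k], the term [f k] stands alone and all later terms are multiples of
    [a]. *)
Lemma lowest_coef_multiple (R : comNzRingType) (a : R) (k M : nat) (f : nat -> R) :
  (forall x, a * x = 0 -> x = 0) -> (k < M)%N -> (forall l, (l < k)%N -> f l = 0) ->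
  \sum_(l < M) a ^+ l * f l = 0 -> exists y, f k = a * y.
Proof.
move=> areg; elim: k M f => [|k IHk] [|M] f // kM f0 sum0.
  exists (- \sum_(l < M) a ^+ l * f l.+1); apply/eqP; rewrite mulrN -addr_eq0 -[X in _ == X]sum0.
  rewrite big_ord_recl mul1r mulr_sumr; apply/eqP; congr (_ + _).
  by apply: eq_bigr => l _; rewrite mulrA -exprS.
apply: (IHk M (fun l => f l.+1)) => // [l lk|]; first exact: f0.
apply: areg; rewrite -[RHS]sum0 big_ord_recl f0 // mulr0 add0r mulr_sumr.
by apply: eq_bigr => l _; rewrite mulrA -exprS.
Qed.

Section RegularDegree.
Variables (Fq : finFieldType) (F : fieldExtType {fraction {poly Fq}}).
Variable infty : dvaluation F.
Local Notation A := (regular_ring infty).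
Local Notation cr := (const_reg infty).

Lemma const_regB : zmod_morphism cr.
Proof. by move=> c d; apply: val_inj; rewrite /= rmorphB. Qed.
Lemma const_regM : monoid_morphism cr.
Proof. by split=> [|c d]; apply: val_inj; rewrite /= ?rmorph1 ?rmorphM. Qed.
HB.instance Definition _ := GRing.isZmodMorphism.Build Fq A cr const_regB.
HB.instance Definition _ := GRing.isMonoidMorphism.Build Fq A cr const_regM.

Lemma regular_mulI (a : A) : a != 0 -> forall x, a * x = 0 -> x = 0.
Proof.
move=> a0 x /(congr1 val)/eqP; rewrite /= mulf_eq0 => /orP[/eqP va|/eqP vx].
  by case/negP: a0; apply/eqP/val_inj.
exact: val_inj.
Qed.

(** A relation between products of powers of [a] with the [x i] becomes, at the lowest power of [a]
    having a nonzero coefficient, a relation modulo [a]. *)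
Lemma regular_dependent (a : A) : a != 0 -> exists N : nat, forall x : 'I_N.+1 -> A,
  exists2 c : 'I_N.+1 -> Fq, (exists i, c i != 0) & exists y, \sum_i cr (c i) * x i = a * y.
Proof.
move=> a0; have [N NP] := powers_dependent (val a); exists N => x.
have [M [c [[i0 [k0 ck0]] sum0]]] := NP (fun i => val (x i)).
pose C k i : Fq := if insub k is Some k' then c i (k' : 'I_M) else 0.
have CE (k : 'I_M) i : C k i = c i k by rewrite /C valK.
have exk : exists k : nat, (k < M)%N && [exists i, C k i != 0].
  by exists k0; rewrite ltn_ord; apply/existsP; exists i0; rewrite CE.
case: (ex_minnP exk) => k /andP[kM /existsP[i1 ck]] kmin.
exists (C k); first by exists i1.
apply: (@lowest_coef_multiple A a k M (fun l => \sum_i cr (C l i) * x i)) => //.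
- exact: regular_mulI.
- move=> l lk; apply: big1 => i _; suff -> : C l i = 0 by rewrite rmorph0 mul0r.
  apply/eqP/negPn/negP => h; have ex : [exists i, C l i != 0] by apply/existsP; exists i.
  by have := kmin l; rewrite (ltn_trans lk kM) ex => /(_ isT); rewrite leqNgt lk.
apply: val_inj; rewrite (rmorph_sum (val : {rmorphism A -> F})) -[RHS]sum0 [RHS]exchange_big.
apply: eq_bigr => l _; rewrite rmorphM rmorphXn rmorph_sum mulr_sumr.
by apply: eq_bigr => i _; rewrite rmorphM CE /= mulrCA.
Qed.

Definition independent_mod (a : A) (d : nat) (e : nat -> A) :=
  forall c : nat -> Fq, (exists y, \sum_(i < d) cr (c i) * e i = a * y) ->
  forall i, (i < d)%N -> c i = 0.

(** [has_rank] speaks only of elements that have a degree, so this must be known before the size of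
    [D a] can be read off. A maximal independent family modulo [a] is a basis. *)
Lemma has_degree_exists (a : A) : a != 0 -> exists d, has_degree a d.
Proof.
move=> a0; have [N NP] := regular_dependent a0.
pose P d := `[< exists e, independent_mod a d e >].
have P0 : exists d, P d.
  by exists 0%N; apply/asboolP; exists (fun=> 0) => c _ [].
have Pmax d : P d -> (d <= N)%N.
  move=> /asboolP[e ind]; rewrite leqNgt; apply/negP => Nd.
  have [c [i /eqP ci] [y yP]] := NP (fun i => e i).
  pose c' j := if insub j is Some j' then c (j' : 'I_N.+1) else 0.
  have c'E (j : 'I_N.+1) : c' j = c j by rewrite /c' valK.
  apply: ci; rewrite -c'E; apply: ind; last exact: leq_trans (ltn_ord i) Nd.
  exists y; rewrite -yP; under [RHS]eq_bigr do rewrite -c'E.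
  rewrite (big_ord_widen d (fun j => cr (c' j) * e j) Nd) [RHS]big_mkcond /=.
  by apply: eq_bigr => j _; case: ifP => // jN; rewrite /c' insubF // rmorph0 mul0r.
have [d /asboolP[e ind] dmax] := ex_maxnP P0 Pmax.
exists d, e => x.
have [c [y xE]] : exists c : {ffun 'I_d -> Fq}, exists y, x = \sum_(i < d) cr (c i) * e i + a * y.
  pose e' i := if (i < d)%N then e i else x.
  have sumE (c : nat -> Fq) : \sum_(i < d.+1) cr (c i) * e' i = \sum_(i < d) cr (c i) * e i + cr (c d) * x.
    rewrite big_ord_recr /= {2}/e' ltnn; congr (_ + _).
    by apply: eq_bigr => i _; rewrite /e' ltn_ord.
  have /existsNP[c /not_implyP[[y yP] cn0]] : ~ independent_mod a d.+1 e'.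
    move=> ind'; have /dmax : P d.+1 by apply/asboolP; exists e'.
    by rewrite ltnn.
  rewrite sumE in yP; have cd : c d != 0.
    apply/eqP => cd; apply: cn0 => i; rewrite ltnS leq_eqVlt => /predU1P[->//|id].
    by apply: ind => //; exists y; rewrite -yP cd rmorph0 mul0r addr0.
  have cdK : cr (c d)^-1 * cr (c d) = 1 by rewrite -rmorphM mulVf // rmorph1.
  exists [ffun i : 'I_d => - (c d)^-1 * c i], (cr (c d)^-1 * y).
  have -> : a * (cr (c d)^-1 * y) = cr (c d)^-1 * (\sum_(i < d) cr (c i) * e i) + x.
    by rewrite mulrA [a * _]mulrC -mulrA -yP mulrDr [_ * (_ * x)]mulrA cdK mul1r.
  have -> : \sum_(i < d) cr ([ffun i : 'I_d => - (c d)^-1 * c i] i) * e i =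
      - (cr (c d)^-1 * (\sum_(i < d) cr (c i) * e i)).
    rewrite mulr_sumr -sumrN; apply: eq_bigr => i _.
    by rewrite ffunE rmorphM rmorphN /= !mulNr mulrA.
  by rewrite addKr.
exists c; split; first by exists y.
move=> c2 [y2 xE2]; apply/ffunP => i; apply/eqP; rewrite -subr_eq0; apply/eqP.
pose D j := if insub j is Some j' then c (j' : 'I_d) - c2 j' else 0.
have DE (j : 'I_d) : D j = c j - c2 j by rewrite /D valK.
rewrite -DE; apply: ind (ltn_ord i); exists (y2 - y).
rewrite (eq_bigr (fun j => cr (c j) * e j - cr (c2 j) * e j)) => [|j _]; last first.
  by rewrite DE rmorphB mulrBl.
rewrite sumrB mulrBr; apply/eqP; rewrite subr_eq addrAC eq_sym subr_eq eq_sym.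
by apply/eqP; rewrite -xE xE2 addrC.
Qed.

End RegularDegree.

(** * Subextensions of the separable closure *)

Section Subextensions.
Variables (K : fieldType) (Ks : fieldType) (j : {rmorphism K -> Ks}).

(** An induction principle rather than an equation between subspaces: it is easily passed up the
    tower built by [adjoin_root], where the base field changes. *)
Definition ring_generates (L : fieldExtType K) (rs : seq L) := forall S : L -> Prop,
  (forall a : K, S a%:A) -> (forall x y, S x -> S y -> S (x + y)) ->
  (forall x y, S x -> S y -> S (x * y)) -> (forall r, r \in rs -> S r) -> forall y, S y.

(** A polynomial over L of least size vanishing at [x] is irreducible; L' is the quotient by it,
    regarded as an extension of K. *)
Lemma adjoin_root (L : fieldExtType K) (i : {rmorphism L -> Ks}) (x : Ks) (P : {poly K}) :
  (forall a : K, i a%:A = j a) -> P != 0 -> root (map_poly j P) x ->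
  exists (L' : fieldExtType K) (i' : {rmorphism L' -> Ks}) (k : {rmorphism L -> L'}) (x' : L'),
    [/\ forall a : K, i' a%:A = j a, forall y, i' (k y) = i y, i' x' = x &
      forall S : L' -> Prop, (forall x y, S x -> S y -> S (x + y)) ->
        (forall x y, S x -> S y -> S (x * y)) -> (forall y, S (k y)) -> S x' -> forall y, S y].
Proof.
move=> iK P0 Px.
have exq : exists n, `[< exists q : {poly L}, [/\ q != 0, root (map_poly i q) x & size q = n] >].
  exists (size P); apply/asboolP; exists (map_poly (in_alg L) P); split.
  - by rewrite map_poly_eq0.
  - rewrite -map_poly_comp; have -> : map_poly (i \o in_alg L) P = map_poly j P => //.
    by apply: eq_map_poly => a; apply: iK.
  by rewrite size_map_poly.
case: (ex_minnP exq) => n /asboolP[q [q0 qx qn]] qmin.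
have irr : irreducible_poly q.
  apply/(subfx_irreducibleP qx q0) => r rx r0; rewrite qn; apply: qmin.
  by apply/asboolP; exists r.
pose L1 : fieldExtType L := SubFieldExtType qx irr.
pose L' : fieldExtType K := baseFieldType L1.
pose i' : {rmorphism L' -> Ks} := @subfx_inj _ _ i x q.
pose k : {rmorphism L -> L'} := in_alg L1.
pose x' : L' := subfx_root i x q.
have i'k y : i' (k y) = i y by exact: (subfx_inj_base qx q0 y).
exists L', i', k, x'; split=> // [a||S SD SM Sk Sx y].
- by rewrite -iK -i'k; congr (i' _).
- exact: subfx_inj_root.
have [r yr] := subfxEroot qx q0 (y : L1).
have -> : y = (map_poly k r).[x'] by exact: yr.
elim/poly_ind: r {yr} => [|r c IHr]; first by rewrite rmorph0 horner0 -(rmorph0 k).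
rewrite rmorphD rmorphM /= map_polyX map_polyC hornerMXaddC; apply: SD.
  by apply: SM.
exact: Sk.
Qed.

Lemma adjoin_seq (xs : seq Ks) :
  (forall x, x \in xs -> exists2 P : {poly K}, P != 0 & root (map_poly j P) x) ->
  exists (L : fieldExtType K) (i : {rmorphism L -> Ks}) (rs : seq L),
    [/\ forall a : K, i a%:A = j a, map i rs = xs & ring_generates rs].
Proof.
elim: xs => [|x xs IHxs] alg.
  exists K^o, j, [::]; split=> // [a|S SK _ _ _ y]; first by rewrite [a%:A]mulr1.
  by rewrite -[y]mulr1; apply: SK.
have [|L [i [rs [iK irs gen]]]] := IHxs; first by move=> y ys; apply: alg; rewrite inE ys orbT.
have [P P0 Px] := alg x (mem_head _ _).
have [L' [i' [k [x' [i'K i'k i'x gen']]]]] := adjoin_root iK P0 Px.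
exists L', i', (x' :: map k rs); split=> //.
  by rewrite /= i'x -map_comp -irs; congr (_ :: _); apply: eq_map => y; rewrite /= i'k.
have klin a : k a%:A = a%:A by apply: (fmorph_inj i'); rewrite i'k iK i'K.
move=> S SK SD SM Srs; apply: gen' => // [|]; last by apply: Srs; rewrite mem_head.
apply: gen => [a|y z Sy Sz|y z Sy Sz|r rrs].
- by rewrite klin.
- by rewrite rmorphD; apply: SD.
- by rewrite rmorphM; apply: SM.
by apply: Srs; rewrite inE map_f ?orbT.
Qed.

Lemma ring_generatesP (L : fieldExtType K) (rs : seq L) :
  ring_generates rs -> <<1 & rs>>%VS = fullv.
Proof.
move=> gen; apply/vspaceP => y; rewrite memvf.
apply: (gen (fun y => y \in <<1 & rs>>%VS)) => [a|x z|x z|r rrs].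
- by rewrite memvZ ?mem1v.
- exact: rpredD.
- exact: rpredM.
exact: seqv_sub_adjoin.
Qed.

Hypothesis sepKs : separable_closure j.

Lemma separable_split (P : {poly Ks}) : separable_poly P ->
  exists xs, P %= \prod_(x <- xs) ('X - x%:P).
Proof.
have [n Pn] := ubnP (size P); elim: n => // n IHn in P Pn * => sepP.
have [P1|P1] := leqP (size P) 1.
  exists [::]; rewrite big_nil -size_poly_eq1; have := separable_poly_neq0 sepP.
  by rewrite -size_poly_gt0; case: (size P) P1 => [|[]].
have [x /factor_theorem[Q PE]] := sepKs.2 P sepP P1.
move: sepP; rewrite PE separable_mul => /and3P[sepQ _ _].
have Q0 := separable_poly_neq0 sepQ.
have [|xs Qxs] := IHn Q _ sepQ.
  by move: Pn; rewrite PE size_Mmonic ?monicXsubC // size_XsubC addn2.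
by exists (x :: xs); rewrite big_cons mulrC eqp_mull.
Qed.

Lemma galois_cover (Ps : seq {poly K}) : all (@separable_poly K) Ps ->
  exists (L : splittingFieldType K) (i : {rmorphism L -> Ks}) (rs : seq L),
  [/\ galois 1%AS {:L}, forall a : K, i a%:A = j a, ring_generates rs &
    map_poly j (\prod_(P <- Ps) P) %= \prod_(r <- rs) ('X - (i r)%:P)].
Proof.
move=> sepPs.
have [xs [Qxs xsP]] : exists xs, map_poly j (\prod_(P <- Ps) P) %= \prod_(x <- xs) ('X - x%:P) /\
    forall x, x \in xs -> exists2 P : {poly K}, separable_poly P & root (map_poly j P) x.
  elim: Ps sepPs => [|P Ps IHPs]; first by exists [::]; rewrite !big_nil rmorph1 eqpxx.
  move=> /= /andP[sepP /IHPs[ys [Qys ysP]]].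
  have [|zs Pzs] := separable_split (P := map_poly j P); first by rewrite separable_map.
  exists (zs ++ ys); split=> [|x].
    by rewrite big_cons rmorphM big_cat; apply: eqp_trans (eqp_mulr _ Pzs) (eqp_mull _ Qys).
  rewrite mem_cat => /orP[xzs|/ysP//]; exists P => //.
  by rewrite (eqp_root Pzs) root_prod_XsubC.
have [x /xsP[P sepP Px]|L0 [i0 [rs [iK irs gen]]]] := adjoin_seq (xs := xs).
  by exists P => //; apply: separable_poly_neq0.
have ax : splitting_field_axiom L0.
  exists (map_poly (in_alg L0) (\prod_(P <- Ps) P)).
    by apply/polyOverP => l; rewrite coef_map memvZ ?mem1v.
  exists rs; last exact: ring_generatesP.
  rewrite -(eqp_map i0) -map_poly_comp.
  have -> : map_poly (i0 \o in_alg L0) (\prod_(P <- Ps) P) = map_poly j (\prod_(P <- Ps) P).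
    by apply: eq_map_poly => a; apply: iK.
  have -> : map_poly i0 (\prod_(r <- rs) ('X - r%:P)) = \prod_(r <- rs) ('X - (i0 r)%:P).
    by rewrite rmorph_prod; apply: eq_bigr => r _; rewrite /= map_polyXsubC.
  by rewrite -(big_map i0 xpredT (fun x => 'X - x%:P)) irs.
pose L : splittingFieldType K := HB.pack (L0 : Type) L0 (FieldExt_isSplittingField.Build K L0 ax).
exists L, i0, rs; split=> //; last by rewrite -(big_map i0 xpredT (fun x => 'X - x%:P)) irs.
rewrite /galois sub1v normalFieldf andbT /=.
suff : separable 1%AS <<1 & (rs : seq L)>>%VS by rewrite (ring_generatesP (gen : @ring_generates L rs)).
apply: separable_Fadjoin_seq; apply/allP => r rrs; apply/separable_elementP.
have [P sepP Pr] := xsP (i0 r) ltac:(by rewrite -irs map_f).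
exists (map_poly (in_alg L) P); split.
- by apply/polyOverP => l; rewrite coef_map memvZ ?mem1v.
- rewrite -(fmorph_root i0) -map_poly_comp.
  have -> : map_poly (i0 \o in_alg L) P = map_poly j P by apply: eq_map_poly => a; apply: iK.
  exact: Pr.
by rewrite separable_map.
Qed.

Lemma embedding (L1 L : fieldExtType K) (i1 : {rmorphism L1 -> Ks}) (i : {rmorphism L -> Ks}) :
  (forall a : K, i1 a%:A = j a) -> (forall a : K, i a%:A = j a) ->
  (forall x, x \in vbasis {:L1} -> exists y, i y = i1 x) ->
  exists iota : {lrmorphism L1 -> L}, forall x, i (iota x) = i1 x.
Proof.
move=> i1K iK im.
have /choice[h hP] x : exists y, i y = i1 x.
  rewrite (coord_vbasis (memvf x)).
  have /choice[b bP] k : exists y, i y = i1 (vbasis {:L1})`_k.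
    have [kb|kb] := ltnP k (size (vbasis {:L1})); first by apply/im/mem_nth.
    by exists 0; rewrite nth_default // !rmorph0.
  exists (\sum_(k < \dim {:L1}) coord (vbasis {:L1}) k x *: b k).
  rewrite !rmorph_sum; apply: eq_bigr => k _.
  by rewrite -[_ *: b k]mulr_algl -[_ *: (vbasis _)`_k]mulr_algl !rmorphM /= iK i1K bP.
have hlin : linear h.
  move=> a x y; apply: (fmorph_inj i); rewrite hP -[a *: x]mulr_algl -[a *: h x]mulr_algl.
  by rewrite !rmorphD !rmorphM /= iK i1K !hP.
have hmul : monoid_morphism h.
  by split=> [|x y]; apply: (fmorph_inj i); rewrite ?rmorphM /= !hP ?rmorph1 ?rmorphM.
pose iota : {lrmorphism L1 -> L} := HB.pack h (GRing.isLinear.Build K L1 L _ h hlin)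
  (GRing.isMonoidMorphism.Build L1 L h hmul).
by exists iota => x; exact: hP.
Qed.

End Subextensions.

(** * The inertia group *)

(** Tychonoff's theorem through an ultrafilter on finite lists of conditions, containing every cone
    of lists that extend a given one. Once [dom x] is listed, the value at [x] ranges over the
    finite [r x], so the ultrafilter selects one value. *)
Lemma compactness (Z : Type) (X : eqType) (fam : seq Z -> X -> X) (r : X -> seq X) (dom : X -> Z) :
  (forall s x, List.In (dom x) s -> fam s x \in r x) ->
  exists f : X -> X, forall (t : seq X) (u : seq Z), exists s : seq Z,
    (forall z, List.In z u -> List.In z s) /\ forall x, x \in t -> f x = fam s x.
Proof.
move=> famr.
pose cone (u : seq Z) : set (seq Z) := fun s => forall z, List.In z u -> List.In z s.
pose F : set_system (seq Z) := fun A => exists u, (cone u `<=` A)%classic.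
have FF : ProperFilter F.
  split.
    by move=> [u /(_ u)]; apply.
  split; first by exists [::].
    move=> A B [u uA] [w wB]; exists (u ++ w) => s sP; split.
      by apply: uA => z zu; apply: sP; apply/List.in_app_iff; left.
    by apply: wB => z zw; apply: sP; apply/List.in_app_iff; right.
  by move=> A B AB [u uA]; exists u; apply: subset_trans AB.
have [U [UU FU]] := ultraFilterLemma FF.
have cover (x : X) (ys : seq X) (A : set (seq Z)) : U A -> (forall s, A s -> fam s x \in ys) ->
    exists y, U (fun s => fam s x = y).
  elim: ys A => [|y ys IHys] A UA Ays.
    by exfalso; apply: (filter_not_empty U); apply: filterS UA => s /Ays.
  have [Uy|Uy] := in_ultra_setVsetC (fun s => fam s x = y) UU; first by exists y.
  apply: (IHys (A `&` ~` (fun s => fam s x = y))%classic); first exact: filterI.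
  by move=> s [/Ays]; rewrite inE => /predU1P[].
have Ucone u : U (cone u) by apply: FU; exists u.
have /choice[f fP] x : exists y, U (fun s => fam s x = y).
  by apply: (cover x (r x) _ (Ucone [:: dom x])) => s sx; apply: famr; apply: sx; left.
exists f => t u.
have : U (fun s => cone u s /\ forall x, x \in t -> f x = fam s x).
  elim: t => [|x t IHt]; first by apply: filterS (Ucone u) => s us; split.
  apply: filterS (filterI IHt (fP x)) => s [[us st] sx]; split=> // y.
  by rewrite inE => /predU1P[->//|]; apply: st.
by move=> /filter_ex[s [us st]]; exists s.
Qed.

Section AutMorphism.
Variables (L : fieldType) (S : set L) (g : field_aut S).
HB.instance Definition _ := GRing.isZmodMorphism.Build L L (aut_fun g) (autB g).
HB.instance Definition _ := GRing.isMonoidMorphism.Build L L (aut_fun g) (autM g).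
End AutMorphism.

Lemma dval_divided (T L : fieldType) (vs : {rmorphism T -> L}) (w : dvaluation L) (e : nat) :
  (0 < e)%N -> (forall x, (e%:Z %| w (vs x))%Z) -> (exists2 x, x != 0 & w (vs x) = e%:Z) ->
  exists wT : dvaluation T, forall x, w (vs x) = wT x *+ e.
Proof.
move=> e_gt0 /= edvd [x1 x10 wx1].
have e_pos : 0 < e%:Z by rewrite ltz_nat.
have ez : e%:Z != 0 by rewrite gt_eqF.
have /choice[wT wTE] x : exists k : int, w (vs x) = k * e%:Z by exact/dvdzP.
have vs0 x : x != 0 -> vs x != 0 by rewrite fmorph_eq0.
have wT0 : wT 0 = 0.
  by apply: (mulIf ez); rewrite -wTE rmorph0 dval0 mul0r.
have wTM x y : x != 0 -> y != 0 -> wT (x * y) = wT x + wT y.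
  by move=> x0 y0; apply: (mulIf ez); rewrite mulrDl -!wTE rmorphM dvalM ?vs0.
have wTD x y : x != 0 -> y != 0 -> x + y != 0 -> Num.min (wT x) (wT y) <= wT (x + y).
  move=> x0 y0 xy0; rewrite -(ler_pM2r e_pos) minr_pMl ?(ltW e_pos) // -!wTE ?rmorphD.
  by apply: dvalD; rewrite ?vs0 // -rmorphD vs0.
have wT1 : exists2 x, x != 0 & wT x = 1.
  by exists x1 => //; apply: (mulIf ez); rewrite -wTE wx1 mul1r.
by exists (DValuation wT0 wTM wTD wT1) => x; rewrite wTE pmulrn mulrzz.
Qed.

Section Inertia.
Variables (K : fieldType) (v : dvaluation K) (p : nat).
Hypotheses (localK : is_local_field v) (pK : p \in [pchar K]).
Variables (Ks : fieldType) (j : {rmorphism K -> Ks}).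

Lemma base_unramified a : max_unramified v j (j a).
Proof.
exists K^o, (@DValuation K^o v (dval0 v) (@dvalM K v) (@dvalD K v) (dval_surj v)).
exists (j : {rmorphism K^o -> Ks}).
split=> [b|b|]; rewrite ?[b%:A]mulr1 //; by exists a.
Qed.

Section OneExtension.
Variables (L : splittingFieldType K) (w : dvaluation L) (e : nat).
Hypothesis galL : galois 1%AS {:L}.
Hypotheses (e_gt0 : (0 < e)%N) (wK : forall a : K, w a%:A = v a *+ e).
Variables (i : {rmorphism L -> Ks}) (iK : forall a : K, i a%:A = j a).

(** By [fixed_inertia] the values of [w] on the fixed field are multiples of the order of the
    inertia group, which is e; divided by e, [w] becomes there a normalized extension of [v] of
    index 1. *)
Lemma fixed_inertia_unramified y : y \in fixedField (inertia_set w) -> max_unramified v j (i y).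
Proof.
move=> Ty; have [pi pi0 wpi] := uniformizer w.
pose winv := dval_gal localK pK e_gt0 wK.
pose T : {subfield L} := [aspace of fixedField (inertia_group winv)].
have cardG := card_inertia_group localK pK galL e_gt0 wK pi0 wpi.
have [_ _ Tdiv] := fixed_inertia (pchar_ext pK L) (ext_resid localK pK e_gt0 wK)
  (ext_closed localK pK e_gt0 wK) pi0 wpi (fintype.subxx (inertia_group winv)).
rewrite cardG in Tdiv.
have vsA (a : K) : vsval (a%:A : subvs_of T) = a%:A by rewrite linearZ /= algid1.
have [varpi varpi0 wvarpi] := uniformizer v.
have [x|| wT wTE] := @dval_divided (subvs_of T) L vsval w e e_gt0.
- exact: Tdiv (subvsP x).
- exists varpi%:A; first by rewrite scaler_eq0 oner_eq0 orbF.
  by apply: etrans (congr1 (dval w) (vsA varpi)) _; rewrite wK wvarpi natz.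
exists (subvs_of T), wT, (i \o vsval : {rmorphism subvs_of T -> Ks}); split=> [a|a|].
- exact: etrans (congr1 i (vsA a)) (iK a).
- apply: (@mulIf _ e%:Z); first by rewrite eqz_nat -lt0n.
  have := etrans (esym (wTE a%:A)) (congr1 (dval w) (vsA a)).
  by rewrite wK !pmulrn !mulrzz.
by exists (Subvs (Ty : y \in T)).
Qed.

Lemma inertia_restrict (g : inertia v j) :
  exists2 s : gal_of {:L}, s \in inertia_set w & forall x, g (i x) = i (s x).
Proof.
have [|s sP] := @normal_embedding K L Ks ((aut_fun g : {rmorphism Ks -> Ks}) \o i) i.
  by move=> a /=; rewrite iK; apply/aut_fix/base_unramified.
exists s => //; pose winv := dval_gal localK pK e_gt0 wK.
rewrite -[inertia_set w]/(gval (inertia_group winv)) -gal_fixedField.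
rewrite gal_kHom ?fixedField_bound //; apply/kAHomP => y Ty.
apply: (fmorph_inj i); rewrite -sP /=; apply: aut_fix.
exact: fixed_inertia_unramified.
Qed.

End OneExtension.

(** A uniformizer of K is still one in the image of L1, and [s] fixes it; by [uniformizer_bound],
    [s] then moves the integers of that image by arbitrarily small amounts. *)
Lemma unramified_fixed (L1 : fieldExtType K) (w1 : dvaluation L1)
    (L : splittingFieldType K) (w : dvaluation L) (e : nat) (iota : {lrmorphism L1 -> L})
    (s : gal_of {:L}) :
  galois 1%AS {:L} -> (forall a : K, w1 a%:A = v a) -> (0 < e)%N -> (forall a : K, w a%:A = v a *+ e) ->
  s \in inertia_set w -> forall x, s (iota x) = iota x.
Proof.
move=> galL w1K e_gt0 wK Gs; pose winv := dval_gal localK pK e_gt0 wK.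
have iotaA (a : K) : iota a%:A = a%:A by rewrite linearZ /= rmorph1.
have vge_iota x : vge w1 0 x = vge w 0 (iota x).
  rewrite (vge_nrm (iota := (iota : {rmorphism L1 -> L})) localK pK e_gt0) => [|a].
    by rewrite (vge_nrm (iota := (idfun : {rmorphism L1 -> L1})) localK pK (ltn0Sn 0)).
  exact: etrans (congr1 (dval w) (iotaA a)) (wK a).
have [m m0 mP] := dval_scale vge_iota.
have [varpi varpi0 wv] := uniformizer v.
have me : m = e.
  have := etrans (esym (congr1 (dval w) (iotaA varpi))) (mP _).
  rewrite w1K wK wv !natz => /eqP; rewrite eqz_nat.
  by move=> /eqP.
pose E := image_field iota.
have Eint y : y \in E -> vge w 0 y -> s y = y.
  move=> Ey y0; apply/eqP; rewrite -subr_eq0; apply/eqP; apply: (@vge_all_eq0 _ w) => N.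
  apply: (@uniformizer_bound K p L w galL (pchar_ext pK L) winv (ext_resid localK pK e_gt0 wK) E varpi%:A).
  - by apply/image_fieldP; exists varpi%:A; rewrite iotaA.
  - by rewrite wK wv natz ltz_nat.
  - move=> z /image_fieldP[z' ->]; have [->|z0] := eqVneq z' 0; first by rewrite rmorph0 !vge0.
    rewrite !vgeE ?fmorph_eq0 // mP me wK wv natz pmulrn mulrzz => we.
    by rewrite ler_peMl // -gtz0_ge1 -(pmulr_lgt0 _ (_ : 0 < e%:Z)) ?ltz_nat // gtz0_ge1.
  - exact: Gs.
  - by rewrite gal_scalar subrr vge0.
  - exact: Ey.
  exact: y0.
move=> x; have [->|x0] := eqVneq x 0; first by rewrite !rmorph0.
have Ex y : iota y \in E by apply/image_fieldP; exists y.
have [xge|xlt] := lerP 0 (w (iota x)); first by rewrite Eint // vgeE ?fmorph_eq0.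
have := Eint (iota x)^-1; rewrite rpredV Ex fmorphV => /(_ isT).
rewrite vgeE ?invr_eq0 ?fmorph_eq0 // dvalV ?fmorph_eq0 // oppr_ge0 ltW //.
by move=> /(_ isT)/invr_inj.
Qed.

End Inertia.

(** * Drinfeld polynomials *)

Section AdditiveValuation.
Variables (M : fieldType) (w : dvaluation M) (q n : nat) (c : nat -> M).
Hypothesis q_gt1 : (1 < q)%N.
Hypothesis c_int : forall i, vge w 0 (c i).
Local Notation f := (fun x => \sum_(i < n.+1) c i * x ^+ (q ^ i)).

(** The linear term dominates: its coefficient is a unit, and higher powers of an element of
    positive value are smaller. *)
Lemma additive_dval_pos x : c 0 != 0 -> w (c 0) = 0 -> x != 0 -> 1 <= w x ->
  f x != 0 /\ w (f x) = w x.
Proof.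
move=> c00 wc0 x0 wx; rewrite /= big_ord_recl /= expn0 expr1.
have wcx : w (c 0 * x) = w x by rewrite dvalM // wc0 add0r.
rewrite -wcx; apply: vge_addl; first by rewrite mulf_neq0.
rewrite wcx; apply: vge_sum => i _; rewrite vgeM0 //=.
rewrite vgeE ?expf_neq0 // dvalX // pmulrn mulrzz.
have : (1 < q ^ bump 0 i)%N by rewrite -{1}(expn0 q) ltn_exp2l.
move: (q ^ bump 0 i)%N (w x) wx => Q z; clear; nia.
Qed.

(** The leading term dominates: its coefficient is a unit, and a negative value is most negative
    after the largest exponent. *)
Lemma additive_dval_neg x : c n != 0 -> w (c n) = 0 -> x != 0 -> w x < 0 ->
  f x != 0 /\ w (f x) = w x *+ (q ^ n).
Proof.
move=> cn0 wcn x0 wx; rewrite /= big_ord_recr /= addrC.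
have wcx : w (c n * x ^+ (q ^ n)) = w x *+ (q ^ n).
  by rewrite dvalM ?expf_neq0 // wcn add0r dvalX.
rewrite -wcx; apply: vge_addl; first by rewrite mulf_neq0 // expf_neq0.
rewrite wcx; apply: vge_sum => i _; rewrite vgeM0 //=.
rewrite vgeE ?expf_neq0 // dvalX // !pmulrn !mulrzz.
have : (q ^ i < q ^ n)%N by rewrite ltn_exp2l.
move: (q ^ i)%N (q ^ n)%N (w x) wx => Q1 Q2 z; clear; nia.
Qed.

End AdditiveValuation.

Section DrinfeldModule.
Variables (Fq : finFieldType) (F : fieldExtType {fraction {poly Fq}}).
Variables (infty : dvaluation F) (K : fieldType) (v : dvaluation K).
Variables (iotaK : {rmorphism Fq -> K}) (D : drinfeld_module infty v iotaK).
Local Notation A := (regular_ring infty).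
Local Notation q := #|Fq|.

Definition drinfeld_coef (a : A) (i : nat) : K := val (D a)`_i.

Definition drinfeld_act (L : fieldType) (j : {rmorphism K -> L}) (a : A) (x : L) : L :=
  points_scale a (x : points D j).

Lemma drinfeld_actE (L : fieldType) (j : {rmorphism K -> L}) a n x : (size (D a) <= n)%N ->
  drinfeld_act j a x = \sum_(i < n) j (drinfeld_coef a i) * x ^+ (q ^ i).
Proof.
move=> an; rewrite /drinfeld_act /points_scale (@twisted_eval_wide Fq L n); last first.
  by rewrite (leq_trans (size_poly _ _)).
by apply: eq_bigr => i _; rewrite coef_map_id0 //= !rmorph0.
Qed.

Lemma drinfeld_actD (L : fieldType) (j : {rmorphism K -> L}) a :
  {morph drinfeld_act j a : x y / x + y}.
Proof. exact: (twisted_evalDr (j \o iotaK)). Qed.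

Lemma drinfeld_actB (L : fieldType) (j : {rmorphism K -> L}) a :
  {morph drinfeld_act j a : x y / x - y}.
Proof.
by move=> x y; apply: (addIr (drinfeld_act j a y)); rewrite -drinfeld_actD !subrK.
Qed.

Lemma drinfeld_act_rmorph (L M : fieldType) (j : {rmorphism K -> L}) (k : {rmorphism K -> M})
    (h : {rmorphism L -> M}) a x :
  (forall b, h (j b) = k b) -> h (drinfeld_act j a x) = drinfeld_act k a (h x).
Proof.
move=> hj; rewrite !(drinfeld_actE _ _ (leqnn _)) rmorph_sum; apply: eq_bigr => i _.
by rewrite rmorphM rmorphXn hj.
Qed.

Lemma nonresidual_neq0 a : a \notin residual_char D -> a != 0.
Proof.
apply: contraNneq => ->; rewrite unfold_in /Defs.characteristic.
have D0 : D 0 = 0 by apply: (addrI (D 0)); rewrite -dmodD !addr0.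
by rewrite D0 coef0 unfold_in /= eqxx.
Qed.

(** The constant coefficient is a unit because [a] avoids the residual characteristic, the leading
    one because D and its reduction have the same rank, so that reduction does not shorten [D a]. *)
Lemma drinfeld_coefs a : a \notin residual_char D -> exists n,
  [/\ size (D a) = n.+1, drinfeld_coef a 0 != 0 /\ v (drinfeld_coef a 0) = 0 &
    drinfeld_coef a n != 0 /\ v (drinfeld_coef a n) = 0].
Proof.
move=> aP.
have unit_coef i : (D a)`_i \notin maxideal v ->
    drinfeld_coef a i != 0 /\ v (drinfeld_coef a i) = 0.
  move=> ci; apply: vge_unit; first by rewrite -valintE (valP (D a)`_i).
  by move: ci; rewrite /vge -gtz0_ge1.
have a0 := nonresidual_neq0 aP.
have [d ad] := has_degree_exists a0.
have [r r0 [rval rres]] := dmod_rank D.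
exists (r * d)%N; have sz : size (D a) = (r * d).+1.
  by rewrite -(rval a d a0 ad) size_map_inj_poly //; exact: val_inj.
split=> //; first exact: unit_coef.
apply: unit_coef.
have := rres a d a0 ad; set P := map_poly _ _ => szP.
have : lead_coef P != 0 by rewrite lead_coef_eq0 -size_poly_gt0 szP.
rewrite lead_coefE szP /= coef_map_id0 ?rmorph0 //; apply: contra => cm.
by rewrite -[X in _ == X](rmorph0 (\pi_(residue_ring v))) -Quotient.idealrBE subr0.
Qed.

Lemma card_Fq_gt1 : (1 < q)%N.
Proof. exact: finNzRing_gt1. Qed.

Section Valued.
Variables (L : fieldType) (w : dvaluation L) (j : {rmorphism K -> L}) (e : nat).
Hypothesis wK : forall a, w (j a) = v a *+ e.
Variable a : A.
Hypothesis aP : a \notin residual_char D.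

Lemma vge_coef i : vge w 0 (j (drinfeld_coef a i)).
Proof.
have := valP (D a)`_i; rewrite valintE -/(drinfeld_coef a i).
have [->|c0] := eqVneq (drinfeld_coef a i) 0; first by rewrite rmorph0 !vge0.
by rewrite !vgeE ?fmorph_eq0 // wK; exact: mulrn_wge0.
Qed.

Lemma act_vge0 x : vge w 0 x -> vge w 0 (drinfeld_act j a x).
Proof.
move=> x0; rewrite (drinfeld_actE _ _ (leqnn _)).
by apply: vge_sum => i _; rewrite vgeM0 ?vge_coef // vgeX0.
Qed.

Lemma act_dval_pos x : x != 0 -> 1 <= w x ->
  drinfeld_act j a x != 0 /\ w (drinfeld_act j a x) = w x.
Proof.
have [n [sz [c0 vc0] _]] := drinfeld_coefs aP; rewrite (drinfeld_actE _ _ (leqnn _)) sz.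
move=> x0 wx; apply: (@additive_dval_pos _ w q n (fun i => j (drinfeld_coef a i)) card_Fq_gt1) => //.
- exact: vge_coef.
- by rewrite fmorph_eq0.
by rewrite wK vc0 mul0rn.
Qed.

Lemma act_dval_neg n x : size (D a) = n.+1 -> x != 0 -> w x < 0 ->
  drinfeld_act j a x != 0 /\ w (drinfeld_act j a x) = w x *+ (q ^ n).
Proof.
have [m [sz _ [cm vcm]]] := drinfeld_coefs aP; rewrite sz => -[<-].
rewrite (drinfeld_actE _ _ (leqnn _)) sz => x0 wx.
apply: (@additive_dval_neg _ w q m (fun i => j (drinfeld_coef a i)) card_Fq_gt1) => //.
- exact: vge_coef.
- by rewrite fmorph_eq0.
by rewrite wK vcm mul0rn.
Qed.

Lemma act_vge0_inv x : vge w 0 (drinfeld_act j a x) -> vge w 0 x.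
Proof.
have [->|x0] := eqVneq x 0; first by rewrite vge0.
rewrite (@vgeE _ w 0 x x0); case: lerP => // wx.
have [n [sz _ _]] := drinfeld_coefs aP; have [y0 wy] := act_dval_neg sz x0 wx.
by rewrite vgeE // wy pmulrn_lge0 ?expn_gt0 ?(ltnW card_Fq_gt1) // leNgt wx.
Qed.

Lemma torsion_vge0 z : drinfeld_act j a z = 0 -> vge w 0 z.
Proof. by move=> az; apply: act_vge0_inv; rewrite az vge0. Qed.

Lemma torsion_eq0 z : drinfeld_act j a z = 0 -> vge w 1 z -> z = 0.
Proof.
move=> az; have [->//|z0] := eqVneq z 0; rewrite vgeE // => wz.
by have [] := act_dval_pos z0 wz; rewrite az eqxx.
Qed.

End Valued.

Section RootPolynomial.
Variable p : nat.
Hypothesis charFq : p \in [pchar Fq].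

Definition root_poly (a : A) (lambda : K) : {poly K} :=
  \sum_(i < size (D a)) drinfeld_coef a i *: 'X^(q ^ i) - lambda%:P.

Lemma root_polyE (L : fieldType) (j : {rmorphism K -> L}) a lambda x :
  (map_poly j (root_poly a lambda)).[x] = drinfeld_act j a x - j lambda.
Proof.
rewrite rmorphB /= map_polyC hornerD hornerN hornerC (drinfeld_actE _ _ (leqnn _)).
rewrite rmorph_sum horner_sum; congr (_ - _); apply: eq_bigr => i _.
by rewrite /= map_polyZ map_polyXn !hornerE.
Qed.

Lemma size_root_poly a lambda n : a \notin residual_char D -> size (D a) = n.+1 ->
  size (root_poly a lambda) = (q ^ n).+1.
Proof.
move=> aP sz; have [m [szm _ [cm _]]] := drinfeld_coefs aP.
move: szm cm; rewrite sz => -[<-] cn; rewrite /root_poly sz big_ord_recr /=.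
have q0 : (0 < q)%N := ltnW card_Fq_gt1.
have szX : size (drinfeld_coef a n *: 'X^(q ^ n)) = (q ^ n).+1 by rewrite size_scale ?size_polyXn.
rewrite [X in X - _]addrC -addrA size_polyDl szX // ltnS.
apply: leq_trans (size_polyD _ _) _; rewrite geq_max size_polyN.
rewrite (leq_trans (size_polyC_leq1 _)) ?expn_gt0 ?q0 // andbT.
apply: leq_trans (size_sum _ _ _) _; apply/bigmax_leqP => i _.
by rewrite (leq_trans (size_scale_leq _ _)) // size_polyXn ltn_exp2l ?card_Fq_gt1.
Qed.

(** All exponents beyond the first are divisible by q, so the derivative is the nonzero constant
    [drinfeld_coef a 0]. *)
Lemma separable_root_poly a lambda : a \notin residual_char D ->
  separable_poly (root_poly a lambda).
Proof.
move=> aP; have [n [sz [c0 _] _]] := drinfeld_coefs aP.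
have pK : p \in [pchar K] by exact: (rmorph_pchar iotaK).
have q0 : q%:R = 0 :> K.
  have [k qE] : exists k, q = (p ^ k)%N by eexists; exact: (card_pprimeChar charFq).
  have := card_Fq_gt1; rewrite qE; case: k {qE} => [|k]; first by rewrite expn0.
  move=> _.
  by rewrite expnS natrM (pcharf0 pK) mul0r.
have derivE : (root_poly a lambda)^`() = drinfeld_coef a 0 *: 1.
  rewrite derivB derivC subr0 sz big_ord_recl derivD expn0 derivZ derivX.
  rewrite raddf_sum big1 ?addr0 // => i _.
  rewrite [LHS]derivZ derivXn -scaler_nat expnS natrM.
  by rewrite q0 mul0r scale0r scaler0.
by rewrite separable_poly.unlock derivE coprimepZr ?coprimep1.
Qed.

End RootPolynomial.
End DrinfeldModule.

(** * Kummer extensions of a local field *)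

Lemma vge_pow_sub1 (M : fieldType) (w : dvaluation M) C x n :
  vge w 0 x -> vge w C (x - 1) -> vge w C (x ^+ n - 1).
Proof.
move=> x0 xC; rewrite subrX1 mulrC; apply: vgeM0 => //.
by apply: vge_sum => i _; apply: vgeX0.
Qed.

Section LocalKummer.
Variables (p : nat) (Fq : finFieldType) (F : fieldExtType {fraction {poly Fq}}).
Variables (infty : dvaluation F) (K : fieldType) (v : dvaluation K).
Variables (iotaK : {rmorphism Fq -> K}) (D : drinfeld_module infty v iotaK).
Hypotheses (charFq : p \in [pchar Fq]) (localK : is_local_field v).
Local Notation A := (regular_ring infty).
Local Notation q := #|Fq|.
Let pK : p \in [pchar K] := rmorph_pchar iotaK charFq.

Variables (L : splittingFieldType K) (w : dvaluation L) (e : nat).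
Hypothesis galL : galois 1%AS {:L}.
Hypotheses (e_gt0 : (0 < e)%N) (wK : forall a : K, w a%:A = v a *+ e).
Let wA : forall b, w (in_alg L b) = v b *+ e := wK.
Local Notation act := (drinfeld_act D (in_alg L)).
Local Notation winv := (dval_gal localK pK e_gt0 wK).
Local Notation G0 := (inertia_group winv).

Variable a : A.
Hypothesis aP : a \notin residual_char D.

Lemma act_gal (s : gal_of {:L}) x : act a (s x) = s (act a x).
Proof. by rewrite (drinfeld_act_rmorph D (k := in_alg L)) // => b; rewrite /= gal_scalar. Qed.

Lemma torsion_fixed (s : gal_of {:L}) z : s \in inertia_set w -> act a z = 0 -> s z = z.
Proof.
move=> /inertiaP Gs az; apply/eqP; rewrite -subr_eq0; apply/eqP.
apply: (torsion_eq0 wA aP); first by rewrite drinfeld_actB act_gal az rmorph0 subrr.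
exact/Gs/(torsion_vge0 wA aP).
Qed.

Variables (lambda : K) (mu : L).
Hypothesis mu_root : act a mu = lambda%:A.

Lemma root_sub_torsion (s : gal_of {:L}) : act a (s mu - mu) = 0.
Proof. by rewrite drinfeld_actB act_gal mu_root gal_scalar subrr. Qed.

(** Height 0 makes [mu] integral; then [s mu - mu] is a torsion point of positive value, hence 0. *)
Lemma root_fixed_unramified (s : gal_of {:L}) : height v lambda = 0%N ->
  s \in inertia_set w -> s mu = mu.
Proof.
rewrite /height => h0 /inertiaP Gs; apply/eqP; rewrite -subr_eq0; apply/eqP.
apply: (torsion_eq0 wA aP); first exact: root_sub_torsion.
apply/Gs/(act_vge0_inv wA aP); rewrite mu_root.
have [l0|l0] := eqVneq lambda 0; first by rewrite l0 scale0r vge0.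
move: h0; rewrite (negPf l0) vgeE ?scaler_eq0 ?oner_eq0 ?orbF // wK => h0.
by apply: mulrn_wge0; move: h0; clear; lia.
Qed.

Variables (n h : nat).
Hypotheses (size_Da : size (D a) = n.+1) (h_gt0 : (0 < h)%N) (hE : height v lambda = h).
Local Notation Q := (q ^ n)%N.

Lemma height_lambda : lambda != 0 /\ v lambda = - h%:Z.
Proof.
move: hE; rewrite /height; case: eqVneq => [_|_]; first by move: h_gt0; case: h.
by move=> hE'; split=> //; move: hE' h_gt0; clear; lia.
Qed.

Lemma root_dval : exists H : nat, [/\ (0 < H)%N, mu != 0, w mu = - H%:Z & (Q * H = e * h)%N].
Proof.
have [l0 vl] := height_lambda.
have wl : w lambda%:A = - (e * h)%N%:Z.
  by rewrite wK vl pmulrn mulrzz PoszM; move: h%:Z e%:Z; clear; lia.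
have lA0 : lambda%:A != 0 :> L by rewrite scaler_eq0 oner_eq0 orbF.
have eh : (0 < e * h)%N by rewrite muln_gt0 e_gt0.
have mu0 : mu != 0.
  apply: contraTneq isT => mu0; have := act_vge0 D wA a (vge0 w 0).
  by rewrite -{1}mu0 mu_root vgeE // wl; move: (e * h)%N eh; clear; lia.
have wmu : w mu < 0.
  rewrite ltNge; apply/negP => mu_ge0; have := act_vge0 D wA a (_ : vge w 0 mu).
  rewrite vgeE // mu_root vgeE // wl => /(_ mu_ge0).
  by move: (e * h)%N eh; clear; lia.
have [_] := act_dval_neg wA aP size_Da mu0 wmu.
rewrite mu_root wl => wE; exists `|w mu|%N; split=> //.
- by move: wmu; clear; lia.
- by move: wmu; clear; lia.
by move: wE wmu; rewrite pmulrn mulrzz; move: (w mu) (e * h)%N Q; clear; nia.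
Qed.

Variables (Ks : fieldType) (j : {rmorphism K -> Ks}) (i : {rmorphism L -> Ks}).
Hypothesis iK : forall b : K, i b%:A = j b.
Variable rs : seq L.
Hypothesis gen : ring_generates rs.
Hypothesis rsE : map_poly j (root_poly D a lambda) %= \prod_(r <- rs) ('X - (i r)%:P).

Lemma i_act x : i (act a x) = drinfeld_act D j a (i x).
Proof. exact: drinfeld_act_rmorph. Qed.

Lemma root_root_poly y : root (map_poly j (root_poly D a lambda)) y = (drinfeld_act D j a y == j lambda).
Proof. by rewrite rootE root_polyE subr_eq0. Qed.

Lemma cover_root y : drinfeld_act D j a y = j lambda -> exists2 r, r \in rs & i r = y.
Proof.
move=> /eqP; rewrite -root_root_poly (eqp_root rsE) -(big_map i predT (fun x => 'X - x%:P)) root_prod_XsubC.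
by case/mapP => r rrs ->; exists r.
Qed.

Lemma cover_act r : r \in rs -> act a r = lambda%:A.
Proof.
move=> rrs; apply: (fmorph_inj i); rewrite i_act iK; apply/eqP.
by rewrite -root_root_poly (eqp_root rsE) -(big_map i predT (fun x => 'X - x%:P)) root_prod_XsubC map_f.
Qed.

Lemma root_fixed_eq1 (s : gal_of {:L}) : s \in inertia_set w -> s mu = mu -> s = 1%g.
Proof.
move=> Gs smu; apply: gal_eqx => x; rewrite gal_id.
apply: (gen (S := fun x => s x = x)) => [b|y z sy sz|y z sy sz|r rrs].
- exact: gal_scalar.
- by rewrite rmorphD /= sy sz.
- by rewrite rmorphM /= sy sz.
have : s (r - mu) = r - mu.
  by apply: torsion_fixed => //; rewrite drinfeld_actB cover_act // mu_root subrr.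
by rewrite rmorphB /= smu => /addIr.
Qed.

Local Notation orbit := (map (fun s : gal_of {:L} => i (s mu)) (enum (inertia_set w))).

Lemma gal_orbit_uniq : uniq orbit.
Proof.
rewrite map_inj_in_uniq ?enum_uniq // => s t; rewrite !mem_enum => Gs Gt /(fmorph_inj i) st.
have st1 : (s * t^-1)%g = 1%g.
  apply: root_fixed_eq1; first by apply: (@groupM _ G0); rewrite ?groupV.
  by rewrite galMx st -galMx mulgV gal_id.
by rewrite -[s](mulgKV t) st1 mul1g.
Qed.

Lemma orbit_roots : all (root (map_poly j (root_poly D a lambda))) orbit.
Proof.
apply/allP => _ /mapP[s _ ->]; rewrite root_root_poly -i_act act_gal mu_root gal_scalar iK.
exact: eqxx.
Qed.

Lemma root_poly_neq0 : map_poly j (root_poly D a lambda) != 0.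
Proof. by rewrite map_poly_eq0 -size_poly_gt0 (size_root_poly _ aP size_Da). Qed.

Lemma ramification_le : (e <= Q)%N.
Proof.
have [pi pi0 wpi] := uniformizer w.
have := max_poly_roots root_poly_neq0 orbit_roots gal_orbit_uniq.
rewrite size_map_poly (size_root_poly _ aP size_Da) size_map -cardE ltnS.
by rewrite (card_inertia_group localK pK galL e_gt0 wK pi0 wpi).
Qed.

(* The unit [mu * pi ^+ H] moves by [z * s pi ^+ H + mu * (s pi ^+ H - pi ^+ H)] with
   [z = s mu - mu] a unit, hence by exactly H unless [w (s pi - pi) <= H + 1]. *)
Lemma upper_ram_trivial (s : gal_of {:L}) : upper_ram w h.+1%:R s -> s mu = mu.
Proof.
have [pi pi0 wpi] := uniformizer w; have [H [H0 mu0 wmu QH]] := root_dval.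
move=> [t [t0 ht st]]; have resid := ext_resid localK pK e_gt0 wK.
have [Gs tpi] := lower_ramP galL (pchar_ext pK L) winv resid pi0 wpi s t0 st.
have [//|smu] := eqVneq (s mu) mu; exfalso.
have spi : s pi != pi.
  by apply: contraNneq smu => /(inertia_gal_eq1 galL (pchar_ext pK L) resid wpi Gs)->; rewrite gal_id.
have {tpi} := tpi spi; set C := w (s pi - pi) => tC.
have CH : C <= H%:Z + 1.
  rewrite leNgt; apply/negP => HC; pose z := s mu - mu.
  have z0 : z != 0 by rewrite subr_eq0.
  have wz : w z = 0.
    have z_int : vge w 0 z by exact/(torsion_vge0 wA aP)/root_sub_torsion.
    have [] // := @vge_unit _ w z z_int.
    by apply: contra z0 => z1; apply/eqP/(torsion_eq0 wA aP) => //; apply: root_sub_torsion.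
  have spi0 : s pi != 0 by rewrite fmorph_eq0.
  have wspi : w (s pi) = 1 by rewrite winv.
  have u0 : vge w 0 (mu * pi ^+ H).
    by rewrite vgeE ?mulf_neq0 ?expf_neq0 // dvalM ?expf_neq0 // wmu dvalX // wpi natz addNr.
  have := inertia_gal_bound galL (pchar_ext pK L) resid wpi Gs (vge_val w (s pi - pi)) u0.
  have -> : s (mu * pi ^+ H) - mu * pi ^+ H = z * s pi ^+ H + mu * (s pi ^+ H - pi ^+ H).
    by rewrite rmorphM rmorphXn /z; ring.
  rewrite -/C => su.
  (* The values add up to -H + (H + 2) + (H - 1) = H + 1, one more than the value of
     [z * s pi ^+ H]. *)
  have diff : vge w (H%:Z + 1) (mu * (s pi ^+ H - pi ^+ H)).
    have -> : H%:Z + 1 = w mu + (H%:Z + 2 + H.-1%:Z).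
      by rewrite wmu; move: H0; clear; lia.
    apply: vgeM (vge_val _ _) _; rewrite subrXX; apply: vgeM.
      by apply: vgeW (vge_val _ _); rewrite -/C; move: HC; clear; lia.
    apply: vge_sum => k _; apply: vgeW (vgeM (vge_val _ _) (vge_val _ _)).
    rewrite !dvalX // wspi wpi !natz -PoszD lez_nat.
    by have := ltn_ord k; clear; lia.
  have zs : z * s pi ^+ H != 0 by rewrite mulf_neq0 ?expf_neq0.
  have wzs : w (z * s pi ^+ H) = H by rewrite dvalM ?expf_neq0 // wz dvalX // wspi natz add0r.
  rewrite -wzs in diff; have [sn0 ws] := vge_addl zs diff.
  move: su; rewrite vgeE // ws wzs; move: HC; clear; lia.
have Hh : (H <= h)%N.
  rewrite -(leq_pmul2l (_ : 0 < Q)%N) ?expn_gt0 ?(ltnW (card_Fq_gt1 Fq)) // QH.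
  by rewrite leq_mul2r ramification_le orbT.
(* In all [t + 1 <= C <= H + 1 <= h + 1], whereas [herbrand w t = h + 1] is at most [t]. *)
have := herbrand_le localK pK galL e_gt0 wK pi0 wpi t0.
rewrite ht leNgt => /negP; apply.
rewrite -(ltrD2r 1); apply: (le_lt_trans tC).
apply: (@le_lt_trans _ _ (h.+1%:Z%:~R)); first by rewrite ler_int; move: CH Hh; clear; lia.
by rewrite -pmulrn ltrDl.
Qed.

Hypothesis coprime_h : coprime h p.

Lemma ramification_eq : e = Q /\ w mu = - h%:Z.
Proof.
have [H [H0 mu0 wmu QH]] := root_dval.
have coQ : coprime Q h.
  have [k qE] : exists k, q = (p ^ k)%N by eexists; exact: (card_pprimeChar charFq).
  by rewrite coprime_sym qE !coprimeXr.
have Qe : (Q %| e)%N by rewrite -(Gauss_dvdl _ coQ) -QH dvdn_mulr.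
have eQ : e = Q by apply/eqP; rewrite eqn_leq ramification_le dvdn_leq.
split=> //; rewrite wmu; congr (- _%:Z).
by apply/eqP; rewrite -(eqn_pmul2l (_ : 0 < Q)%N) ?QH -?eQ.
Qed.

Lemma root_uniformizer : exists (al : nat) (c : K),
  [/\ c != 0, mu != 0 & w (mu ^+ al * c%:A) = 1].
Proof.
have [eQ wmu] := ramification_eq; have [_ [_ mu0 _ _]] := root_dval.
have [varpi varpi0 wv] := uniformizer v.
have coQ : coprime e h.
  have [k qE] : exists k, q = (p ^ k)%N by eexists; exact: (card_pprimeChar charFq).
  by rewrite coprime_sym eQ qE !coprimeXr.
(* Bezout gives [be * e - al * h = 1], which is the value of [mu ^+ al] times the [be]-th power of
   [varpi]. *)
have [be al bez _] := egcdnP h e_gt0; rewrite (eqP coQ) in bez.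
exists al, (varpi ^+ be); split; rewrite ?expf_neq0 //.
rewrite dvalM ?expf_neq0 ?scaler_eq0 ?oner_eq0 ?orbF ?expf_neq0 //.
rewrite dvalX // wmu wK dvalX // wv natz !pmulrn !mulrzz.
by move: bez; clear; nia.
Qed.

(** On the uniformizer [mu ^+ al * c%:A], an inertia element [t] acts by the factor
    [(t mu / mu) ^+ al]. Here [t mu / mu - 1] has value at least h, as [t mu - mu] is integral and
    [mu] has value -h. So G_h is all of G0, and Herbrand's function takes h to h. *)
Lemma inertia_upper_ram (s : gal_of {:L}) : s \in inertia_set w -> upper_ram w h%:R s.
Proof.
have [al [c [c0 mu0]]] := root_uniformizer; set pi := _ * _ => wpi Gs.
have [eQ wmu] := ramification_eq.
have pi0 : pi != 0 by rewrite mulf_neq0 ?expf_neq0 // scaler_eq0 oner_eq0 orbF.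
have resid := ext_resid localK pK e_gt0 wK.
have low t : t \in G0 -> t \in lower_ram w h%:R.
  move=> Gt; apply/(lower_ramP galL (pchar_ext pK L) winv resid pi0 wpi); rewrite ?ler0n //.
  split=> // tpi; rewrite natr1 -[h.+1%:R]/(h.+1%:Z%:~R) ler_int -vgeE ?subr_eq0 //.
  pose z := t mu - mu.
  have tmuE : t mu / mu - 1 = z / mu by rewrite mulrBl divff.
  have wzmu : vge w h%:Z (z / mu).
    have -> : h%:Z = 0 + h%:Z by rewrite add0r.
    apply: vgeM; first exact/(torsion_vge0 wA aP)/root_sub_torsion.
    by rewrite vgeE ?invr_eq0 // dvalV // wmu opprK.
  have -> : t pi - pi = pi * ((t mu / mu) ^+ al - 1).
    rewrite /pi rmorphM rmorphXn /= gal_scalar expr_div_n.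
    by field; rewrite expf_neq0.
  have -> : h.+1%:Z = w pi + h%:Z by rewrite wpi; clear; lia.
  apply: vgeM (vge_val _ _) _; apply: vge_pow_sub1; last by rewrite tmuE.
  by rewrite vgeE ?mulf_neq0 ?invr_eq0 ?fmorph_eq0 // dvalM ?invr_eq0 ?fmorph_eq0 // dvalV // winv subrr.
exists h%:R; split; rewrite ?ler0n //; last exact: low.
apply: (addIr 1); rewrite (herbrandE galL (pchar_ext pK L) winv resid pi0 wpi) ?ler0n //.
have G00 : #|G0|%:R != 0 :> rat by rewrite pnatr_eq0 -lt0n cardG_gt0.
apply: (mulIf G00); rewrite /phi divfK // mulr_natr -sumr_const; apply: eq_bigr => t Gt.
apply/eqP; rewrite -(lower_ram_depth galL (pchar_ext pK L) resid pi0 wpi (ler0n _ h) Gt).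
exact: low.
Qed.

(** The orbit of [mu] has e = Q elements, as many as the degree of the polynomial; a root outside it
    would be one too many. *)
Lemma upper_ram_roots y : drinfeld_act D j a y = j lambda ->
  exists2 s : gal_of {:L}, upper_ram w h%:R s & i (s mu) = y.
Proof.
move=> ay; have [eQ _] := ramification_eq.
have [pi pi0 wpi] := uniformizer w.
have [/mapP[s]|yN] := boolP (y \in orbit).
  by rewrite mem_enum => Gs ->; exists s => //; apply: inertia_upper_ram.
have := @max_poly_roots _ _ (y :: orbit) root_poly_neq0.
rewrite /= yN gal_orbit_uniq orbit_roots root_root_poly ay eqxx => /(_ isT isT).
rewrite size_map_poly (size_root_poly _ aP size_Da) size_map -cardE.
by rewrite (card_inertia_group localK pK galL e_gt0 wK pi0 wpi) eQ ltnn.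
Qed.

End LocalKummer.

(** * The Kummer pairing *)

Section InverseModule.
Variables (F : fieldType) (infty : dvaluation F).
Local Notation A := (regular_ring infty).
Variable n : {pred A}.

(** The product a x brought back into A. For [a] in the ideal it is regular, so the default 0 of
    [insubd] is not reached. *)
Definition inv_mul (a : A) (x : inv_module n) : A := insubd (0 : A) (val a * (val x : F)).

Lemma inv_mulE a x : a \in n -> val (inv_mul a x) = val a * (val x : F).
Proof. by move=> an; rewrite insubdK //; exact: (asboolP _ (valP x)). Qed.

Lemma inv_mul_scale a x : a \in n -> a *: x = inv_mul a x *: inv_one n.
Proof.
move=> an; apply: val_inj; rewrite !linearZ /=.
by apply: etrans (esym (inv_mulE x an)) _; exact/esym/(@mulr1 F).
Qed.

Lemma inv_mul_linear a b x y : a \in n -> inv_mul a (b *: x + y) = b * inv_mul a x + inv_mul a y.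
Proof.
move=> an; apply: val_inj; apply: etrans (inv_mulE _ an) _.
transitivity (val b * val (inv_mul a x) + val (inv_mul a y) : F); last by rewrite rmorphD rmorphM.
by rewrite !inv_mulE // mulrCA -mulrDr.
Qed.

Lemma inv_mul_one a : a \in n -> inv_mul a (inv_one n) = a.
Proof. by move=> an; apply: val_inj; apply: etrans (inv_mulE _ an) _; exact: (@mulr1 F). Qed.

End InverseModule.

Section KummerPairing.
Variables (p : nat) (Fq : finFieldType) (F : fieldExtType {fraction {poly Fq}}).
Variables (infty : dvaluation F) (K : fieldType) (v : dvaluation K).
Variables (iotaK : {rmorphism Fq -> K}) (D : drinfeld_module infty v iotaK).
Hypotheses (charFq : p \in [pchar Fq]) (localK : is_local_field v).
Variables (Ks : fieldType) (j : {rmorphism K -> Ks}).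
Hypothesis sepKs : separable_closure j.
Local Notation A := (regular_ring infty).
Local Notation act := (drinfeld_act D j).
Let pK : p \in [pchar K] := rmorph_pchar iotaK charFq.

Lemma drinfeld_actM a b x : act (a * b) x = act a (act b x).
Proof. by rewrite [RHS]points_scaleA. Qed.

Lemma drinfeld_actDl a b x : act (a + b) x = act a x + act b x.
Proof. exact: points_scaleDl. Qed.

Lemma drinfeld_act0 a : act a 0 = 0.
Proof. by rewrite -[X in act a X](subrr 0) drinfeld_actB subrr. Qed.

Lemma linear_act (n : {pred A}) (f : inv_module n -> points D j) b x : linear f ->
  f (b *: x) = act b (f x).
Proof.
move=> lin; have f0 : f 0 = 0.
  have := lin 1 0 0; rewrite scaler0 addr0 scale1r => /eqP.
  by rewrite -subr_eq subrr eq_sym => /eqP.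
by rewrite -[b *: x]addr0 lin f0 addr0.
Qed.

(** An A-linear map on the inverse of the ideal is thus determined up to a-torsion by its value at
    1. *)
Lemma linear_inv_mul (n : {pred A}) (f : inv_module n -> points D j) a x : linear f ->
  a \in n -> act a (f x) = act (inv_mul a x) (f (inv_one n)).
Proof. by move=> lin an; rewrite -!linear_act // inv_mul_scale. Qed.

Lemma root_exists a lambda : a \notin residual_char D -> exists mu, act a mu = j lambda.
Proof.
move=> aP; have [n [sz _ _]] := drinfeld_coefs aP.
have [||x] := sepKs.2 (map_poly j (root_poly D a lambda)).
- by rewrite separable_map (separable_root_poly charFq).
- by rewrite size_map_poly (size_root_poly _ aP sz) ltnS expn_gt0 (ltnW (card_Fq_gt1 Fq)).
by rewrite rootE root_polyE subr_eq0 => /eqP ax; exists x.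
Qed.

Lemma root_cover a lambda : a \notin residual_char D ->
  exists (L : splittingFieldType K) (w : dvaluation L) (e : nat) (i : {rmorphism L -> Ks}) (rs : seq L),
  [/\ galois 1%AS {:L}, (0 < e)%N & forall b : K, w b%:A = v b *+ e] /\
  [/\ forall b : K, i b%:A = j b, ring_generates rs &
    map_poly j (root_poly D a lambda) %= \prod_(r <- rs) ('X - (i r)%:P)].
Proof.
move=> aP; have [|L [i [rs [galL iK gen rsE]]]] := galois_cover sepKs (Ps := [:: root_poly D a lambda]).
  by rewrite /= (separable_root_poly charFq).
have [w [e [e_gt0 wK]]] := extension_exists localK pK L.
by exists L, w, e, i, rs; split=> //; split=> //; move: rsE; rewrite big_seq1.
Qed.

Section OneAutomorphism.
Variable g : inertia v j.

Lemma inertia_base b : g (j b) = j b.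
Proof. exact/aut_fix/base_unramified. Qed.

Lemma inertia_act a x : g (act a x) = act a (g x).
Proof.
exact: (drinfeld_act_rmorph D (h := (aut_fun g : {rmorphism Ks -> Ks})) a x inertia_base).
Qed.

Lemma inertia_torsion a z : a \notin residual_char D -> act a z = 0 -> g z = z.
Proof.
move=> aP az; have [L [w [e [i [rs [[galL e_gt0 wK] [iK gen rsE]]]]]]] := root_cover 0 aP.
have [|r _ rz] := cover_root rsE (y := z); first by rewrite az rmorph0.
have [s Gs gs] := inertia_restrict localK pK galL e_gt0 wK iK g.
rewrite -rz gs (torsion_fixed wK aP Gs) //.
by apply: (fmorph_inj i); rewrite (drinfeld_act_rmorph D (j := in_alg L) (h := i) a r iK) rz az rmorph0.
Qed.

Lemma inertia_roots a lambda mu : a \notin residual_char D -> act a mu = j lambda ->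
  act a (g mu - mu) = 0.
Proof. by move=> aP amu; rewrite drinfeld_actB -inertia_act amu inertia_base subrr. Qed.

Lemma inertia_root_unramified a lambda mu : a \notin residual_char D -> act a mu = j lambda ->
  height v lambda = 0%N -> g mu = mu.
Proof.
move=> aP amu h0; have [L [w [e [i [rs [[galL e_gt0 wK] [iK gen rsE]]]]]]] := root_cover lambda aP.
have [r rrs rmu] := cover_root rsE amu.
have [s Gs gs] := inertia_restrict localK pK galL e_gt0 wK iK g.
rewrite -rmu gs; congr (i _).
apply: (root_fixed_unramified wK aP _ h0 Gs).
exact: (cover_act iK rsE).
Qed.

Lemma upper_inertia_root a lambda mu : a \notin residual_char D -> act a mu = j lambda ->
  upper_inertia (height v lambda).+1%:R g -> g mu = mu.
Proof.
move=> aP amu gu; have [h0|h_gt0] := posnP (height v lambda).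
  exact: inertia_root_unramified amu h0.
have [L [w [e [i [rs [[galL e_gt0 wK] [iK gen rsE]]]]]]] := root_cover lambda aP.
have [n [sz _ _]] := drinfeld_coefs aP.
have [r rrs rmu] := cover_root rsE amu.
have [s su gs] := gu L w e i galL e_gt0 wK iK; rewrite -rmu gs; congr (i _).
exact: (upper_ram_trivial charFq localK galL e_gt0 wK aP (cover_act iK rsE rrs) sz h_gt0 erefl iK gen rsE su).
Qed.

Variable lambda : K.

(** The linear map required by the pairing sends [x] to the action of a x on [mu]; at 1 this is the
    action of [a] on [mu], that is [lambda]. *)
Lemma kummer_at_root (n : {pred A}) (t : tors D j n) a mu :
  a \in n -> act a mu = j lambda ->
  (forall x, t x = act (inv_mul a x) (g mu - mu)) -> kummer_at (j lambda : points D j) g t.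
Proof.
move=> an amu tE; exists (fun x => act (inv_mul a x) mu); split=> [b x y||x].
- by rewrite inv_mul_linear // drinfeld_actDl drinfeld_actM.
- by rewrite inv_mul_one.
by rewrite tE drinfeld_actB inertia_act.
Qed.

(** Two linear maps with value [lambda] at 1 differ by a-torsion points, for an [a] of the level
    prime to the residual characteristic, and [g] fixes these. *)
Lemma kummer_at_unique (n : level D) (t t' : tors D j n) :
  kummer_at (j lambda : points D j) g t -> kummer_at (j lambda : points D j) g t' ->
  t =1 t'.
Proof.
move=> [f [flin f1 tE]] [f' [flin' f1' tE']] x; have [a an aP] := lvl_residual n.
have : act a ((f x : Ks) - f' x) = 0 by rewrite drinfeld_actB !(linear_inv_mul _ _ an) // f1 f1' subrr.
move/(inertia_torsion aP); rewrite (autB g) tE tE' => gE.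
have swap (x1 x2 y1 y2 : Ks) : x1 - x2 = y1 - y2 -> x1 - y1 = x2 - y2.
  by move=> xy; rewrite -[x1](subrK x2) xy; ring.
exact: swap gE.
Qed.

End OneAutomorphism.

Lemma tors_eq (n : {pred A}) (t t' : tors D j n) : t =1 t' -> t = t'.
Proof.
case: t t' => [f fl fr] [f' fl' fr'] /= /funext ff'; subst f'.
by congr Tors; exact: Prop_irrelevance.
Qed.

Lemma tate_eq (t t' : tate D j) : (forall n, t n =1 t' n) -> t = t'.
Proof.
case: t t' => [f fc] [f' fc'] /= ff'.
have {}ff' : f = f' by apply: functional_extensionality_dep => n; exact: tors_eq.
by subst f'; congr Tate; exact: Prop_irrelevance.
Qed.

Lemma kummer_ad_eq (g : inertia v j) lambda (t : tate D j) :
  (forall n : level D, kummer_at (j lambda : points D j) g (t n)) ->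
  kummer_ad (j lambda : points D j) g = t.
Proof.
move=> tK; rewrite /kummer_ad; case: pselect => [ex|[]]; last by exists t.
by apply: tate_eq => n; apply: (kummer_at_unique (svalP (cid ex) n) (tK n)).
Qed.

Section Quotient.
Variable lambda : K.

Definition fixes_roots : set (inertia v j) := fun g =>
  forall a mu, a \notin residual_char D -> act a mu = j lambda -> g mu = mu.

(** The automorphisms fixing all roots form a closed subgroup. It contains commutators, since
    inertia translates roots by torsion points that it fixes, and p-th powers, since p times a
    translation is 0. Hence the pairing factors through J. *)
Lemma elem_ab_ker_fixes (g : inertia v j) : elem_ab_ker p g -> fixes_roots g.
Proof.
apply=> [|g' cl|x y|x] {g}.
- split=> [//|x y xH yH a mu aP amu].
  rewrite [LHS]/(x (aut_inv y mu)); have ymu := yH a mu aP amu.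
  by rewrite -{1}ymu autK; exact: xH aP amu.
- move=> a mu aP amu; have [h hH hg] := cl [:: mu].
  by rewrite -hg ?mem_head //; exact: hH aP amu.
- move=> a mu aP amu.
  have xy : x (y mu) = y (x mu).
    have tz (g : inertia v j) : act a (g mu - mu) = 0 by apply: (@inertia_roots _ _ lambda).
    have zx := inertia_torsion y aP (tz x); have zy := inertia_torsion x aP (tz y).
    by move: zx zy; rewrite (autB y) (autB x) => /eqP; rewrite subr_eq => /eqP-> /eqP;
      rewrite subr_eq => /eqP->; ring.
  rewrite [LHS]/(aut_inv x (aut_inv y (x (y mu)))) xy.
  exact: etrans (congr1 (aut_inv x) (autK y _)) (autK x _).
move=> a mu aP amu; pose z := x mu - mu.
have xz : x z = z by apply: (inertia_torsion x aP); apply: (@inertia_roots _ _ lambda).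
have xk k : (x ^+ k)%g mu = mu + z *+ k.
  elim: k => [|k IHk]; first by rewrite mulr0n addr0.
  rewrite expgS; apply: etrans (congr1 (aut_fun x) IHk) _.
  have -> : x (mu + z *+ k) = x mu + x z *+ k.
    by rewrite -[LHS]/((aut_fun x : {rmorphism Ks -> Ks}) _) rmorphD rmorphMn.
  by rewrite xz mulrS /z; ring.
have pKs : p \in [pchar Ks] by apply: (rmorph_pchar j pK).
by rewrite xk -mulr_natr (pcharf0 pKs) mulr0 addr0.
Qed.

Lemma repr_root (c : J v j p) (g : inertia v j) a mu : c = \pi_(J v j p) g ->
  a \notin residual_char D -> act a mu = j lambda -> generic_quotient.repr c mu = g mu.
Proof.
move=> cE aP amu.
have : elem_ab_ker p ((generic_quotient.repr c : inertia v j) * g^-1)%g.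
  have : generic_quotient.repr c = g %[mod elem_ab_quot (max_unramified v j) p] by rewrite reprK cE.
  by move/eqmodP/asboolP.
move/elem_ab_ker_fixes/(_ a (g mu) aP); rewrite -inertia_act amu inertia_base => /(_ erefl).
by rewrite [LHS]/(generic_quotient.repr c (aut_inv g (g mu))) autK.
Qed.

Lemma kummer_J_eq (c : J v j p) (g : inertia v j) (t : tate D j) : c = \pi_(J v j p) g ->
  (forall n : level D, exists a mu, [/\ a \in (n : {pred A}), a \notin residual_char D,
     act a mu = j lambda & forall x, t n x = act (inv_mul a x) (g mu - mu)]) ->
  kummer_J D lambda c = t.
Proof.
move=> cE tE; apply: kummer_ad_eq => n; have [a [mu [an aP amu tn]]] := tE n.
by apply: (kummer_at_root an amu) => x; rewrite (repr_root cE aP amu).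
Qed.

End Quotient.
End KummerPairing.

(** * Inverse limits of finite stages *)

Lemma mem_In (T : eqType) (x : T) (s : seq T) : List.In x s <-> x \in s.
Proof.
elim: s => //= y s [IHs sIH]; rewrite inE; split=> [[->|/IHs->]|/predU1P[->|/sIH]].
- by rewrite eqxx.
- by rewrite orbT.
- by left.
by right.
Qed.

Lemma principal_ideal (R : comNzRingType) (b : R) : (forall c, b * c <> 1) ->
  exists I : idealr R, forall x, x \in (I : {pred R}) <-> exists c, x = b * c.
Proof.
move=> b1; pose I : {pred R} := fun x => `[< exists c, x = b * c >].
have clI : idealr_closed I.
  split=> [||a x y].
  - by apply/asboolP; exists 0; rewrite mulr0.
  - by apply/asboolP => -[c /esym]; apply: b1.
  move=> /asboolP[c ->] /asboolP[d ->]; apply/asboolP; exists (a * c + d).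
  by rewrite mulrDr mulrCA.
pose J : idealr R := HB.pack I (isIdealr.Build R I clI).
by exists J => x; apply: iff_sym; apply: rwP; exact: asboolP.
Qed.

Section Stages.
Variables (K : fieldType) (v : dvaluation K) (p : nat).
Hypotheses (localK : is_local_field v) (pK : p \in [pchar K]).
Variables (Ks : fieldType) (j : {rmorphism K -> Ks}).
Hypothesis sepKs : separable_closure j.

Record stage := Stage {
  stage_field :> splittingFieldType K;
  stage_dval : dvaluation stage_field;
  stage_index : nat;
  stage_emb : {rmorphism stage_field -> Ks};
  stage_galois : galois 1%AS {:stage_field};
  stage_index_gt0 : (0 < stage_index)%N;
  stage_dvalK : forall a : K, stage_dval a%:A = v a *+ stage_index;
  stage_embK : forall a : K, stage_emb a%:A = j a
}.

Lemma stage_cover (zs : seq Ks) :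
  exists S : stage, forall z, z \in zs -> exists x, stage_emb S x = z.
Proof.
have /choice[P PP] z : exists Q : {poly K}, separable_poly Q /\ root (map_poly j Q) z.
  by have [Q sQ Qz] := sepKs.1 z; exists Q.
have [|L [i [rs [galL iK gen rsE]]]] := galois_cover sepKs (Ps := map P zs).
  by apply/allP => _ /mapP[z _ ->]; case: (PP z).
have [w [e [e_gt0 wK]]] := extension_exists localK pK L.
exists (Stage galL e_gt0 wK iK) => z zzs /=.
have : root (map_poly j (\prod_(Q <- map P zs) Q)) z.
  rewrite big_map (perm_big _ (perm_to_rem zzs)) big_cons rmorphM rootM.
  by have [_ ->] := PP z.
rewrite (eqp_root rsE) -(big_map i predT (fun x => 'X - x%:P)) root_prod_XsubC.
by case/mapP => r _ ->; exists r.
Qed.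

Lemma stage_inertia (S : stage) (u : rat) (s : gal_of {:S}) :
  upper_ram (stage_dval S) u s -> s \in inertia_set (stage_dval S).
Proof.
have [pi pi0 wpi] := uniformizer (stage_dval S); move=> [t [t0 _ st]].
by have [] := lower_ramP (stage_galois S) (pchar_ext pK S)
  (dval_gal localK pK (stage_index_gt0 S) (@stage_dvalK S))
  (ext_resid localK pK (stage_index_gt0 S) (@stage_dvalK S)) pi0 wpi s t0 st.
Qed.

(** Herbrand's theorem, as [upper_ram_lift], carries the automorphism up to a stage that also
    contains [zs]. *)
Lemma stage_extend (S1 : stage) (u : rat) (s1 : gal_of {:S1}) (zs : seq Ks) :
  upper_ram (stage_dval S1) u s1 ->
  exists (S : stage) (s : gal_of {:S}), [/\ upper_ram (stage_dval S) u s,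
    forall z, z \in zs -> exists x, stage_emb S x = z &
    forall x1, exists2 x, stage_emb S x = stage_emb S1 x1 &
      stage_emb S (s x) = stage_emb S1 (s1 x1)].
Proof.
move=> s1u; have [S SP] := stage_cover (zs ++ map (stage_emb S1) (vbasis {:S1})).
have [x x1|iota iotaE] := embedding (@stage_embK S1) (@stage_embK S).
  by apply: SP; rewrite mem_cat map_f ?orbT.
have [pi pi0 wpi] := uniformizer (stage_dval S).
have [pi1 pi10 wpi1] := uniformizer (stage_dval S1).
have [s su rs] := upper_ram_lift localK pK (stage_galois S1) (stage_index_gt0 S1)
  (@stage_dvalK S1) (stage_galois S) (stage_index_gt0 S) (@stage_dvalK S) iota
  pi10 wpi1 pi0 wpi s1u.
exists S, s; split=> // [z zzs|x1]; first by apply: SP; rewrite mem_cat zzs.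
by exists (iota x1); rewrite ?iotaE // restrictE rs iotaE.
Qed.

Lemma stage_one u : 0 <= u -> exists (S : stage) (s : gal_of {:S}), upper_ram (stage_dval S) u s.
Proof.
move=> u0; have [S _] := stage_cover [::]; exists S, 1%g.
have [pi pi0 wpi] := uniformizer (stage_dval S).
exact: (upper_ram1 localK pK (stage_galois S) (stage_index_gt0 S) (@stage_dvalK S) pi0 wpi).
Qed.

(** Extended by the identity outside the image of the stage, because [compactness] deals with total
    functions. *)
Definition stage_fun (S : stage) (s : gal_of {:S}) (y : Ks) : Ks :=
  match pselect (exists x, stage_emb S x = y) with
  | left ex => stage_emb S (s (sval (cid ex)))
  | right _ => y
  end.

Lemma stage_funE (S : stage) (s : gal_of {:S}) x :
  stage_fun s (stage_emb S x) = stage_emb S (s x).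
Proof.
rewrite /stage_fun; case: pselect => [ex|[]]; last by exists x.
by have /fmorph_inj-> := svalP (cid ex).
Qed.

Lemma roots_finite (x : Ks) : exists (P : {poly K}) (xs : seq Ks),
  root (map_poly j P) x /\ forall y, root (map_poly j P) y = (y \in xs).
Proof.
have [P sP Px] := sepKs.1 x.
have [|xs xsE] := separable_split sepKs (P := map_poly j P); first by rewrite separable_map.
exists P, xs; split=> // y; rewrite (eqp_root xsE) root_prod_XsubC //.
Qed.

(** The issue is surjectivity: an injective map preserving the finite set of roots of a polynomial
    over K permutes it. *)
Lemma field_aut_exists (f : Ks -> Ks) (U : set Ks) : zmod_morphism f -> monoid_morphism f ->
  (forall y, U y -> f y = y) -> (forall a, f (j a) = j a) ->
  exists g : field_aut U, g =1 f.
Proof.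
move=> fB fM fU fj.
pose fm : {rmorphism Ks -> Ks} := HB.pack f
  (GRing.isZmodMorphism.Build Ks Ks f fB) (GRing.isMonoidMorphism.Build Ks Ks f fM).
have f_inj : injective f := fmorph_inj fm.
have froot P x : root (map_poly j P) x -> root (map_poly j P) (f x).
  move=> Px; have -> : map_poly j P = map_poly fm (map_poly j P).
    by rewrite -map_poly_comp; apply: eq_map_poly => a; rewrite /= [RHS]fj.
  exact: (rmorph_root fm).
have f_surj y : exists x, f x = y.
  have [P [xs [Py xsP]]] := roots_finite y.
  have sub : {subset map f (undup xs) <= undup xs}.
    by move=> _ /mapP[x xxs ->]; move: xxs; rewrite !mem_undup -!xsP; apply: froot.
  have uxs : uniq (map f (undup xs)) by rewrite map_inj_uniq ?undup_uniq.
  have [|_ eqxs] := uniq_min_size uxs sub; first by rewrite size_map.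
  by have := eqxs y; rewrite mem_undup -xsP Py => /mapP[x _ ->]; exists x.
have /choice[f' f'K] := f_surj.
have fK : cancel f f' by move=> x; apply: f_inj; rewrite f'K.
by exists (FieldAut fK f'K fB fM fU).
Qed.

(** Conditions are of two kinds: [inl y] asks that the stage contain [y], [inr n] that [good n]
    hold. Each finite list is met at some stage, and [compactness] glues, for [y] can only be sent
    to a root of a polynomial over K vanishing at [y] once it lies in the stage. *)
Lemma inertia_limit (u : rat) (N : Type) (good : N -> Ks -> Prop) (c : N -> Ks) :
  (forall (ns : seq N), exists (S : stage) (s : gal_of {:S}), upper_ram (stage_dval S) u s /\
     forall n, List.In n ns -> exists x, stage_emb S x = c n /\ good n (stage_emb S (s x))) ->
  exists2 g : inertia v j, upper_inertia u g & forall n, good n (g (c n)).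
Proof.
move=> fin.
pose Good (s : seq (Ks + N)) (f : Ks -> Ks) := exists (S : stage) (sg : gal_of {:S}),
  [/\ upper_ram (stage_dval S) u sg, forall x, f (stage_emb S x) = stage_emb S (sg x),
      forall y, List.In (inl y) s -> exists x, stage_emb S x = y &
      forall n, List.In (inr n) s -> good n (f (c n))].
have /choice[fam famP] s : exists f, Good s f.
  pose ys := pmap (fun z => if z is inl y then Some y else None) s.
  pose ns := pmap (fun z => if z is inr n then Some n else None) s.
  have ysP y : List.In (inl y) s -> y \in ys.
    rewrite /ys; elim: s {ys ns} => //= -[y'|n] s IHs [].
    - by move=> [->]; rewrite mem_head.
    - by rewrite inE => /IHs->; rewrite orbT.
    - by [].
    exact: IHs.
  have nsP n : List.In (inr n) s -> List.In n ns.
    rewrite /ns; elim: s {ys ns ysP} => //= -[y'|n'] s IHs [] //.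
    - by move=> [->]; left.
    by move=> /IHs; right.
  have [S1 [s1 [s1u S1n]]] := fin ns.
  have [S [sg [su Sys Sx]]] := stage_extend ys s1u.
  exists (stage_fun sg), S, sg; split=> // [x|y /ysP/Sys//|n /nsP/S1n[x1 [x1n gn]]].
    exact: stage_funE.
  have [x xE sxE] := Sx x1.
  by rewrite -x1n -xE stage_funE sxE.
have /choice[r rP] y : exists xs : seq Ks, exists P : {poly K},
    root (map_poly j P) y /\ forall z, root (map_poly j P) z = (z \in xs).
  by have [P [xs H]] := roots_finite y; exists xs, P.
have [s y ys|f fP] := @compactness (Ks + N)%type Ks fam r inl.
  have [S [sg [_ fE fy _]]] := famP s; have [x xy] := fy y ys.
  have [P [Py PE]] := rP y; rewrite -PE -xy fE; move: Py; rewrite -xy.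
  have mapE (k : {rmorphism S -> Ks}) : (forall a : K, k a%:A = j a) ->
      map_poly j P = map_poly k (map_poly (in_alg S) P).
    by move=> kE; rewrite -map_poly_comp; apply: eq_map_poly => a; rewrite /= kE.
  rewrite (mapE (stage_emb S)); last exact: stage_embK.
  rewrite !fmorph_root => Px.
  have -> : map_poly (in_alg S) P = map_poly sg (map_poly (in_alg S) P).
    by rewrite -map_poly_comp; apply: eq_map_poly => a; rewrite /= gal_scalar.
  exact: rmorph_root.
(* Any finite part of [f] comes from one Galois automorphism, so the properties of [f] can be
   checked at a single stage. *)
have stageP (t : seq Ks) (ys : seq Ks) (ns : seq N) : exists (S : stage) (sg : gal_of {:S}),
    [/\ upper_ram (stage_dval S) u sg, forall x, stage_emb S x \in t -> f (stage_emb S x) = stage_emb S (sg x),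
        forall y, y \in ys -> exists x, stage_emb S x = y &
        forall n, List.In n ns -> c n \in t -> good n (f (c n))].
  have [s [us st]] := fP t (map inl ys ++ map inr ns); have [S [sg [su fE fy fn]]] := famP s.
  exists S, sg; split=> // [x xt|y yys|n nns cnt].
  - by rewrite st // fE.
  - apply/fy/us/List.in_app_iff; left; exact/List.in_map/(mem_In _ _).
  rewrite st //; apply/fn/us/List.in_app_iff; right; exact: List.in_map.
have fB : zmod_morphism f.
  move=> x y; have [S [sg [_ fE im _]]] := stageP [:: x; y; x - y] [:: x; y] [::].
  have [|x' xE] := im x; first exact: mem_head.
  have [|y' yE] := im y; first by rewrite !inE eqxx orbT.
  move: fE; rewrite -xE -yE -rmorphB => fE.
  by rewrite !fE ?inE ?eqxx ?orbT // !rmorphB.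
have fM : monoid_morphism f.
  split=> [|x y].
    have [S [sg [_ fE _ _]]] := stageP [:: 1] [::] [::].
    by rewrite -(rmorph1 (stage_emb S)) fE ?rmorph1 ?mem_head.
  have [S [sg [_ fE im _]]] := stageP [:: x; y; x * y] [:: x; y] [::].
  have [|x' xE] := im x; first exact: mem_head.
  have [|y' yE] := im y; first by rewrite !inE eqxx orbT.
  move: fE; rewrite -xE -yE -rmorphM => fE.
  by rewrite !fE ?inE ?eqxx ?orbT // !rmorphM.
have fU y : max_unramified v j y -> f y = y.
  move=> [L1 [w1 [i1 [i1K w1K [x xy]]]]].
  have [S [sg [su fE im _]]] := stageP [:: y] (map i1 (vbasis {:L1})) [::].
  have [x1 x1b|iota iotaE] := embedding i1K (@stage_embK S).
    by apply: im; rewrite map_f.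
  rewrite -xy -iotaE in fE *; rewrite fE ?mem_head //; congr (stage_emb S _).
exact: (unramified_fixed localK pK iota (stage_galois S) w1K (stage_index_gt0 S) (@stage_dvalK S)
    (stage_inertia su)).
have fj a : f (j a) = j a by exact/fU/base_unramified.
have [g gE] := field_aut_exists fB fM fU fj.
exists g => [L1 w1 e1 i1 galL1 e1_gt0 w1K i1K|n]; last first.
  have [S [sg [_ _ _ gn]]] := stageP [:: c n] [::] [:: n].
  by rewrite gE; apply: gn; [left | rewrite mem_head].
(* The field L1 embeds into a stage containing the images of a basis, and restriction to L1 respects
   the upper numbering. *)
have [S [sg [su fE im _]]] := stageP (map i1 (vbasis {:L1})) (map i1 (vbasis {:L1})) [::].
have [x1 x1b|iota iotaE] := embedding i1K (@stage_embK S).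
  by apply: im; rewrite map_f.
have [pi pi0 wpi] := uniformizer (stage_dval S).
have [pi1 pi10 wpi1] := uniformizer w1.
exists (restrict iota sg).
  exact: (upper_ram_restrict localK pK galL1 e1_gt0 w1K (stage_galois S) (stage_index_gt0 S)
    (@stage_dvalK S) iota pi10 wpi1 pi0 wpi su).
pose gm : {rmorphism Ks -> Ks} := aut_fun g.
have g1 x : x \in vbasis {:L1} -> gm (i1 x) = i1 (restrict iota sg x).
  by move=> xb; rewrite /gm /= gE -!iotaE -restrictE fE // iotaE map_f.
have scal (a : K) (x : L1) : a *: x = a%:A * x by rewrite mulr_algl.
move=> x; change (gm (i1 x) = i1 (restrict iota sg x)).
rewrite (coord_vbasis (memvf x)) !rmorph_sum; apply: eq_bigr => k _ /=.
have kb : (vbasis {:L1})`_k \in vbasis {:L1} by rewrite mem_nth // size_tuple.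
rewrite scal !rmorphM /= gal_scalar -(g1 _ kb) i1K; congr (_ * _).
by rewrite /gm /= gE fj.
Qed.

End Stages.

(** * Surjectivity *)

Section Surjectivity.
Variables (p : nat) (Fq : finFieldType) (F : fieldExtType {fraction {poly Fq}}).
Variables (infty : dvaluation F) (K : fieldType) (v : dvaluation K).
Variables (iotaK : {rmorphism Fq -> K}) (D : drinfeld_module infty v iotaK).
Hypotheses (charFq : p \in [pchar Fq]) (localK : is_local_field v).
Variables (Ks : fieldType) (j : {rmorphism K -> Ks}).
Hypothesis sepKs : separable_closure j.
Local Notation A := (regular_ring infty).
Local Notation act := (drinfeld_act D j).
Let pK : p \in [pchar K] := rmorph_pchar iotaK charFq.

Lemma residual_char1 : 1 \notin residual_char D.
Proof. by rewrite unfold_in /Defs.characteristic dmod1 coefC eqxx unfold_in /= oner_eq0 dval1. Qed.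

Lemma residual_charM a b : a \notin residual_char D -> b \notin residual_char D ->
  a * b \notin residual_char D.
Proof.
move=> aP bP; have [n [szn [a0 va] _]] := drinfeld_coefs aP.
have [m [szm [b0 vb] _]] := drinfeld_coefs bP.
have abE : drinfeld_coef D (a * b) 0 = drinfeld_coef D a 0 * drinfeld_coef D b 0.
  rewrite /drinfeld_coef dmodM /twisted_mul szn szm coef_sum (big_ord_recl n) [X in _ + X]big1.
    rewrite addr0 coef_sum (big_ord_recl m) [X in _ + X]big1.
      by rewrite addr0 coefZ coefXn mulr1 expn0 expr1 rmorphM.
    by move=> k _; rewrite coefZ coefXn mulr0.
  by move=> i _; rewrite coef_sum big1 // => k _; rewrite coefZ coefXn mulr0.
rewrite unfold_in /Defs.characteristic unfold_in -/(drinfeld_coef D (a * b) 0) abE.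
by rewrite mulf_eq0 (negPf a0) (negPf b0) dvalM // va vb.
Qed.

Variables (lambda : K) (t : tate D j).

Lemma nonresidual_multiple (s : seq A) : (forall a, a \in s -> a \notin residual_char D) ->
  exists2 b, b \notin residual_char D & forall a, a \in s -> exists c, b = a * c.
Proof.
elim: s => [|a s IHs] sP; first by exists 1; [exact: residual_char1|].
have [x xs|b bP bE] := IHs; first by apply: sP; rewrite inE xs orbT.
exists (a * b); first by apply: residual_charM => //; apply: sP; exact: mem_head.
move=> x; rewrite inE => /predU1P[->|/bE[c bc]]; first by exists b.
by exists (a * c); rewrite bc mulrCA.
Qed.

Lemma regular_eq0 (b : A) : (val b == 0 :> F) = (b == 0).
Proof. by rewrite -(inj_eq val_inj). Qed.

(** The point [z] is the value of [t] at the generator 1 / b of the inverse of the principal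
    ideal. *)
Lemma level_generator (b : A) : b \notin residual_char D -> (forall c, b * c <> 1) ->
  exists (m : level D) (z : Ks), [/\ forall x, x \in (m : {pred A}) <-> exists c, x = b * c,
    act b z = 0 & forall x : inv_module m, t m x = act (inv_mul b x) z].
Proof.
move=> bP b1; have b0 : val b != 0 :> F by rewrite regular_eq0 (nonresidual_neq0 bP).
have [I IE] := principal_ideal b1.
have Ib : b \in (I : {pred A}) by apply/IE; exists 1; rewrite mulr1.
pose m : level D := @Level _ _ _ _ _ _ D I (ex_intro2 _ _ b Ib bP).
have xb_inv : ((val b)^-1 : F) \in ideal_inv (I : {pred A}).
  apply/asboolP => a /IE[c ->].
  have -> : val (b * c) * (val b)^-1 = val c by rewrite rmorphM /= mulrAC divff // mul1r.
  exact: valP c.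
pose xb : inv_module m := Sub ((val b)^-1 : F) xb_inv.
have mb : b \in (m : {pred A}) := Ib.
have xbE : b *: xb = inv_one m.
  by apply: val_inj; rewrite linearZ; exact: (@mulfV F _ b0).
exists m, (t m xb : Ks); split=> [//||x].
  rewrite -(linear_act _ _ (tors_linear (t m))) xbE; apply: tors_regular.
  exact: (rpred1 (regular infty)).
rewrite -(linear_act _ _ (tors_linear (t m))); congr (t m _); apply: val_inj.
apply/esym.
transitivity (val (inv_mul b x) * (val b)^-1 : F); first by [].
have divK (y z : F) : y != 0 -> y * z * y^-1 = z by move=> y0; rewrite mulrAC divff ?mul1r.
by rewrite inv_mulE //; exact: divK.
Qed.

(* Levels are replaced by their elements, as [level D] lives in too large a universe to
   index an inverse limit. *)
Definition level_element (a : A) : Prop := a \notin residual_char D /\ forall c, a * c <> 1.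

Lemma level_elementP (n : level D) a : a \in (n : {pred A}) -> a \notin residual_char D ->
  level_element a.
Proof.
move=> an aP; split=> // c ac; have := idealMr c an.
by rewrite mulrC ac; apply/negP; rewrite (idealr1 (lvl n)).
Qed.

(** Let b = a c be a common multiple of the listed level elements, [z] its torsion point from
    [level_generator] and [r] a root for b. An automorphism sending [r] to [r + z] serves for every
    a: [mu a] is c r plus a torsion point fixed by inertia, so it moves by c z, and a y applied to c
    z is b y applied to z, which is [t] at y. *)
Lemma kummer_stage (mu : A -> Ks) (s : seq A) :
  coprime (height v lambda) p ->
  (forall a, level_element a -> act a (mu a) = j lambda) ->
  (forall a, ~ level_element a -> mu a = 0) ->
  exists (S : stage v j) (sg : gal_of {:S}), upper_ram (stage_dval S) (height v lambda)%:R sg /\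
    forall a, List.In a s -> exists x, stage_emb S x = mu a /\
      (level_element a -> forall n : level D, a \in (n : {pred A}) -> forall y : inv_module n,
        t n y = act (inv_mul a y) (stage_emb S (sg x) - mu a)).
Proof.
move=> coph muE mu0; pose s' := [seq a <- s | `[< level_element a >]].
have s'P a : a \in s' -> level_element a by rewrite mem_filter => /andP[/asboolP].
(* Without level elements the common multiple would be 1, which generates no proper ideal; any
   element of the upper group then serves. *)
case s'E : s' => [|a0 s0].
  have [S [sg su]] := stage_one localK pK sepKs (ler0n _ (height v lambda)).
  exists S, sg; split=> // a /mem_In sa; have aN : ~ level_element a.
    by move=> /asboolP aok; have : a \in s' by [rewrite mem_filter aok]; rewrite s'E.
  by exists 0; rewrite rmorph0 mu0.
have [b bP bE] := nonresidual_multiple (fun a as' => (s'P a as').1).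
have b1 c : b * c <> 1.
  have a0s : a0 \in s' by rewrite s'E mem_head.
  have [c0 ->] := bE a0 a0s; rewrite -mulrA; exact: (s'P a0 a0s).2.
have [m [z [mE bz tz]]] := level_generator bP b1.
have h_gt0 : (0 < height v lambda)%N.
  rewrite lt0n; apply: contraTneq coph => ->; rewrite /coprime gcd0n.
  by rewrite neq_ltn prime_gt1 ?orbT // (pcharf_prime charFq).
have [L [w [e [i [rs [[galL e_gt0 wK] [iK gen rsE]]]]]]] :=
  root_cover charFq localK sepKs lambda bP.
have actL a x : i (drinfeld_act D (in_alg L) a x) = act a (i x) :=
  drinfeld_act_rmorph D (j := in_alg L) (h := i) a x iK.
have [y0 y0E] := root_exists charFq sepKs lambda bP.
have [r rrs _] := cover_root rsE y0E.
have br := cover_act iK rsE rrs.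
have bir : act b (i r) = j lambda by rewrite -actL br iK.
have [d [sz _ _]] := drinfeld_coefs bP.
have [|sg su sr] := upper_ram_roots charFq localK galL e_gt0 wK bP br sz h_gt0 erefl iK gen rsE coph
  (y := i r + z); first by rewrite drinfeld_actD bir bz addr0.
pose S := Stage galL e_gt0 wK iK; exists S, sg; split=> // a /mem_In sa.
have Gs : sg \in inertia_set w := stage_inertia (S := S) localK pK su.
have [aok|aN] := pselect (level_element a); last by exists 0; rewrite rmorph0 mu0.
have [|c bc] := bE a; first by rewrite mem_filter sa andbT; apply/asboolP.
pose zeta := mu a - act c (i r).
have az : act a zeta = 0 by rewrite drinfeld_actB muE // -drinfeld_actM -bc bir subrr.
have bzeta : act b zeta = 0 by rewrite bc mulrC drinfeld_actM az drinfeld_act0.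
(* The torsion point [zeta] is realized in L as the difference [r2 - r] of two roots. *)
have [|r2 r2rs ir2] := cover_root rsE (y := i r + zeta).
  by rewrite drinfeld_actD bir bzeta addr0.
have fixz : sg (r2 - r) = r2 - r.
  apply: (torsion_fixed wK bP Gs); apply: (fmorph_inj i).
  by rewrite actL rmorphB /= ir2 addrAC subrr add0r bzeta rmorph0.
exists (drinfeld_act D (in_alg L) c r + (r2 - r)); split.
  by rewrite /= rmorphD /= actL rmorphB /= ir2 /zeta; ring.
move=> _ n an y; have sub : {subset (m : {pred A}) <= (n : {pred A})}.
  by move=> x /mE[k ->]; rewrite bc -mulrA mulrC; exact: (idealMr (c * k) an).
have y'P : val y \in ideal_inv (m : {pred A}).
  apply/asboolP => x /sub xn; exact: (asboolP _ (valP y)).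
pose y' : inv_module m := Sub (val y) y'P.
have mb : b \in (m : {pred A}) by apply/mE; exists 1; rewrite mulr1.
rewrite (tate_compat t sub (x := y) (x' := y')) // tz.
have -> : inv_mul b y' = inv_mul a y * c.
  apply: val_inj; apply: etrans (inv_mulE _ mb) _.
  transitivity (val (inv_mul a y) * val c : F); last by rewrite rmorphM.
  by rewrite (inv_mulE _ an) bc rmorphM; exact: (@mulrAC F).
rewrite drinfeld_actM; congr (act _ _).
have -> : sg (drinfeld_act D (in_alg L) c r + (r2 - r)) =
    drinfeld_act D (in_alg L) c (sg r) + (r2 - r).
  by rewrite rmorphD /= fixz act_gal.
rewrite /= rmorphD /= actL rmorphB /= ir2 sr drinfeld_actD /zeta; ring.
Qed.

Lemma kummer_upper_onto : coprime (height v lambda) p ->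
  exists2 c : J v j p, upper_J v j p (height v lambda)%:R c & kummer_J D lambda c = t.
Proof.
move=> coph.
have /choice[mu muE] a : exists x, (level_element a -> act a x = j lambda) /\
    (~ level_element a -> x = 0).
  have [[aP a1]|aN] := pselect (level_element a); last by exists 0.
  by have [x ax] := root_exists charFq sepKs lambda aP; exists x; split=> // -[].
pose good (a : A) (y : Ks) := level_element a -> forall n : level D, a \in (n : {pred A}) ->
  forall x : inv_module n, t n x = act (inv_mul a x) (y - mu a).
have [g gu gE] := inertia_limit localK pK sepKs (good := good)
  (fun s => kummer_stage s coph (fun a => (muE a).1) (fun a => (muE a).2)).
exists (\pi_(J v j p) g); first by exists g.
apply: (kummer_J_eq charFq localK sepKs erefl) => n.
have [a an aP] := lvl_residual n; have aok := level_elementP an aP.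
by exists a, (mu a); split=> //; [exact: (muE a).1 | exact: gE].
Qed.

Lemma kummer_trivial (c : J v j p) (g : inertia v j) : c = \pi_(J v j p) g ->
  (forall a mu, a \notin residual_char D -> act a mu = j lambda -> g mu = mu) ->
  kummer_J D lambda c = tate0 D j.
Proof.
move=> cE gmu; apply: (kummer_J_eq charFq localK sepKs cE) => n.
have [a an aP] := lvl_residual n; have [mu amu] := root_exists charFq sepKs lambda aP.
by exists a, mu; split=> // x; rewrite (gmu a) // subrr drinfeld_act0.
Qed.

End Surjectivity.

Theorem theorem3p6
  (p : nat) (Fq : finFieldType) (charFq : p \in [pchar Fq])
  (K : fieldType) (v : dvaluation K) (localK : is_local_field v)
  (iotaK : {rmorphism Fq -> K})
  (Ks : fieldType) (j : {rmorphism K -> Ks}) (sepKs : separable_closure j)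
  (F : fieldExtType {fraction {poly Fq}}) (infty : dvaluation F)
  (D : drinfeld_module infty v iotaK) (lambda : K) :
  [/\ (forall c : J v j p,
         upper_J v j p (height v lambda).+1%:R c ->
         kummer_J D lambda c = tate0 D j),
      (height v lambda = 0%N ->
         forall c : J v j p, kummer_J D lambda c = tate0 D j) &
      (coprime (height v lambda) p ->
         forall t : tate D j,
           exists2 c : J v j p,
             upper_J v j p (height v lambda)%:R c & kummer_J D lambda c = t)].
Proof.
split=> [c [g gu cE]|h0 c|coph t].
- apply: (kummer_trivial charFq localK sepKs cE) => a mu aP amu.
  exact: (upper_inertia_root charFq localK sepKs aP amu gu).
(* At height 0 the roots are integral, so every representative in the inertia group fixes them; the
   filtration does not enter. *)
- apply: (kummer_trivial charFq localK sepKs (esym (reprK c))) => a mu aP amu.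
  exact: (inertia_root_unramified charFq localK sepKs _ aP amu h0).
exact: kummer_upper_onto.
Qed.
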